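(* MEFE-Matching can be solved in polynomial time on instances in which the degree of every course is at most two. That is, there is a polynomial-time algorithm that, given such an instance, outputs a MEFE matching if one exists and correctly reports that none exists otherwise.
   Context: An instance of MEFE-Matching consists of: a finite set of courses $X=\{x_1,\dots,x_n\}$; a finite set of TAs $T=\{t_1,\dots,t_m\}$; for each TA $t_i$ a utility (valuation) function $u_i=u_{t_i}\colon X\to\mathbb{Z}_{\ge 0}$ and a grade function $g_i=g_{t_i}\colon X\to\mathbb{Q}_{\ge 0}$; for each course $x_i$ a capacity $c_i$ (a positive integer) and a utility (valuation) function $v_i=v_{x_i}\colon T\to\mathbb{Z}_{\ge 0}$, where for every TA $t$ and course $x_i$ one has $v_i(t)=0$ if $u_t(x_i)=0$ and $v_i(t)>0$ otherwise; and a number $k\in\mathbb{Q}_{\ge 0}$. All numbers are encoded in binary. The degree of a course is the number of TAs it values positively. A matching is a function $\mu\colon T\to X\cup\{\emptyset\}$, where $\mu(t)=\emptyset$ means $t$ is unassigned; by convention $u_t(\emptyset)=0$. It is feasible if $|\mu^{-1}(x_i)|=c_i$ for every course $x_i$ and no TA $t$ is assigned to a course $x$ with $u_t(x)=0$. A MEFE (merit-based envy-free egalitarian) matching is a feasible matching $\mu$ such that (1) (satisfaction of courses) for every course $x_i$, $\mathrm{AvgUtil}(x_i)=\frac{1}{c_i}\sum_{t\in\mu^{-1}(x_i)}v_i(t)\ge k$; and (2) (merit-based envy-freeness) there are no two TAs $t_i,t_j$ with $\mu(t_j)\in X$, $g_i(\mu(t_j))\ge g_j(\mu(t_j))$ and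 $u_i(\mu(t_j))>u_i(\mu(t_i))$. *)

(* Defs.v *)
From HB Require Import structures.
From mathcomp Require Import all_boot all_order all_algebra.

Set Implicit Arguments.
Unset Strict Implicit.
Unset Printing Implicit Defensive.

Import Order.TTheory GRing.Theory Num.Theory.

(* Deterministic multi-tape Turing machines over the alphabet {0, 1, #}. *)

Inductive letter := Bit of bool | Sep.

Definition letter_to_option (a : letter) : option bool :=
  if a is Bit b then Some b else None.
Definition option_to_letter (o : option bool) : letter :=
  if o is Some b then Bit b else Sep.
Lemma letter_to_optionK : cancel letter_to_option option_to_letter.
Proof. by case. Qed.
HB.instance Definition _ := Finite.copy letter (can_type letter_to_optionK).

(* [None] is the blank symbol. *)
Definition cell := option letter.

Inductive move := MoveLeft | Stay | MoveRight.

(* A two-way infinite tape.  [right_of] starts with the scanned cell and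
   [left_of] lists the cells to its left, nearest first; all cells beyond the
   two lists are blank. *)
Record tape := Tape { left_of : seq cell; right_of : seq cell }.

Definition read (tp : tape) : cell := head None (right_of tp).

Definition write_and_move (a : cell * move) (tp : tape) : tape :=
  let: Tape l r := tp in
  match a.2 with
  | MoveLeft => Tape (behead l) (head None l :: a.1 :: behead r)
  | Stay => Tape l (a.1 :: behead r)
  | MoveRight => Tape (a.1 :: l) (behead r)
  end.

Record machine := Machine {
  last_tape : nat;  (* the tapes are numbered 0, ..., last_tape *)
  state : finType;
  start : state;
  halting : pred state;
  transition : state -> {ffun 'I_last_tape.+1 -> cell} ->
               state * {ffun 'I_last_tape.+1 -> cell * move}
}.

Section Execution.
Variable M : machine.

Record config := Config {
  cstate : state M;
  ctapes : {ffun 'I_(last_tape M).+1 -> tape}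
}.

Definition step (C : config) : config :=
  if halting (cstate C) then C else
  let: (q, act) :=
    transition (cstate C) [ffun i => read (ctapes C i)] in
  Config q [ffun i => write_and_move (act i) (ctapes C i)].

Definition initial (w : seq letter) : config :=
  Config (start M)
    [ffun i => Tape [::] (if i == ord0 then map Some w else [::])].

Fixpoint until_blank (s : seq cell) : seq letter :=
  if s is Some a :: s' then a :: until_blank s' else [::].

(* The output is the blank-free word starting at the head of the last tape. *)
Definition output (C : config) : seq letter :=
  until_blank (right_of (ctapes C ord_max)).

Definition halts_within (w : seq letter) (t : nat) (w' : seq letter) : Prop :=
  let C := iter t step (initial w) in
  halting (cstate C) /\ output C = w'.

End Execution.

Record instance := Instance {
  ncourses : nat;
  nTAs : nat;
  TA_util : 'I_nTAs -> 'I_ncourses -> nat;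
  grade : 'I_nTAs -> 'I_ncourses -> rat;
  capacity : 'I_ncourses -> nat;
  course_util : 'I_ncourses -> 'I_nTAs -> nat;
  threshold : rat;
  grade_ge0 : forall t x, (0 <= grade t x)%R;
  capacity_gt0 : forall x, 0 < capacity x;
  course_util_eq0 : forall x t, (course_util x t == 0) = (TA_util t x == 0);
  threshold_ge0 : (0 <= threshold)%R
}.

Section Matching.
Variable I : instance.
Notation course := 'I_(ncourses I).
Notation TA := 'I_(nTAs I).

Definition degree (x : course) : nat := #|[set t : TA | 0 < course_util x t]|.

Definition matching := {ffun TA -> option course}.

Definition assigned (mu : matching) (x : course) : {set TA} :=
  [set t | mu t == Some x].

Definition util (t : TA) (o : option course) : nat :=
  if o is Some x then TA_util t x else 0.

Definition feasible (mu : matching) : Prop :=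
  (forall x, #|assigned mu x| = capacity x) /\
  (forall t x, mu t = Some x -> TA_util t x <> 0).

Definition avg_util (mu : matching) (x : course) : rat :=
  ((capacity x)%:R^-1 * \sum_(t in assigned mu x) (course_util x t)%:R)%R.

Definition merit_envy (mu : matching) (i j : TA) : Prop :=
  exists x, [/\ mu j = Some x, (grade j x <= grade i x)%R
              & util i (mu i) < util i (Some x)].

Definition MEFE (mu : matching) : Prop :=
  [/\ feasible mu,
      forall x, (threshold I <= avg_util mu x)%R
    & ~ exists i j, merit_envy mu i j].

End Matching.

(* Binary expansion, least significant bit first; 0 is the empty word. *)
Fixpoint positive_bits (p : BinNums.positive) : seq bool :=
  match p with
  | BinNums.xH => [:: true]
  | BinNums.xO p' => false :: positive_bits p'
  | BinNums.xI p' => true :: positive_bits p'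
  end.

Definition nat_bits (n : nat) : seq bool :=
  if bin_of_nat n is BinNums.Npos p then positive_bits p else [::].

Definition enc_nat (n : nat) : seq letter := rcons (map Bit (nat_bits n)) Sep.

Definition enc_rat (q : rat) : seq letter :=
  enc_nat `|numq q|%N ++ enc_nat `|denq q|%N.

(* The numbers of courses and TAs are written in unary, so that the length of
   an instance is at least the cardinality of its sets of courses and TAs. *)
Definition enc_card (n : nat) : seq letter := rcons (nseq n (Bit true)) Sep.

Definition enc_instance (I : instance) : seq letter :=
  enc_card (ncourses I) ++ enc_card (nTAs I) ++
  flatten [seq enc_nat (TA_util t x)
             | t <- enum 'I_(nTAs I), x <- enum 'I_(ncourses I)] ++
  flatten [seq enc_rat (grade t x)
             | t <- enum 'I_(nTAs I), x <- enum 'I_(ncourses I)] ++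
  flatten [seq enc_nat (capacity x) | x <- enum 'I_(ncourses I)] ++
  flatten [seq enc_nat (course_util x t)
             | x <- enum 'I_(ncourses I), t <- enum 'I_(nTAs I)] ++
  enc_rat (threshold I).

(* Course number j is written as j + 1, and 0 stands for "unassigned". *)
Definition enc_matching (I : instance) (mu : matching I) : seq letter :=
  flatten [seq enc_nat (if mu t is Some x then (nat_of_ord x).+1 else 0)
             | t <- enum 'I_(nTAs I)].

(* [None] is the answer that there is no MEFE matching. *)
Definition enc_answer (I : instance) (r : option (matching I)) : seq letter :=
  if r is Some mu then Bit true :: enc_matching mu else [:: Bit false].

Definition correct_answer (I : instance) (r : option (matching I)) : Prop :=
  if r is Some mu then MEFE mu else ~ exists mu : matching I, MEFE mu.

(* Main.v *)
(* When all degrees are at most two, a course of capacity one is an edge between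
   the TAs it values, and fixing the course of one TA r forces assignments: every
   other course of r goes to its other neighbour, whose remaining courses are then
   forced in turn.  Suppose a MEFE matching mu exists.  Map each TA to the other
   neighbour of its course in mu, or to itself if there is none; iterating this map
   from any TA runs into a cycle.  For r on the cycle, propagation from
   (r, mu(r)) covers exactly the connected component of r and recovers mu on it.
   As all conditions on a TA concern only its own component, one may try all pairs
   (r, course or nothing), keep every propagated assignment that is closed under
   adjacency and satisfies the conditions, and glue these over disjoint components.

   For the running time, the algorithm is written in a small imperative language
   whose values are bounded by the constant L = 8 |w| + 1 and whose loops are
   bounded by values, so that every program compiles to a Turing machine that runs
   in time polynomial in |w|.  A value v is stored as a head position, and the four
   arrays of the algorithm are tapes. *)

From HB Require Import structures.
From mathcomp Require Import all_boot all_order all_algebra.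
From mathcomp Require Import zify.
Require Import Defs.

Set Implicit Arguments.
Unset Strict Implicit.
Unset Printing Implicit Defensive.

(** * Propagation of forced assignments *)

(** A positive answer is backed by a final test of the glued assignment, so the propagation argument
    mainly serves completeness: if a solution exists, the glued assignment passes that test. The
    accepted candidates need not come from this solution; it only guarantees that every component
    gets covered. On the machine side the obstacle is that utilities, grades and capacities are
    binary, hence possibly exponential in [|w|], while a counter holds values up to [L] only.
    Capacities are merely compared with 1 and 2, and every other comparison becomes, with
    denominators cleared, an inequality between products. It is decided by adding up the columns of
    both schoolbook products from the low end, keeping only the carry, which is linear in [|w|]. The
    factor 8 in [L] is what this takes: an offset of [2|w|] makes the carry nonnegative, and
    intermediate sums reach four times the offset. The summand 1 is the cell that marks zero on a
    counter. *)

Section Propagation.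
Variables (T X : finType) (inc : T -> X -> bool) (cap : X -> nat).
Variables (avg1 : T -> X -> bool) (avg2 : T -> T -> X -> bool).
Variables (beats : T -> T -> X -> bool) (util_le : T -> X -> X -> bool).
Implicit Types (E R : {set T * X}) (C : {set T}) (r s t : T) (x y z : X).

(** A course of degree at most two with a larger capacity can never be filled, so such a capacity
    fails. For capacity two no uniqueness is tested, as two distinct TAs already exhaust the
    course. *)
Definition course_ok E y : bool :=
  (cap y == 1) && [exists s, [&& (s, y) \in E,
     [forall s', ((s', y) \in E) ==> (s' == s)] & avg1 s y]]
  || (cap y == 2) && [exists s, exists s', [&& s != s', (s, y) \in E,
     (s', y) \in E & avg2 s s' y]].

Definition single E s : bool :=
  [forall y, forall y', ((s, y) \in E) && ((s, y') \in E) ==> (y == y')].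

(** An unassigned [s] has utility 0 and prefers every [x] with [inc s x]; the existential over [y]
    makes it fail, as it should. *)
Definition no_envy E s : bool :=
  [forall x, forall s', [&& inc s x, (s', x) \in E & beats s s' x] ==>
     [exists y, ((s, y) \in E) && util_le s x y]].

Definition ok E s : bool :=
  [&& single E s, no_envy E s & [forall y, inc s y ==> course_ok E y]].

(** The root is included explicitly: guessed to be unassigned, it holds no edge, yet its
    neighbourhood must be checked. *)
Definition touched E r s : bool := (s == r) || [exists z, (s, z) \in E].

Definition good E r : bool :=
  [forall s, touched E r s ==> ok E s &&
     [forall y, inc s y ==> [forall s', inc s' y ==> touched E r s']]].

Definition forced E r (o : option X) t x : bool :=
  inc t x && [|| (t, x) \in E, (t == r) && (Some x == o) |
    [exists s, [&& s != t, inc s x &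
       [|| [exists z, ((s, z) \in E) && (z != x)], (s == r) && (Some x != o) |
           ((s, x) \in E) && (cap x == 2)]]]].

Definition propagate r o E : {set T * X} := [set p | forced E r o p.1 p.2].

Definition closure K r o := iter K (propagate r o) set0.

Definition process K (RC : {set T * X} * {set T}) (c : T * option X) :=
  let E := closure K c.1 c.2 in
  if (c.1 \notin RC.2) && good E c.1
  then (RC.1 :|: E, RC.2 :|: [set s | touched E c.1 s]) else RC.

(** [ok] examines a course only through its incident TAs, so a course without any, which cannot
    reach its positive capacity, is ruled out separately. *)
Definition final_ok E : bool :=
  [forall s, ok E s] && [forall y, exists s, inc s y].

Definition adjacency_closed (C : {set T}) :=
  forall s s' y, s \in C -> inc s y -> inc s' y -> s' \in C.

Definition within E := forall s y, (s, y) \in E -> inc s y.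

Lemma propagate_mono r o E E' : E \subset E' -> propagate r o E \subset propagate r o E'.
Proof.
move=> /subsetP EE; apply/subsetP => -[t x]; rewrite !inE /forced /=.
case/andP=> -> /or3P[/EE->//|->|/existsP[s /and3P[st sx H]]]; rewrite ?orbT //=.
apply/or3P/Or33/existsP; exists s; rewrite st sx /=.
case/or3P: H => [/existsP[z /andP[/EE sz zx]]|->|/andP[/EE-> ->]]; rewrite ?orbT //.
by apply/or3P/Or31/existsP; exists z; rewrite sz zx.
Qed.

Lemma closure_fix K r o : #|{: T * X}| <= K ->
  propagate r o (closure K r o) = closure K r o.
Proof.
move=> le; have mono : {homo propagate r o : A B / A \subset B}.
  by move=> A B; apply: propagate_mono.
rewrite /closure -(subnK le) iterD.
have -> : iter #|{: T * X}| (propagate r o) set0 = fixset (propagate r o) by [].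
have fixE := fixsetK mono.
by elim: (K - _) => [|k IH]; [exact: fixE|rewrite iterS IH IH].
Qed.

(** The step also receives that the current stage lies in the final closure; this lets
    [touched_backward] turn an edge of a stage into a TA touched by the closure. *)
Lemma closure_ind K r o (P : T -> X -> Prop) :
  (forall E, (forall t x, (t, x) \in E -> P t x) ->
     E \subset closure K r o -> forall t x, forced E r o t x -> P t x) ->
  #|{: T * X}| <= K -> forall t x, (t, x) \in closure K r o -> P t x.
Proof.
move=> step le.
suff H k : k <= K -> forall t x, (t, x) \in closure k r o -> P t x by exact: H.
elim: k => [|k IH] kK t x; first by rewrite inE.
rewrite /closure iterS inE; apply: step; first exact: (IH (ltnW kK)).
have sub j : closure j r o \subset closure j.+1 r o.
  elim: j => [|j]; first exact: sub0set.
  exact: propagate_mono.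
rewrite -(subnKC (ltnW kK)); elim: (K - k) => [|d]; first by rewrite addn0.
by move=> /subset_trans; apply; rewrite addnS; apply: sub.
Qed.

Lemma closure_within K r o : within (closure K r o).
Proof. by case: K => [|K] s y; rewrite /closure ?iterS inE //= => /andP[]. Qed.

Lemma eq_course_ok E E' y : (forall s, ((s, y) \in E) = ((s, y) \in E')) ->
  course_ok E y = course_ok E' y.
Proof.
move=> H; rewrite /course_ok; congr (_ && _ || _ && _).
  apply: eq_existsb => s; rewrite H; congr [&& _, _ & _].
  by apply: eq_forallb => s'; rewrite H.
by apply: eq_existsb => s; apply: eq_existsb => s'; rewrite !H.
Qed.

(** Locality: only edges at [s] and at courses incident with [s] matter. Every transfer of [ok]
    between a component, the union of components and a solution goes through this. *)
Lemma eq_ok E E' s :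
  (forall s' y, s' = s \/ inc s y -> ((s', y) \in E) = ((s', y) \in E')) ->
  ok E s = ok E' s.
Proof.
move=> H; rewrite /ok; congr [&& _, _ & _].
- by apply: eq_forallb => y; apply: eq_forallb => y'; rewrite !H; try by left.
- apply: eq_forallb => x; apply: eq_forallb => s'.
  case sx: (inc s x) => //=; rewrite H; last by right.
  by congr (_ ==> _); apply: eq_existsb => y; rewrite H //; left.
- apply: eq_forallb => y; case sy: (inc s y) => //=.
  by apply: eq_course_ok => s'; apply: H; right.
Qed.

Lemma goodP E r s : good E r -> touched E r s ->
  ok E s /\ forall y s', inc s y -> inc s' y -> touched E r s'.
Proof.
move=> /forallP/(_ s)/implyP H /H/andP[oks /forallP cl]; split=> // y s' sy s'y.
by have /implyP/(_ sy)/forallP/(_ s')/implyP/(_ s'y) := cl y.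
Qed.

Definition invariant (RC : {set T * X} * {set T}) :=
  [/\ adjacency_closed RC.2, within RC.1,
      forall s y, (s, y) \in RC.1 -> s \in RC.2
    & forall s, s \in RC.2 -> ok RC.1 s].

(** Each forcing rule passes from [s] to [t] through a shared course, so it cannot enter an
    adjacency-closed set from outside. *)
Lemma closure_avoids K C r o : #|{: T * X}| <= K -> adjacency_closed C -> r \notin C ->
  forall s, touched (closure K r o) r s -> s \notin C.
Proof.
move=> le cl rC s /orP[/eqP->//|/existsP[z]].
move: s z; apply: closure_ind le => E IH _ t x /andP[tx].
case/or3P=> [/IH//|/andP[/eqP-> _]//|/existsP[s /and3P[_ sx H]]].
have : s \notin C.
  by case/or3P: H => [/existsP[z /andP[/IH]]|/andP[/eqP-> _]//|/andP[/IH]].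
by apply: contra => tC; apply: cl tC tx sx.
Qed.

(** The covered set and the newly touched set are disjoint and both closed under adjacency. No TA
    sees an edge of the other side, so by locality the union preserves [ok] on both. *)
Lemma process_invariant K RC c : #|{: T * X}| <= K -> invariant RC -> invariant (process K RC c).
Proof.
case: RC c => R C [r o] le [] /= cl RI RC okR.
rewrite /process /=; case: ifP => //= /andP[rC gE].
set E := closure K r o in gE *.
have EI : within E by apply: closure_within.
have av s : touched E r s -> s \notin C by apply: closure_avoids.
have tE s y : (s, y) \in E -> touched E r s.
  by move=> sy; apply/orP; right; apply/existsP; exists y.
split=> /=.
- move=> s s' y; rewrite !inE => /orP[sC|ts] sy s'y; first by rewrite (cl _ _ _ sC sy s'y).
  by have [_ /(_ _ _ sy s'y)->] := goodP gE ts; rewrite orbT.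
- by move=> s y; rewrite inE => /orP[/RI|/EI].
- by move=> s y; rewrite !inE => /orP[/RC->//|/tE->]; rewrite orbT.
- move=> s; rewrite !inE => /orP[sC|ts].
    rewrite (@eq_ok _ R) ?okR // => s' y H; rewrite inE.
    case s'y: ((s', y) \in E); rewrite ?orbF //.
    have /negP[] := av _ (tE _ _ s'y).
    by case: H => [->//|sy]; apply: cl sC sy (EI _ _ s'y).
  have [okE clE] := goodP gE ts.
  rewrite (@eq_ok _ E) // => s' y H; rewrite inE.
  case s'y: ((s', y) \in R) => //=.
  have : touched E r s' by case: H => [->//|sy]; apply: clE sy (RI _ _ s'y).
  by move/av/negP=> [];  apply: RC s'y.
Qed.

Lemma process_mono K (RC : {set T * X} * {set T}) c : RC.2 \subset (process K RC c).2.
Proof. by rewrite /process; case: ifP => //= _; apply: subsetUl. Qed.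

Lemma process_good K (RC : {set T * X} * {set T}) c :
  good (closure K c.1 c.2) c.1 -> c.1 \in (process K RC c).2.
Proof.
move=> g; rewrite /process g andbT; case: ifP => [_|/negbFE//] /=.
by rewrite !inE /touched eqxx orbT.
Qed.

(** * Completeness: a solution [S] makes the candidates on its cycles acceptable *)

Section Completeness.
Variables (K : nat) (S : {set T * X}).
Hypotheses (K_large : #|{: T * X}| <= K) (S_within : within S) (S_ok : final_ok S).
Hypothesis degree_le2 : forall x r s t, inc r x -> inc s x -> inc t x ->
  r != s -> t != s -> t = r.

Lemma S_single s y y' : (s, y) \in S -> (s, y') \in S -> y = y'.
Proof.
have /andP[/forallP/(_ s)/and3P[/forallP/(_ y)/forallP/(_ y')/implyP H _ _] _] := S_ok.
by move=> sy sy'; apply/eqP; apply: H; rewrite sy.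
Qed.

Lemma S_course y : course_ok S y.
Proof.
have /andP[/forallP A /forallP/(_ y)/existsP[s sy]] := S_ok.
by have /and3P[_ _ /forallP/(_ y)/implyP/(_ sy)] := A s.
Qed.

(** Some TA fills [x] in [S]; it is not [s], and the degree bound leaves only [t]. *)
Lemma S_other s t x : s != t -> inc s x -> inc t x -> (s, x) \notin S -> (t, x) \in S.
Proof.
move=> st sx tx nsx.
have [a ax] : exists a, (a, x) \in S.
  have /orP[] := S_course x; first by case/andP=> _ /existsP[a /and3P[]]; exists a.
  by case/andP=> _ /existsP[a /existsP[b /and4P[]]]; exists a.
have as_ : a != s by apply: contraNneq nsx => <-.
by rewrite -(degree_le2 tx sx (S_within ax) _ as_) // eq_sym.
Qed.

Lemma S_two s t x : s != t -> (s, x) \in S -> (t, x) \in S -> cap x == 2.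
Proof.
move=> st sx tx; have /orP[/andP[_ /existsP[a /and3P[_ /forallP U _]]]|/andP[]//] := S_course x.
have /eqP ea := implyP (U s) sx; have /eqP eb := implyP (U t) tx.
by rewrite ea eb eqxx in st.
Qed.

Lemma S_cap2 s t x : s != t -> inc s x -> inc t x -> cap x == 2 -> (t, x) \in S.
Proof.
move=> st sx tx c2.
have /orP[/andP[/eqP c1]|/andP[_ /existsP[a /existsP[b /and4P[ab ax bx _]]]]] := S_course x.
  by rewrite c1 in c2.
have [<-//|at_] := eqVneq a t.
have [<-//|bt] := eqVneq b t.
have ea := degree_le2 sx tx (S_within ax) st at_.
have eb := degree_le2 sx tx (S_within bx) st bt.
by rewrite ea eb eqxx in ab.
Qed.

Definition partner s : option X := [pick y | (s, y) \in S].

Lemma partnerP s y : ((s, y) \in S) = (partner s == Some y).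
Proof.
rewrite /partner; case: pickP => [z sz|no]; last by rewrite no.
by apply/idP/eqP => [/S_single/(_ sz)->|[<-]].
Qed.

Definition other s : T :=
  if partner s is Some y then odflt s [pick t | (t != s) && inc t y] else s.

Lemma other_eq s t y : (s, y) \in S -> t != s -> inc t y -> other s = t.
Proof.
move=> sy ts ty; have := sy; rewrite partnerP /other => /eqP->.
case: pickP => [t' /andP[t's t'y]|/(_ t)] /=; last by rewrite ts ty.
exact: degree_le2 ty (S_within sy) t'y ts t's.
Qed.

Lemma otherP s : other s != s -> exists y, [/\ (s, y) \in S, inc s y & inc (other s) y].
Proof.
rewrite /other; case E: (partner s) => [y|]; last by rewrite eqxx.
case: pickP => [t /andP[ts ty] _|]; last by rewrite eqxx.
by exists y; split=> //; [rewrite partnerP E|apply: S_within; rewrite partnerP E].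
Qed.

(** Consecutive points of an orbit coincide or share a course, so membership travels backwards along
    the orbit. *)
Lemma closed_other C s k : adjacency_closed C -> iter k other s \in C -> s \in C.
Proof.
move=> cl; elim: k => //= k IH H; apply: IH.
have [e|no] := eqVneq (other (iter k other s)) (iter k other s); first by rewrite -e.
by have [y [_ sy oy]] := otherP no; apply: cl H oy sy.
Qed.

Section Candidate.
Variables (r : T) (p : nat).
Hypothesis r_cycle : iter p.+1 other r = r.
Let E := closure K r (partner r).
Let E_fix : propagate r (partner r) E = E := closure_fix r (partner r) K_large.

(** With the correct guess for [r], every forcing rule is a valid inference about [S]. *)
Lemma closure_sub s y : (s, y) \in E -> (s, y) \in S.
Proof.
move: s y; apply: closure_ind K_large => E' IH _ t x /andP[tx].
case/or3P=> [/IH//|/andP[/eqP-> /eqP e]|/existsP[s /and3P[st sx H]]].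
  by rewrite partnerP e.
case/or3P: H => [/existsP[z /andP[/IH sz zx]]|/andP[/eqP e no]|/andP[/IH sx' c2]].
- apply: S_other st sx tx _; apply: contra zx => sx'.
  by rewrite (S_single sz sx').
- by apply: S_other st sx tx _; rewrite e partnerP eq_sym.
- exact: S_cap2 st sx tx c2.
Qed.

Lemma forcedE s y : forced E r (partner r) s y -> (s, y) \in E.
Proof. by move=> F; rewrite -E_fix inE. Qed.

(** A touched TA other than the root has an edge in [E], which lies in [S] and is therefore its only
    edge there; the edge of the root is the guess. *)
Lemma touched_row s y : touched E r s -> (s, y) \in S -> (s, y) \in E.
Proof.
move=> /orP[/eqP->|/existsP[z sz]] sy; last by rewrite (S_single sy (closure_sub sz)).
apply: forcedE; rewrite /forced (S_within sy) eqxx /=.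
by have := sy; rewrite partnerP => /eqP->; rewrite eqxx orbT.
Qed.

Lemma touched_edge s y : (s, y) \in E -> touched E r s.
Proof. by move=> sy; apply/orP; right; apply/existsP; exists y. Qed.

(** If [s] also holds [y] in [S], then the capacity is two and that rule fires; otherwise [s] is
    placed elsewhere or is a root without [y], and one of the other rules fires. *)
Lemma touched_forward s t y : touched E r s -> t != s -> inc s y -> (t, y) \in S ->
  touched E r t.
Proof.
move=> ts nts sy ty; apply: (@touched_edge _ y); apply: forcedE.
rewrite /forced (S_within ty) /=; apply/or3P/Or33/existsP; exists s.
rewrite eq_sym nts sy /=.
case sy': ((s, y) \in S).
  by rewrite (touched_row ts sy') (S_two nts ty sy') !orbT.
case/orP: ts => [/eqP e|/existsP[z sz]].
  by rewrite e eqxx eq_sym -partnerP -e sy' /= orbT.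
apply/or3P/Or31/existsP; exists z; rewrite sz /=.
by apply: contraFneq sy' => <-; apply: closure_sub.
Qed.

(** The edge of a TA other than [r] was forced from a second neighbour of [y], which is touched; by
    the degree bound this neighbour is [t]. *)
Lemma touched_backward s t y : s != r -> (s, y) \in E -> t != s -> inc t y ->
  touched E r t.
Proof.
move=> + sy; move: s y sy t.
suff H s y : (s, y) \in E -> forall t, s != r -> t != s -> inc t y -> touched E r t.
  by move=> s y sy t sr; apply: H sy _ sr.
move: s y; apply: closure_ind K_large => E' IH /subsetP E'E s y /andP[sy].
case/or3P=> [sy' t|/andP[/eqP-> _] t|/existsP[a /and3P[as_ ay H]] t] sr ts ty.
- exact: IH sy' t sr ts ty.
- by rewrite eqxx in sr.
- have -> : t = a by apply: degree_le2 ay sy ty as_ ts.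
  case/or3P: H => [/existsP[z /andP[az _]]|/andP[/eqP-> _]|/andP[az _]].
  + exact: touched_edge (E'E _ az).
  + by rewrite /touched eqxx.
  + exact: touched_edge (E'E _ az).
Qed.

Lemma touched_other s : touched E r (other s) -> touched E r s.
Proof.
have [->//|no] := eqVneq (other s) s.
have [y [sy _ oy]] := otherP no.
by move=> to; apply: touched_forward to _ oy sy; rewrite eq_sym.
Qed.

(* The delicate case is the course of [r] itself: propagation leaves [r] only
   along its other courses, but the cycle leads from [other r] back to [r], so
   [other r] is reached from behind. *)
Lemma touched_closed s t y : touched E r s -> inc s y -> inc t y -> touched E r t.
Proof.
move=> ts sy ty; have [->//|nts] := eqVneq t s.
case ty': ((t, y) \in S); first exact: touched_forward ts nts sy ty'.
have sy' : (s, y) \in S by apply: S_other nts ty sy _; rewrite ty'.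
have [e|sr] := eqVneq s r; last exact: touched_backward sr (touched_row ts sy') nts ty.
have <- : other s = t by apply: other_eq sy' nts ty.
rewrite e; have : touched E r (iter p.+1 other r) by rewrite r_cycle /touched eqxx.
rewrite iterSr; elim: p (other r) => //= k IH x /touched_other; exact: IH.
Qed.

(** On the touched TAs, which are closed under adjacency, [E] and [S] have the same edges, so [ok]
    carries over from [S] by locality. *)
Lemma candidate_good : good E r.
Proof.
apply/forallP => s; apply/implyP => ts; apply/andP; split; last first.
  apply/forallP => y; apply/implyP => sy; apply/forallP => t; apply/implyP => ty.
  exact: touched_closed ts sy ty.
have /andP[/forallP/(_ s) okS _] := S_ok.
rewrite (@eq_ok _ S) // => t y H; apply/idP/idP => [/closure_sub//|ty].
apply: (touched_row _ ty); case: H => [->//|sy].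
exact: touched_closed ts sy (S_within ty).
Qed.

End Candidate.

Lemma exists_cycle s : exists i p, iter p.+1 other (iter i other s) = iter i other s.
Proof.
have /trajectP[i i_lt E] := looping_order other s.
exists i, (fingraph.order other s - i.+1).
rewrite -iterD.
have -> : (fingraph.order other s - i.+1).+1 + i = fingraph.order other s by lia.
exact: E.
Qed.

(** A TA on a cycle of [other] is covered at the latest when its own correct candidate is tried, and
    covered TAs satisfy [ok] by the invariant. *)
Lemma process_all (cands : seq (T * option X)) : (forall c, c \in cands) ->
  final_ok (foldl (process K) (set0, set0) cands).1.
Proof.
move=> all_c; set RC := foldl _ _ _.
have inv : invariant RC.
  rewrite /RC; have : invariant (set0, set0).
    by split=> [s|s|s|s]; rewrite ?inE //= => y; rewrite inE.
  elim: cands (set0, set0) {all_c RC} => //= c cs IH RC inv.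
  exact/IH/process_invariant.
have mono cs (RC0 : {set T * X} * {set T}) : RC0.2 \subset (foldl (process K) RC0 cs).2.
  elim: cs RC0 => //= c cs IH RC0; exact: subset_trans (process_mono _ _ _) (IH _).
have cov r : good (closure K r (partner r)) r -> r \in RC.2.
  move=> g; rewrite /RC; have := all_c (r, partner r).
  elim: (cands) (set0, set0) => //= c cs IH RC0; rewrite inE => /orP[/eqP<-|]; last exact: IH.
  by apply: (subsetP (mono _ _)); apply: process_good.
(* That every course has an incident TA concerns the instance alone, so it can be taken from [S]. *)
case: inv => cl _ _ okR; apply/andP; split; last by case/andP: S_ok.
apply/forallP => s; apply: okR.
have [i [p E]] := exists_cycle s.
(* The orbit of [s] enters the cycle after [i] steps; coverage is pulled back from there. *)
apply: (closed_other (k := i) cl); apply: cov.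
exact: candidate_good E.
Qed.

End Completeness.

End Propagation.

(** * Structured programs for Turing machines *)

(** Tapes are indexed by all naturals so that commands compose without recording how many tapes they
    use; a finite number is fixed only in [machine_of]. *)
Definition tapes := nat -> tape.
Definition action := nat -> cell -> cell * move.
Definition act (g : action) (T : tapes) : tapes :=
  fun k => write_and_move (g k (read (T k))) (T k).
Definition idle : action := fun _ a => (a, Stay).

Inductive cmd :=
| Do of action
| Seq of cmd & cmd
| Cond of nat & pred cell & cmd & cmd
| While of nat & pred cell & cmd.

Fixpoint control (c : cmd) : finType :=
  match c with
  | Do _ => unit
  | Seq a b => (control a + control b)%type
  | Cond _ _ a b => option (control a + control b)
  | While _ _ a => option (control a)
  end.

Fixpoint entry (c : cmd) : control c :=
  match c return control c with
  | Do _ => tt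
  | Seq a b => inl (entry a)
  | Cond _ _ a b => None
  | While _ _ a => None
  end.

(* The control point [None] of a conditional or a loop is its test; as a next
   control point, the outer [None] means that the command is finished. *)
Fixpoint next (c : cmd) (rd : nat -> cell) : control c -> option (control c) * action :=
  match c return control c -> option (control c) * action with
  | Do g => fun _ => (None, g)
  | Seq a b => fun q =>
      match q with
      | inl q1 => let: (o, g) := next rd q1 in
                  (Some (if o is Some q' then inl q' else inr (entry b)), g)
      | inr q2 => let: (o, g) := next rd q2 in (omap inr o, g)
      end
  | Cond k P a b => fun q =>
      match q with
      | None => (Some (Some (if P (rd k) then inl (entry a) else inr (entry b))), idle)
      | Some (inl q1) => let: (o, g) := next rd q1 in (omap (fun q' => Some (inl q')) o, g)
      | Some (inr q2) => let: (o, g) := next rd q2 in (omap (fun q' => Some (inr q')) o, g)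
      end
  | While k P a => fun q =>
      match q with
      | None => (if P (rd k) then Some (Some (entry a)) else None, idle)
      | Some q1 => let: (o, g) := next rd q1 in (Some o, g)
      end
  end.

Definition reads (T : tapes) : nat -> cell := fun k => read (T k).

Inductive runs (c : cmd) : control c -> tapes -> nat -> tapes -> Prop :=
| runs_exit q T g : next (reads T) q = (None, g) -> runs q T 1 (act g T)
| runs_step q q' T g n T' : next (reads T) q = (Some q', g) ->
    runs q' (act g T) n T' -> runs q T n.+1 T'.

Definition exec c := runs (entry c).

Lemma exec_Do g T : exec (Do g) T 1 (act g T).
Proof. exact: runs_exit. Qed.

Lemma exec_Seq a b T n T1 m T2 :
  exec a T n T1 -> exec b T1 m T2 -> exec (Seq a b) T (n + m) T2.
Proof.
rewrite /exec /= => A B; elim: A B => {T n T1} [q T g E|q q' T g n T1 E _ IH] B.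
  apply: (@runs_step (Seq a b) _ (inr (entry b)) _ g); first by rewrite /= E.
  elim: B => {E q T T2 m} [q T g' E|q q' T g' m T2 E _ IH].
    by apply: runs_exit; rewrite /= E.
  by apply: (runs_step (q' := (inr q' : control (Seq a b)))) IH; rewrite /= E.
by apply: (runs_step (q' := (inl q' : control (Seq a b)))) (IH B); rewrite /= E.
Qed.

Lemma exec_Cond k (P : pred cell) a b T n T' :
  exec (if P (read (T k)) then a else b) (act idle T) n T' ->
  exec (Cond k P a b) T n.+1 T'.
Proof.
rewrite /exec => A.
apply: (@runs_step (Cond k P a b) _
  (Some (if P (read (T k)) then inl (entry a) else inr (entry b))) _ idle) => //.
case: ifP A => _.
  move: (entry a) (act idle T) => q T0.
  elim=> {q T0 T T' n} [q T g E|q q' T g n T' E _ IH].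
    by apply: runs_exit; rewrite /= E.
  by apply: (runs_step (q' := (Some (inl q') : control (Cond k P a b)))) IH; rewrite /= E.
move: (entry b) (act idle T) => q T0.
elim=> {q T0 T T' n} [q T g E|q q' T g n T' E _ IH].
  by apply: runs_exit; rewrite /= E.
by apply: (runs_step (q' := (Some (inr q') : control (Cond k P a b)))) IH; rewrite /= E.
Qed.

Lemma exec_While_false k (P : pred cell) a T :
  ~~ P (read (T k)) -> exec (While k P a) T 1 (act idle T).
Proof. by move=> nP; apply: runs_exit => /=; rewrite (negbTE nP). Qed.

Lemma exec_While_true k (P : pred cell) a T n T1 m T2 :
  P (read (T k)) -> exec a (act idle T) n T1 -> exec (While k P a) T1 m T2 ->
  exec (While k P a) T (n + m).+1 T2.
Proof.
rewrite /exec => PT A B.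
apply: (@runs_step (While k P a) _ (Some (entry a)) _ idle); first by rewrite /= PT.
move: (entry a) (act idle T) A B => q T0.
elim=> {q T0 PT T T1 n} [q T g E|q q' T g n T1 E _ IH] B.
  by apply: (runs_step (q' := (None : control (While k P a)))) B; rewrite /= E.
by apply: (runs_step (q' := (Some q' : control (While k P a)))) (IH B); rewrite /= E.
Qed.

(** An action on a tape depends only on the cell read there, so only the tests could make a run
    depend on tapes that the machine does not have. *)
Fixpoint tests_below (K : nat) (c : cmd) : bool :=
  match c with
  | Do _ => true
  | Seq a b => tests_below K a && tests_below K b
  | Cond k _ a b => [&& k < K, tests_below K a & tests_below K b]
  | While k _ a => (k < K) && tests_below K a
  end.

Lemma eq_next K c rd rd' (q : control c) : tests_below K c ->
  (forall k, k < K -> rd k = rd' k) -> next rd q = next rd' q.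
Proof.
elim: c q => [g|a IHa b IHb|k P a IHa b IHb|k P a IHa] //=.
- by case=> q /andP[Ka Kb] E; rewrite ?(IHa _ Ka E) ?(IHb _ Kb E).
- by case=> [[q|q]|] /and3P[kK Ka Kb] E; rewrite ?(IHa _ Ka E) ?(IHb _ Kb E) ?E.
- by case=> [q|] /andP[kK Ka] E; rewrite ?(IHa _ Ka E) ?E.
Qed.

(** [inord] is faithful only for indices up to [n]; [tests_below] confines the tests to these. *)
Definition ffun_below {n : nat} (h : {ffun 'I_n.+1 -> cell}) : nat -> cell :=
  fun k => h (inord k).

Definition machine_of (o : nat) (c : cmd) : machine :=
  @Machine o (option (control c)) (Some (entry c)) (fun q => q == None)
    (fun q h => if q is Some q' then
        let: (q1, g) := next (ffun_below h) q' in (q1, [ffun i => g (nat_of_ord i) (h i)])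
      else (None, [ffun i => (h i, Stay)])).

Definition initial_tapes (w : seq letter) : tapes :=
  fun k => Tape [::] (if k == 0 then map Some w else [::]).

Lemma compile_run o c (w : seq letter) n T' :
  tests_below o.+1 c -> exec c (initial_tapes w) n T' ->
  halts_within (machine_of o c) w n (until_blank (right_of (T' o))).
Proof.
move=> bc A; rewrite /halts_within.
suff H q T (C : config (machine_of o c)) : cstate C = Some q ->
    (forall i, ctapes C i = T (nat_of_ord i)) -> runs q T n T' ->
    let C' := iter n (@step (machine_of o c)) C in
    cstate C' = None /\ ctapes C' ord_max = T' o.
  have [] := H (entry c) (initial_tapes w) (initial (machine_of o c) w) erefl _ A.
    by move=> i; rewrite ffunE.
  by rewrite /output /= => -> ->.
move=> + + R; elim: R C => {A q T n T'} [q T g E|q q' T g n T' E R IH] C qC TC.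
  have -> : iter 1 (@step (machine_of o c)) C = step C by [].
  have E' : next (ffun_below [ffun i => read (ctapes C i)]) q = (None, g).
    rewrite -E; apply: eq_next bc _ => k kK.
    by rewrite /ffun_below ffunE TC inordK.
  by rewrite /step qC /= E' /= ffunE; split; rewrite // ffunE ffunE TC.
rewrite iterSr; apply: IH => [|i].
  rewrite /step qC /=.
  rewrite (@eq_next o.+1 c _ (reads T)) ?E // => k kK.
  by rewrite /ffun_below ffunE TC inordK.
rewrite /step qC /=.
rewrite (@eq_next o.+1 c _ (reads T)) ?E //= => [|k kK].
  by rewrite ffunE ffunE ffunE TC.
by rewrite /ffun_below ffunE TC inordK.
Qed.

(** * Total correctness of commands with time bounds *)

Definition upd {A : Type} (f : nat -> A) (k : nat) (v : A) : nat -> A :=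
  fun j => if j == k then v else f j.

(* The tape has its head on cell [p] and content [f], where nothing is said
   about the cells to the left of cell 0. *)
Definition at_pos (tp : tape) (f : nat -> cell) (p : nat) :=
  (forall i, nth None (right_of tp) i = f (p + i)) /\
  (forall i, i < p -> nth None (left_of tp) i = f (p - i.+1)).

Definition moved (m : move) (p : nat) : nat :=
  match m with MoveLeft => p.-1 | Stay => p | MoveRight => p.+1 end.

Lemma at_pos_read tp f p : at_pos tp f p -> read tp = f p.
Proof. by case=> R _; have := R 0; rewrite addn0 nth0. Qed.


Lemma at_pos_move tp f p a f' : at_pos tp f p ->
  (a.2 = MoveLeft -> 0 < p) -> f' =1 upd f p a.1 ->
  at_pos (write_and_move a tp) f' (moved a.2 p).
Proof.
case: tp a => l r [a m] [/= R Lf] mp E.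
have ne i : p + i.+1 == p = false by lia.
have nl i : i < p -> p - i.+1 == p = false by lia.
case: m mp => /= mp; split=> [[|i]|[|i]] //=; rewrite ?E /upd ?addn0 ?eqxx ?ne ?nth_behead ?R //.
- have {}mp := mp erefl; rewrite -nth0 Lf // subn1.
  by have -> : p.-1 == p = false by lia.
- have {}mp := mp erefl; case: i => [|i] /=.
    by rewrite addn1 prednK ?eqxx.
  rewrite nth_behead R.
  have -> : p.-1 + i.+2 = p + i.+1 by lia.
  by rewrite ne.
- move=> ip; rewrite Lf; last by lia.
  have -> : p.-1 - 1 = p - 2 by lia.
  by rewrite nl //; lia.
- move=> ip; rewrite Lf; last by lia.
  have -> : p.-1 - i.+2 = p - i.+3 by lia.
  by rewrite nl //; lia.
- by move=> ip; rewrite nl // Lf.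
- by move=> ip; rewrite nl // Lf.
- have -> : p.+1 == p = false by lia.
  by rewrite addn1.
- have -> : p.+1 + i.+1 = p + i.+2 by lia.
  by rewrite ne.
- by rewrite subn1 /= eqxx.
- by move=> ip; rewrite subSS nl // Lf.
Qed.

Definition contents := nat -> nat -> cell.
Definition positions := nat -> nat.
Definition at_tapes (T : tapes) (f : contents) (p : positions) :=
  forall k, at_pos (T k) (f k) (p k).

(** Stating conditions on contents and positions identifies tapes that differ only in explicit
    trailing blanks. *)
Definition wp (c : cmd) (n : nat) (f : contents) (p : positions)
    (Q : contents -> positions -> Prop) : Prop :=
  forall T, at_tapes T f p ->
  exists n' T' f' p', [/\ n' <= n, exec c T n' T', at_tapes T' f' p' & Q f' p'].

Lemma at_tapes_idle T f p : at_tapes T f p -> at_tapes (act idle T) f p.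
Proof.
move=> A k; apply: (at_pos_move (a := (read (T k), Stay)) (A k)) => // i /=.
by rewrite /upd (at_pos_read (A k)); case: eqP => // ->.
Qed.

Lemma wp_weaken c n f p (Q : _ -> _ -> Prop) n' (Q' : _ -> _ -> Prop) : wp c n f p Q -> n <= n' ->
  (forall f' p', Q f' p' -> Q' f' p') -> wp c n' f p Q'.
Proof.
move=> W nn QQ T /W[m [T' [f' [p' [mn E A q]]]]].
by exists m, T', f', p'; split=> //; [exact: leq_trans mn nn|exact: QQ].
Qed.

Lemma wp_Do g f p f' p' (Q : _ -> _ -> Prop) :
  (forall k, let a := g k (f k (p k)) in
     [/\ a.2 = MoveLeft -> 0 < p k, f' k =1 upd (f k) (p k) a.1 & p' k = moved a.2 (p k)]) ->
  Q f' p' -> wp (Do g) 1 f p Q.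
Proof.
move=> H q T A; exists 1, (act g T), f', p'; split=> //; first exact: exec_Do.
move=> k; have [mp E ->] := H k; rewrite /act (at_pos_read (A k)).
exact: at_pos_move.
Qed.

Lemma wp_Seq a b n m f p (Q R : _ -> _ -> Prop) : wp a n f p R ->
  (forall f' p', R f' p' -> wp b m f' p' Q) -> wp (Seq a b) (n + m) f p Q.
Proof.
move=> W V T /W[n1 [T1 [f1 [p1 [le1 E1 A1 q1]]]]].
have [n2 [T2 [f2 [p2 [le2 E2 A2 q2]]]]] := V _ _ q1 _ A1.
exists (n1 + n2), T2, f2, p2; split=> //; first exact: leq_add.
exact: exec_Seq E1 E2.
Qed.

Lemma wp_Cond k (P : pred cell) a b n f p Q :
  wp (if P (f k (p k)) then a else b) n f p Q ->
  wp (Cond k P a b) n.+1 f p Q.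
Proof.
move=> W T A; have [n1 [T1 [f1 [p1 [le1 E1 A1 q1]]]]] := W _ (at_tapes_idle A).
exists n1.+1, T1, f1, p1; split=> //.
by apply: exec_Cond; rewrite (at_pos_read (A k)).
Qed.

(** The number [m] of rounds is known beforehand and the invariant is indexed by the completed
    rounds, so one induction gives both correctness and the time bound. *)
Lemma wp_While k (P : pred cell) c n m (I : nat -> contents -> positions -> Prop)
    (Q : _ -> _ -> Prop) f p :
  I 0 f p ->
  (forall i f p, i < m -> I i f p -> P (f k (p k)) /\ wp c n f p (I i.+1)) ->
  (forall f p, I m f p -> ~~ P (f k (p k)) /\ Q f p) ->
  wp (While k P c) (m * n.+1).+1 f p Q.
Proof.
move=> I0 step last.
have [j jm] : {j | j = m} by exists m.
have: I (m - j) f p by rewrite jm subnn.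
have: j <= m by rewrite jm.
rewrite -[in (_ * _).+1]jm => {jm I0}; elim: j f p => [|j IH] f p jm.
  rewrite subn0 => /last[nP q] T A.
  exists 1, (act idle T), f, p; split=> //; last exact: at_tapes_idle.
  by apply: exec_While_false; rewrite (at_pos_read (A k)).
move=> Ij; have lt : m - j.+1 < m by lia.
have [PT W] := step _ _ _ lt Ij.
move=> T A; have [n1 [T1 [f1 [p1 [le1 E1 A1 q1]]]]] := W _ (at_tapes_idle A).
rewrite -subSn // subSS in q1.
have [n2 [T2 [f2 [p2 [le2 E2 A2 q2]]]]] := IH _ _ (ltnW jm) q1 _ A1.
exists (n1 + n2).+1, T2, f2, p2; split=> //; first by nia.
by apply: exec_While_true E1 E2; rewrite (at_pos_read (A k)).
Qed.

Definition wp_pos c n f p (Q : positions -> Prop) := wp c n f p (fun f' p' => f' = f /\ Q p').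

Lemma wp_pos_weaken c n f p (Q : _ -> Prop) n' (Q' : _ -> Prop) : wp_pos c n f p Q -> n <= n' ->
  (forall p', Q p' -> Q' p') -> wp_pos c n' f p Q'.
Proof.
move=> W nn QQ; apply: wp_weaken W nn _ => f' p' [-> /QQ]; by split.
Qed.

Lemma wp_pos_Seq a b n m f p (Q R : _ -> Prop) : wp_pos a n f p R ->
  (forall p', R p' -> wp_pos b m f p' Q) -> wp_pos (Seq a b) (n + m) f p Q.
Proof. by move=> W V; apply: wp_Seq W _ => f' p' [-> /V]. Qed.

Lemma wp_pos_While k (P : pred cell) c n m (I : nat -> positions -> Prop)
    (Q : _ -> Prop) f p :
  I 0 p ->
  (forall i p, i < m -> I i p -> P (f k (p k)) /\ wp_pos c n f p (I i.+1)) ->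
  (forall p, I m p -> ~~ P (f k (p k)) /\ Q p) ->
  wp_pos (While k P c) (m * n.+1).+1 f p Q.
Proof.
move=> I0 step last.
apply: (wp_While (I := fun i f' p' => f' = f /\ I i p')) => //.
  by move=> i f' p' im [-> /(step _ _ im)].
by move=> f' p' [-> /last[]].
Qed.

(** * Counters stored as head positions *)

Definition shift_by (v : nat) (m : move) (p : nat) :=
  match m with MoveLeft => p - v | Stay => p | MoveRight => p + v end.

Definition moves (mv : nat -> move) : cmd := Do (fun k a => (a, mv k)).

Lemma wp_pos_moves mv f p (Q : _ -> Prop) :
  (forall k, mv k = MoveLeft -> 0 < p k) ->
  Q (fun k => moved (mv k) (p k)) ->
  wp_pos (moves mv) 1 f p Q.
Proof.
move=> mp q; apply: (wp_Do (f' := f) (p' := fun k => moved (mv k) (p k))) => // k /=.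
by split=> [/mp||] // i; rewrite /upd; case: eqP => // ->.
Qed.

Definition not_sep : pred cell := fun a => a != Some Sep.

(* The tape of a counter with values 0, ..., L; value [v] is cell [v.+1]. *)
Definition ruler (L : nat) : nat -> cell :=
  fun i => if i == 1 then Some Sep else if 1 < i <= L then Some (Bit true) else None.

(** Both ends of the range are visible to the head: value 0 is on [Sep] and value [L] on the first
    blank. Counting thus takes moves only, and rulers are never rewritten. *)
Lemma ruler_sep L v : not_sep (ruler L v.+1) = (0 < v).
Proof. by rewrite /ruler /not_sep eqSS; case: v => //= v; case: ifP. Qed.

Lemma ruler_blank L v : 0 < L -> isSome (ruler L v.+1) = (v < L).
Proof.
move=> L0; rewrite /ruler eqSS; case: v => [|v] /=.
  by rewrite L0.
by case: ifP.
Qed.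

(** The basic gadget: while counter [k] runs down from [v] to 0, other heads travel [v] cells in
    lockstep. Clearing, copying and addressing a memory tape are all instances. *)
Definition sweep k mv := While k not_sep (moves mv).

Lemma wp_pos_sweep L k mv f p v :
  f k =1 ruler L -> p k = v.+1 -> mv k = MoveLeft ->
  (forall j, mv j = MoveLeft -> v <= p j) ->
  wp_pos (sweep k mv) (2 * v + 1) f p (fun p' => forall j, p' j = shift_by v (mv j) (p j)).
Proof.
move=> fk pk mk mp; rewrite mulnC addn1.
apply: (wp_pos_While (I := fun i p' => forall j, p' j = shift_by i (mv j) (p j))).
- by move=> j; case: (mv j) => /=; rewrite ?subn0 ?addn0.
- move=> i p' iv E; split.
    rewrite fk E mk /= pk subSn; last by lia.
    by rewrite ruler_sep subn_gt0.
  apply: wp_pos_moves => j.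
    by move=> mj; rewrite E mj /=; have := mp j mj; lia.
  by rewrite E; case: (mv j) => //=; lia.
- by move=> p' E; split=> //; rewrite fk E mk /= pk subSnn ruler_sep.
Qed.

Lemma wp_pos_sweep_max L k mv f p v : v <= L ->
  f k =1 ruler L -> p k = v.+1 -> mv k = MoveLeft ->
  (forall j, mv j = MoveLeft -> v <= p j) ->
  wp_pos (sweep k mv) (2 * L + 1) f p (fun p' => forall j, p' j = shift_by v (mv j) (p j)).
Proof.
move=> vL fk pk mk mp; apply: wp_pos_weaken (wp_pos_sweep fk pk mk mp) _ _ => //.
by rewrite leq_add2r leq_mul2l vL.
Qed.

Definition clear k := sweep k (fun j => if j == k then MoveLeft else Stay).
Definition transfer s d := Seq (clear d)
  (sweep s (fun j => if j == s then MoveLeft else if j == d then MoveRight else Stay)).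
(** Reading a counter runs it down to zero, so the value is duplicated on [d] and [d.+1], and the
    second copy is spent on restoring [s]. *)
Definition copy s d := Seq (clear d) (Seq (clear d.+1) (Seq
  (sweep s (fun j => if j == s then MoveLeft
                     else if (j == d) || (j == d.+1) then MoveRight else Stay))
  (sweep d.+1 (fun j => if j == d.+1 then MoveLeft
                        else if j == s then MoveRight else Stay)))).

Lemma wp_pos_clear L k f p : f k =1 ruler L -> 0 < p k <= L.+1 ->
  wp_pos (clear k) (2 * L + 1) f p (fun p' => p' =1 upd p k 1).
Proof.
move=> fk pk; have E : p k = (p k).-1.+1 by lia.
apply: wp_pos_weaken (wp_pos_sweep fk E _ _) _ _.
- by rewrite eqxx.
- by move=> j; case: eqP => // -> _; lia.
- by lia.
- move=> p' H j; rewrite H /upd; case: eqP => //= ->; clear -pk; lia.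
Qed.

Lemma wp_pos_transfer L s d f p : f s =1 ruler L -> f d =1 ruler L -> s != d ->
  0 < p s <= L.+1 -> 0 < p d <= L.+1 ->
  wp_pos (transfer s d) (2 * (2 * L + 1)) f p (fun p' => p' =1 upd (upd p d (p s)) s 1).
Proof.
move=> fs fd sd ps pd; rewrite mulSn mul1n.
apply: wp_pos_Seq (wp_pos_clear fd pd) _ => p1 E1.
have Es : p1 s = (p s).-1.+1 by rewrite E1 /upd (negbTE sd); lia.
apply: wp_pos_weaken (wp_pos_sweep fs Es _ _) _ _.
- by rewrite eqxx.
- by move=> j; case: eqP => [->|_]; [rewrite Es; lia|case: eqP].
- by lia.
- move=> p' H j; rewrite H !E1 /upd; case: (eqVneq j s) => [->|js] /=.
    by rewrite (negbTE sd); lia.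
  by case: eqVneq => //= _; lia.
Qed.

Lemma wp_pos_copy L s d f p : f s =1 ruler L -> f d =1 ruler L -> f d.+1 =1 ruler L ->
  s != d -> s != d.+1 ->
  0 < p s <= L.+1 -> 0 < p d <= L.+1 -> 0 < p d.+1 <= L.+1 ->
  wp_pos (copy s d) (4 * (2 * L + 1)) f p (fun p' => p' =1 upd (upd p d (p s)) d.+1 1).
Proof.
move=> fs fd fd' sd sd' ps pd pd'.
have -> x : 4 * x = x + (x + (x + x)) by lia.
apply: wp_pos_Seq (wp_pos_clear fd pd) _ => p1 E1.
have p1d : 0 < p1 d.+1 <= L.+1 by rewrite E1 /upd; case: eqP => //; lia.
apply: wp_pos_Seq (wp_pos_clear fd' p1d) _ => p2 E2.
have Es : p2 s = (p s).-1.+1.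
  by rewrite E2 /upd (negbTE sd') E1 /upd (negbTE sd); lia.
have vL : (p s).-1 <= L by lia.
apply: wp_pos_Seq (wp_pos_sweep_max vL fs Es _ _) _ => [|j|p3 E3].
- by rewrite eqxx.
- by case: eqP => [->|_]; [rewrite Es; lia|case: ifP].
have nd : (d.+1 == d) = false by lia.
have Ed : p3 d.+1 = (p s).-1.+1.
  by rewrite E3 eq_sym (negbTE sd') eqxx orbT /= E2 /upd eqxx; lia.
apply: wp_pos_weaken (wp_pos_sweep_max vL fd' Ed _ _) (leqnn _) _ => [|j|p' H j].
- by rewrite eqxx.
- by case: eqP => [->|_]; [rewrite Ed; lia|case: ifP].
- rewrite H /upd.
  case: (eqVneq j d.+1) => [->|jd'] /=; first by rewrite Ed; lia.
  case: (eqVneq j s) => [->|js] /=.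
    by rewrite E3 eqxx /= (negbTE sd) Es; lia.
  rewrite E3 (negbTE js) (negbTE jd') orbF !E2 /upd (negbTE jd') !E1 /upd.
  by case: eqP => //= _; lia.
Qed.

(** * Bounded expressions *)

Inductive region := InputTape | EdgeTape | NewTape | ResultTape | CoveredTape.

Definition tape_of (r : region) : nat :=
  match r with
  | InputTape => 0 | EdgeTape => 1 | NewTape => 2 | ResultTape => 3 | CoveredTape => 4
  end.

Definition region_eqb (r r' : region) : bool := tape_of r == tape_of r'.
Lemma region_eqP : Equality.axiom region_eqb.
Proof. by move=> r r'; apply: (iffP idP) => [|->]; [case: r; case: r'|case: r']. Qed.
HB.instance Definition _ := hasDecEq.Build region region_eqP.

Lemma tape_of_lt r : tape_of r < 5. Proof. by case: r. Qed.

Definition memory := region -> nat -> cell.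

Definition scons (x : nat) (s : nat -> nat) : nat -> nat :=
  fun i => if i is j.+1 then s j else x.

(** [Fold] is the only loop; its round count is evaluated before the first round and is at most [L].
    [Ren] only reassigns variables to tapes at compile time and costs no steps. *)
Inductive expr :=
| Var of nat
| Zero
| Top
| Succ of expr
| Pred of expr
| Ite of expr & expr & expr
| Bind of expr & expr
| Ren of (nat -> nat) & expr
| Fold of expr & expr & expr
| Look of region & letter & expr.

(* All values are at most [L]: [Top] is [L], and [Succ] is saturating.  The
   body of a [Fold] sees the accumulator as variable 0 and the number of
   completed rounds as variable 1. *)
Fixpoint eval (L : nat) (mem : memory) (s : nat -> nat) (e : expr) : nat :=
  match e with
  | Var i => s i
  | Zero => 0
  | Top => L
  | Succ e => minn (eval L mem s e).+1 L
  | Pred e => (eval L mem s e).-1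
  | Ite e a b => if eval L mem s e == 0 then eval L mem s b else eval L mem s a
  | Bind a b => eval L mem (scons (eval L mem s a) s) b
  | Ren r e => eval L mem (fun i => s (r i)) e
  | Fold c i b =>
      iteri (eval L mem s c) (fun j acc => eval L mem (scons acc (scons j s)) b)
        (eval L mem s i)
  | Look r a e => mem r (eval L mem s e) == Some a
  end.

Lemma scons_ext x s s' : s =1 s' -> scons x s =1 scons x s'.
Proof. by move=> E [|i] /=. Qed.

Lemma eval_ext L mem mem' s s' e : mem =2 mem' -> s =1 s' ->
  eval L mem s e = eval L mem' s' e.
Proof.
move=> M; elim: e s s' => //=.
- by move=> e IH s s' E; rewrite (IH _ _ E).
- by move=> e IH s s' E; rewrite (IH _ _ E).
- by move=> e IH a IHa b IHb s s' E; rewrite (IH _ _ E) (IHa _ _ E) (IHb _ _ E).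
- by move=> a IHa b IHb s s' E; rewrite (IHa _ _ E); apply: IHb; apply: scons_ext.
- by move=> r e IH s s' E; apply: IH => i; apply: E.
- move=> c IHc i IHi b IHb s s' E; rewrite (IHc _ _ E) (IHi _ _ E).
  by apply: eq_iteri => j y; apply: IHb; do 2 apply: scons_ext.
- by move=> r a e IH s s' E; rewrite (IH _ _ E) M.
Qed.

Definition skip : cmd := Do idle.
Definition move_tape k m := moves (fun j => if j == k then m else Stay).

(* [compile fr d e] leaves the value of [e] on tape [d]; variable [i] is on tape
   [fr i], and the tapes from [d] on are free. *)
Fixpoint compile (fr : nat -> nat) (d : nat) (e : expr) : cmd :=
  match e with
  | Var i => copy (fr i) d
  | Zero => clear d
  | Top => While d isSome (move_tape d MoveRight)
  | Succ e => Seq (compile fr d e) (Cond d isSome (move_tape d MoveRight) skip)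
  | Pred e => Seq (compile fr d e) (Cond d not_sep (move_tape d MoveLeft) skip)
  | Ite e a b => Seq (compile fr d e) (Cond d not_sep (compile fr d a) (compile fr d b))
  | Bind a b =>
      Seq (compile fr d a) (Seq (compile (scons d fr) d.+1 b) (transfer d.+1 d))
  | Ren r e => compile (fun i => fr (r i)) d e
  | Fold c i b =>
      Seq (compile fr d c) (Seq (compile fr d.+1 i) (Seq (clear d.+2) (Seq
        (While d not_sep
          (Seq (compile (scons d.+1 (scons d.+2 fr)) d.+3 b) (Seq
            (transfer d.+3 d.+1)
            (moves (fun k => if k == d then MoveLeft
                             else if k == d.+2 then MoveRight else Stay)))))
        (transfer d.+1 d))))
  | Look r a e =>
      let back := sweep d.+1 (fun k => if (k == d.+1) || (k == tape_of r)
                                       then MoveLeft else Stay) in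
      Seq (compile fr d e) (Seq (clear d.+1) (Seq
        (sweep d (fun k => if k == d then MoveLeft
           else if (k == d.+1) || (k == tape_of r) then MoveRight else Stay))
        (Cond (tape_of r) (pred1 (Some a)) (Seq back (move_tape d MoveRight)) back)))
  end.

Fixpoint depth (e : expr) : nat :=
  match e with
  | Var _ => 2
  | Zero | Top => 1
  | Succ e | Pred e => depth e
  | Ite e a b => depth e + depth a + depth b
  | Bind a b => depth a + depth b + 2
  | Ren r e => depth e
  | Fold c i b => depth c + depth i + depth b + 4
  | Look r a e => depth e + 2
  end.

Fixpoint time (L : nat) (e : expr) : nat :=
  let S := 2 * L + 1 in
  match e with
  | Var _ => 4 * S
  | Zero | Top => S
  | Succ e | Pred e => time L e + 2
  | Ite e a b => time L e + (time L a + time L b).+1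
  | Bind a b => time L a + (time L b + 2 * S)
  | Ren r e => time L e
  | Fold c i b =>
      time L c + (time L i + (S + ((L * (time L b + (2 * S + 1)).+1).+1 + 2 * S)))
  | Look r a e => time L e + (S + (S + (S + 1).+1))
  end.

Lemma depth_gt0 e : 0 < depth e.
Proof. by elim: e => //=; lia. Qed.

Section Compilation.
Variables (L o : nat).

Definition counters_ok (f : contents) (p : positions) :=
  forall k, 5 <= k < o -> f k =1 ruler L /\ 0 < p k <= L.+1.

Definition mem_ok (mem : memory) (f : contents) (p : positions) :=
  forall r, p (tape_of r) = 1 /\ forall i, f (tape_of r) i.+1 = mem r i.

(** Memory tapes and live variables lie below [d], the output tape is [o]; everything between is
    scratch space. *)
Definition same_below d (p p' : positions) :=
  forall k, (k < d) || (o <= k) -> p' k = p k.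

Lemma same_below_trans d d' p1 p2 p3 : d <= d' ->
  same_below d p1 p2 -> same_below d' p2 p3 -> same_below d p1 p3.
Proof. by move=> dd A B k kd; rewrite B ?A //; lia. Qed.

Lemma mem_ok_same mem f d p p' : 5 <= d -> mem_ok mem f p -> same_below d p p' ->
  mem_ok mem f p'.
Proof.
move=> d5 M A r; have [p1 E] := M r; split=> //.
by rewrite A //; have := tape_of_lt r; lia.
Qed.

Lemma counters_ok_upd f p p' k v : counters_ok f p -> 0 < v <= L.+1 ->
  p' =1 upd p k v -> counters_ok f p'.
Proof.
move=> C v_ok E j j_ok; have [fj pj] := C j j_ok.
by split=> //; rewrite E /upd; case: eqP.
Qed.

Lemma same_below_upd d p p' k v : d <= k < o -> p' =1 upd p k v -> same_below d p p'.
Proof. by move=> kd E j jd; rewrite E /upd; case: eqP => // jk; lia. Qed.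

Lemma wp_pos_move_tape k m f p (Q : _ -> Prop) : (m = MoveLeft -> 0 < p k) ->
  Q (upd p k (moved m (p k))) ->
  (forall p' p'', p' =1 p'' -> Q p' -> Q p'') -> wp_pos (move_tape k m) 1 f p Q.
Proof.
move=> mp q ext; apply: wp_pos_moves => [j|]; first by case: eqP => // ->.
by apply: ext q => j; rewrite /upd; case: eqP => // ->.
Qed.

Definition computes fr d e mem f p p' :=
  [/\ counters_ok f p', same_below d p p'
    & p' d = (eval L mem (fun i => (p (fr i)).-1) e).+1].

(** The tapes form a stack: a subexpression works from [d] upwards and leaves the variables below
    untouched, and the memory heads are back on cell 1 at the end of each expression. *)
Lemma wp_pos_compile mem f e fr d p : 0 < L -> counters_ok f p -> mem_ok mem f p -> 5 <= d ->
  d + depth e <= o -> (forall i, 5 <= fr i < d) ->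
  wp_pos (compile fr d e) (time L e) f p (computes fr d e mem f p).
Proof.
have mono P P' n c p0 : (forall p', P p' -> P' p') -> wp_pos c n f p0 P -> wp_pos c n f p0 P'.
  by move=> H /wp_pos_weaken; apply.
have env1 (fr' : nat -> nat) d' p1 p2 : (forall i, 5 <= fr' i < d') ->
    same_below d' p1 p2 ->
    (fun i => (p2 (fr' i)).-1) =1 (fun i => (p1 (fr' i)).-1).
  by move=> frd B i; rewrite B //; have := frd i; lia.
move=> L_gt0; elim: e fr d p => /=.
- move=> i fr d p C M d5 do_ frd.
  have fi := frd i.
  have [fs ps] : _ /\ _ := C (fr i) ltac:(lia).
  have [fd pd] : _ /\ _ := C d ltac:(lia).
  have [fd' pd'] : _ /\ _ := C d.+1 ltac:(lia).
  apply: mono (wp_pos_copy fs fd fd' _ _ ps pd pd'); try lia.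
  move=> p' E; split.
  + by move=> j jo; have [fj pj] := C j jo; split=> //; rewrite E /upd; do 2?[case: eqP => // _].
  + by move=> j jo; rewrite E /upd; do 2![case: eqP => ?; first lia].
  + rewrite E /upd eqxx ifF; last by lia.
    by rewrite /= prednK //; lia.
- move=> fr d p C M d5 do_ frd; have [fd pd] : _ /\ _ := C d ltac:(lia).
  apply: mono (wp_pos_clear fd pd) => p' E; split; last by rewrite E /upd eqxx.
    exact: counters_ok_upd E.
  by apply: same_below_upd E; lia.
- move=> fr d p C M d5 do_ frd; have [fd pd] : _ /\ _ := C d ltac:(lia).
  have T : (L.+1 - p d) * 2 < 2 * L + 1 by lia.
  apply: wp_pos_weaken T (fun _ H => H).
  apply: (wp_pos_While (I := fun i p' => p' =1 upd p d (p d + i))).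
  + by move=> j; rewrite /upd addn0; case: eqP => // ->.
  + move=> i p' iL E; split.
      have -> : p' d = (p d + i).-1.+1 by rewrite E /upd eqxx; lia.
      by rewrite fd ruler_blank //; lia.
    apply: wp_pos_move_tape => [//||p1 p2 E1 H j]; last by rewrite -E1 H.
    move=> j; rewrite /upd; case: eqP => [_|/eqP/negbTE nj]; rewrite /= E /upd ?nj //.
    by rewrite eqxx addnS.
  + move=> p' E.
    have Ed : p' d = L.+1 by rewrite E /upd eqxx; lia.
    split; first by rewrite Ed fd ruler_blank // ltnn.
    split=> //; last by apply: same_below_upd E; lia.
    by apply: counters_ok_upd C _ E; lia.
- move=> e IH fr d p C M d5 do_ frd; have dg := depth_gt0 e.
  apply: wp_pos_Seq (IH _ _ _ C M d5 do_ frd) _ => p1 [C1 B1 E1].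
  have [fd pd] : _ /\ _ := C1 d ltac:(lia).
  apply: wp_Cond; rewrite fd E1 ruler_blank //; case: ltnP => lt.
    apply: wp_pos_moves => [j|]; first by case: ifP.
    split.
    + apply: (counters_ok_upd (k := d) (v := (p1 d).+1)) C1 _ _; first by lia.
      by move=> j; rewrite /upd; case: eqP => // ->.
    + apply: same_below_trans (leqnn d) B1 _.
      apply: (same_below_upd (k := d) (v := (p1 d).+1)); first by lia.
      by move=> j; rewrite /upd; case: eqP => // ->.
    + by rewrite eqxx /= E1; lia.
  apply: wp_pos_moves => //; split=> //=; first by rewrite E1; lia.
- move=> e IH fr d p C M d5 do_ frd; have dg := depth_gt0 e.
  apply: wp_pos_Seq (IH _ _ _ C M d5 do_ frd) _ => p1 [C1 B1 E1].
  have [fd pd] : _ /\ _ := C1 d ltac:(lia).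
  apply: wp_Cond; rewrite fd E1 ruler_sep //; case: ltnP => lt.
    apply: wp_pos_moves => [j|]; first by case: eqP => // ->; lia.
    split.
    + apply: (counters_ok_upd (k := d) (v := (p1 d).-1)) C1 _ _; first by lia.
      by move=> j; rewrite /upd; case: eqP => // ->.
    + apply: same_below_trans (leqnn d) B1 _.
      apply: (same_below_upd (k := d) (v := (p1 d).-1)); first by lia.
      by move=> j; rewrite /upd; case: eqP => // ->.
    + by rewrite eqxx /= E1; lia.
  apply: wp_pos_moves => //; split=> //=; first by rewrite E1; lia.
- move=> e IH a IHa b IHb fr d p C M d5 do_ frd; have dg := depth_gt0 e.
  have do1 : d + depth e <= o by lia.
  apply: wp_pos_Seq (IH _ _ _ C M d5 do1 frd) _ => p1 [C1 B1 E1].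
  have [fd pd] : _ /\ _ := C1 d ltac:(lia).
  have M1 := mem_ok_same d5 M B1.
  have fin e' : wp_pos (compile fr d e') (time L e') f p1 (computes fr d e' mem f p1) ->
      wp_pos (compile fr d e') (time L e') f p1 (computes fr d e' mem f p).
    apply: mono => p2 [C2 B2 E2]; split=> //; first exact: same_below_trans B1 B2.
    by rewrite E2; congr _.+1; apply: eval_ext => //; apply: env1 B1.
  apply: wp_Cond; rewrite fd E1 ruler_sep lt0n.
  case: (eqVneq (eval _ _ _ e) 0) => Z /=.
    have do2 : d + depth b <= o by lia.
    have W := fin _ (IHb _ _ _ C1 M1 d5 do2 frd).
    apply: wp_pos_weaken W _ _; first by lia.
    by move=> p2 [C2 B2 E2]; split=> //; rewrite /= Z.
  have do2 : d + depth a <= o by lia.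
  have W := fin _ (IHa _ _ _ C1 M1 d5 do2 frd).
  apply: wp_pos_weaken W _ _; first by lia.
  by move=> p2 [C2 B2 E2]; split=> //; rewrite /= (negbTE Z).
- move=> a IHa b IHb fr d p C M d5 do_ frd.
  have dg := depth_gt0 b.
  have do1 : d + depth a <= o by lia.
  apply: wp_pos_Seq (IHa _ _ _ C M d5 do1 frd) _ => p1 [C1 B1 E1].
  have M1 := mem_ok_same d5 M B1.
  have d5' : 5 <= d.+1 by lia.
  have do2 : d.+1 + depth b <= o by lia.
  have frd' i : 5 <= scons d fr i < d.+1.
    by case: i => [|i] /=; [lia|have := frd i; lia].
  apply: wp_pos_Seq (IHb _ _ _ C1 M1 d5' do2 frd') _ => p2 [C2 B2 E2].
  have [fd pd] : _ /\ _ := C2 d ltac:(lia).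
  have [fd' pd'] : _ /\ _ := C2 d.+1 ltac:(lia).
  apply: mono (wp_pos_transfer fd' fd _ pd' pd); last by lia.
  move=> p3 E3; split.
  + by move=> j jo; have [fj pj] := C2 j jo; split=> //; rewrite E3 /upd; do 2?[case: eqP => // _].
  + apply: same_below_trans (leqnn _) B1 _ => j jo.
    rewrite E3 /upd; do 2![case: eqP => ?; first lia].
    by rewrite B2 //; lia.
  + rewrite E3 /upd eqxx ifF; last by lia.
    rewrite E2; congr _.+1; apply: eval_ext => // -[|i] /=; first by rewrite E1.
    exact: env1 B1 i.
- by move=> r e IH fr d p C M d5 do_ frd; apply: IH.
- move=> c IHc i IHi b IHb fr d p C M d5 do_ frd.
  have [gc gi gb] : [/\ 0 < depth c, 0 < depth i & 0 < depth b] by split; apply: depth_gt0.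
  have do1 : d + depth c <= o by lia.
  apply: wp_pos_Seq (IHc _ _ _ C M d5 do1 frd) _ => p1 [C1 B1 E1].
  have M1 := mem_ok_same d5 M B1.
  have d5' : 5 <= d.+1 by lia.
  have do2 : d.+1 + depth i <= o by lia.
  have frd' j : 5 <= fr j < d.+1 by have := frd j; lia.
  apply: wp_pos_Seq (IHi _ _ _ C1 M1 d5' do2 frd') _ => p2 [C2 B2 E2].
  have [fd2 pd2] : _ /\ _ := C2 d.+2 ltac:(lia).
  apply: wp_pos_Seq (wp_pos_clear fd2 pd2) _ => p3 E3.
  set s := fun j => (p (fr j)).-1.
  set cnt := eval L mem s c in E1.
  pose G j acc := eval L mem (scons acc (scons j s)) b.
  set v0 := eval L mem s i.
  have {}E2 : p2 d.+1 = v0.+1.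
    by rewrite E2; congr _.+1; apply: eval_ext => //; apply: env1 B1.
  have cL : cnt <= L by have [_] : _ /\ _ := C1 d ltac:(lia); rewrite E1; lia.
  (* [d] counts the remaining rounds down and [d.+2] the completed ones up, because the body may
     refer to the latter; [d.+1] is the accumulator. *)
  pose I j p' := [/\ counters_ok f p', same_below d p p', p' d = (cnt - j).+1,
                     p' d.+1 = (iteri j G v0).+1 & p' d.+2 = j.+1].
  have [fd pd] : _ /\ _ := C1 d ltac:(lia).
  apply: (@wp_pos_Seq _ _ _ _ _ _ _ (I cnt)).
    have le : (cnt * (time L b + (2 * (2 * L + 1) + 1)).+1).+1 <=
              (L * (time L b + (2 * (2 * L + 1) + 1)).+1).+1.
      by rewrite ltnS leq_mul2r cL orbT.
    apply: wp_pos_weaken le (fun _ H => H).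
    apply: (wp_pos_While (I := I)).
    + split.
      * by apply: counters_ok_upd C2 _ E3.
      * apply: same_below_trans (leqnn _) B1 _ => j jo.
        by rewrite E3 /upd; case: eqP => ?; [lia|rewrite B2 //; lia].
      * rewrite E3 /upd ifF; last by lia.
        by rewrite B2 ?E1 ?subn0 //; lia.
      * by rewrite E3 /upd ifF /= ?E2 //; lia.
      * by rewrite E3 /upd eqxx.
    + move=> j p4 jc [C4 B4 Ed Ed1 Ed2]; split.
        by rewrite fd Ed ruler_sep; lia.
      have M4 := mem_ok_same d5 M B4.
      have d5'' : 5 <= d.+3 by lia.
      have do3 : d.+3 + depth b <= o by lia.
      have frd'' x : 5 <= scons d.+1 (scons d.+2 fr) x < d.+3.
        by case: x => [|[|x]] /=; [lia|lia|have := frd x; lia].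
      apply: wp_pos_Seq (IHb _ _ _ C4 M4 d5'' do3 frd'') _ => p5 [C5 B5 E5].
      have {}E5 : p5 d.+3 = (iteri j.+1 G v0).+1.
        rewrite E5 /= /G; congr _.+1; apply: eval_ext => // -[|[|x]] /=.
        - by rewrite Ed1.
        - by rewrite Ed2.
        - exact: env1 B4 x.
      have [fd3 pd3] : _ /\ _ := C5 d.+3 ltac:(lia).
      have [fd1 pd1] : _ /\ _ := C5 d.+1 ltac:(lia).
      have ne : d.+3 != d.+1 by lia.
      apply: wp_pos_Seq (wp_pos_transfer fd3 fd1 ne pd3 pd1) _ => p6 E6.
      have Ed6 : p6 d = (cnt - j).+1.
        by rewrite E6 /upd !ifF ?B5 ?Ed //; lia.
      have Ed26 : p6 d.+2 = j.+1.
        by rewrite E6 /upd !ifF ?B5 ?Ed2 //; lia.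
      apply: wp_pos_moves => [k|]; first by case: eqP => [->|_]; [rewrite Ed6|case: eqP].
      split=> /=.
      * move=> k ko; have [fk pk] := C5 k ko; split=> //.
        case: eqP => [->|_]; first by rewrite Ed6 /=; lia.
        case: eqP => [->|_]; first by rewrite Ed26 /=; lia.
        by rewrite E6 /upd /=; do 2?[case: eqP => // _].
      * apply: same_below_trans (leqnn _) B4 _ => k ko.
        do 2![case: eqP => ?; first lia]; rewrite /= E6 /upd.
        by do 2![case: eqP => ?; first lia]; rewrite B5 //; lia.
      * by rewrite eqxx Ed6 /=; lia.
      * do 2![rewrite ifF; last by lia].
        by rewrite /= E6 /upd ifF ?eqxx ?E5 //; lia.
      * by rewrite ifF ?eqxx ?Ed26 //; lia.
    + move=> p4 IH4; split=> //; case: IH4 => C4 B4 Ed Ed1 Ed2.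
      by rewrite fd Ed subnn ruler_sep.
  move=> p4 [C4 B4 Ed Ed1 Ed2].
  have [fd1 pd1] : _ /\ _ := C4 d.+1 ltac:(lia).
  have [_ pd4] : _ /\ _ := C4 d ltac:(lia).
  apply: mono (wp_pos_transfer fd1 fd _ pd1 pd4); last by lia.
  move=> p5 E5; split.
  + by move=> j jo; have [fj pj] := C4 j jo; split=> //; rewrite E5 /upd; do 2?[case: eqP => // _].
  + apply: same_below_trans (leqnn _) B4 _ => j jo.
    by rewrite E5 /upd; do 2![case: eqP => ?; first lia].
  + by rewrite E5 /upd eqxx ifF ?Ed1 //; lia.
- move=> r a e IH fr d p C M d5 do_ frd.
  have do1 : d + depth e <= o by lia.
  have dg := depth_gt0 e.
  have rd := tape_of_lt r.
  apply: wp_pos_Seq (IH _ _ _ C M d5 do1 frd) _ => p1 [C1 B1 E1].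
  set v := eval _ _ _ _ in E1 *.
  have [fd pd] : _ /\ _ := C1 d ltac:(lia).
  have [fd1 pd1] : _ /\ _ := C1 d.+1 ltac:(lia).
  have vL : v <= L by rewrite E1 in pd; lia.
  apply: wp_pos_Seq (wp_pos_clear fd1 pd1) _ => p2 E2.
  have Ed2 : p2 d = v.+1 by rewrite E2 /upd ifF //; lia.
  have [Mr1 Mr2] := M r.
  have Er2 : p2 (tape_of r) = 1.
    by rewrite E2 /upd ifF ?B1 //; lia.
  apply: wp_pos_Seq (wp_pos_sweep_max vL fd Ed2 _ _) _ => [|j|p3 E3].
  + by rewrite eqxx.
  + by case: eqP => [->|_]; [lia|case: ifP].
  have Ed3 : p3 d = 1 by rewrite E3 eqxx /= Ed2; lia.
  have Er3 : p3 (tape_of r) = v.+1.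
    by rewrite E3 ifF ?eqxx ?orbT /= ?Er2 //; lia.
  have Ed13 : p3 d.+1 = v.+1.
    by rewrite E3 ifF ?eqxx /= ?E2 /upd ?eqxx ?add1n //; lia.
  (* [d.+1] has recorded how far the memory head went, so sweeping it to 0 brings that head home. *)
  have back : wp_pos (sweep d.+1 (fun k => if (k == d.+1) || (k == tape_of r)
                               then MoveLeft else Stay)) (2 * L + 1) f p3
      (fun p' => p' =1 upd (upd p1 d 1) d.+1 1).
    apply: wp_pos_weaken (wp_pos_sweep_max vL fd1 Ed13 _ _) (leqnn _) _ => [|j|p4 E4 j].
    * by rewrite eqxx.
    * by case: ifP => // /orP[/eqP->|/eqP->] _; lia.
    * rewrite E4 /upd; case: (eqVneq j d.+1) => [->|n1] /=; first by lia.
      case: (eqVneq j (tape_of r)) => [->|n2] /=.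
        by rewrite Er3 ifF ?B1 ?Mr1 //; lia.
      rewrite E3 (negbTE n1) (negbTE n2) /=; case: (eqVneq j d) => [->|n3] /=.
        by rewrite Ed2; lia.
      by rewrite E2 /upd (negbTE n1).
  have fin p4 (x : nat) : x <= 1 -> p4 =1 upd (upd p1 d.+1 1) d x.+1 ->
      [/\ counters_ok f p4, same_below d p p4 & p4 d = x.+1].
    move=> x1 E4; split.
    * move=> j jo; have [fj pj] := C1 j jo; split=> //; rewrite E4 /upd.
      by case: eqP => ?; [lia|case: eqP].
    * apply: same_below_trans (leqnn _) B1 _ => j jo.
      by rewrite E4 /upd; do 2![case: eqP => ?; first lia].
    * by rewrite E4 /upd eqxx.
  apply: wp_Cond; rewrite Er3 Mr2 /= -/v; case: eqP => A.
    apply: wp_pos_Seq back _ => p4 E4.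
    apply: wp_pos_moves => [j|]; first by case: ifP.
    apply: fin => [|j] /=; rewrite -/v A eqxx //= /upd.
    case: eqP => [->|nj]; rewrite E4 /upd ?eqxx; first by rewrite ifF //; lia.
    by move/eqP/negbTE: nj ->.
  apply: wp_pos_weaken back _ _; first by lia.
  move=> p4 E4; apply: fin => [|j] /=; rewrite -/v.
    by case: eqP.
  rewrite E4 /upd; case: (eqVneq j d) => [->|//]; rewrite ifF; last by lia.
  by case: eqP A.
Qed.

End Compilation.

(** * Programs over arrays *)

Inductive prog :=
| PSeq of prog & prog
| PIf of expr & prog & prog
| PFor of expr & prog
| PWrite of region & expr & expr
| PEmit of letter.

(** False is the blank, so that a fresh tape is the all-false array. *)
Definition flag (b : bool) : cell := if b then Some (Bit true) else None.

Definition set_mem (mem : memory) r k (c : cell) : memory :=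
  fun r' j => if (r' == r) && (j == k) then c else mem r' j.

Fixpoint run (L : nat) (P : prog) (s : nat -> nat) (st : memory * seq letter)
    : memory * seq letter :=
  match P with
  | PSeq P1 P2 => run L P2 s (run L P1 s st)
  | PIf e P1 P2 => if eval L st.1 s e != 0 then run L P1 s st else run L P2 s st
  | PFor e P1 => iteri (eval L st.1 s e) (fun j st => run L P1 (scons j s) st) st
  | PWrite r i e =>
      (set_mem st.1 r (eval L st.1 s i) (flag (eval L st.1 s e != 0)), st.2)
  | PEmit a => (st.1, rcons st.2 a)
  end.

Lemma run_ext L P s s' st : s =1 s' -> run L P s st = run L P s' st.
Proof.
have ev s1 s2 mem e : s1 =1 s2 -> eval L mem s1 e = eval L mem s2 e.
  by move=> E; apply: eval_ext.
elim: P s s' st => //=.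
- by move=> P1 IH1 P2 IH2 s s' st E; rewrite (IH1 _ _ _ E); apply: IH2.
- by move=> e P1 IH1 P2 IH2 s s' st E; rewrite (ev _ _ _ _ E) (IH1 _ _ _ E) (IH2 _ _ _ E).
- move=> e P IH s s' st E; rewrite (ev _ _ _ _ E).
  by apply: eq_iteri => j y; apply: IH; apply: scons_ext.
- by move=> r i e s s' st E; rewrite !(ev _ _ _ _ E).
Qed.

Fixpoint pcompile (o : nat) (fr : nat -> nat) (d : nat) (P : prog) : cmd :=
  match P with
  | PSeq P1 P2 => Seq (pcompile o fr d P1) (pcompile o fr d P2)
  | PIf e P1 P2 =>
      Seq (compile fr d e) (Cond d not_sep (pcompile o fr d P1) (pcompile o fr d P2))
  | PFor e P1 =>
      Seq (compile fr d e) (Seq (clear d.+1)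
        (While d not_sep (Seq (pcompile o (scons d.+1 fr) d.+2 P1)
           (moves (fun k => if k == d then MoveLeft
                            else if k == d.+1 then MoveRight else Stay)))))
  | PWrite r i e =>
      Seq (compile fr d i) (Seq (compile fr d.+1 e) (Seq (clear d.+2) (Seq
        (sweep d (fun k => if k == d then MoveLeft
           else if (k == d.+2) || (k == tape_of r) then MoveRight else Stay))
        (Seq (Cond d.+1 not_sep
               (Do (fun k a => (if k == tape_of r then flag true else a, Stay)))
               (Do (fun k a => (if k == tape_of r then flag false else a, Stay))))
          (sweep d.+2 (fun k => if (k == d.+2) || (k == tape_of r)
                                then MoveLeft else Stay))))))
  | PEmit a => Do (fun k b => if k == o then (Some a, MoveRight) else (b, Stay))
  end.

Fixpoint pdepth (P : prog) : nat :=
  match P with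
  | PSeq P1 P2 => pdepth P1 + pdepth P2
  | PIf e P1 P2 => depth e + pdepth P1 + pdepth P2
  | PFor e P1 => depth e + pdepth P1 + 2
  | PWrite r i e => depth i + depth e + 3
  | PEmit _ => 0
  end.

Fixpoint ptime (L : nat) (P : prog) : nat :=
  let S := 2 * L + 1 in
  match P with
  | PSeq P1 P2 => ptime L P1 + ptime L P2
  | PIf e P1 P2 => time L e + (ptime L P1 + ptime L P2).+1
  | PFor e P1 => time L e + (S + (L * (ptime L P1 + 1).+1).+1)
  | PWrite r i e => time L i + (time L e + (S + (S + (2 + S))))
  | PEmit _ => 1
  end.

Section Compilation.
Variables (L o : nat).

(** Cell 0 of the output tape stays blank: there [finish] stops on its way back to the first output
    letter. *)
Definition represents mem (out : seq letter) f p :=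
  [/\ counters_ok L o f p, mem_ok mem f p, f o 0 = None,
      p o = (size out).+1 & forall i, f o i.+1 = nth None (map Some out) i].

(** The bound on the output length by the running time is what limits the cost of [finish]. *)
Definition after d (out : seq letter) (p : positions) n f' p' (st : memory * seq letter) :=
  [/\ represents st.1 st.2 f' p', (forall k, 5 <= k < d -> p' k = p k)
    & size st.2 <= size out + n].

Lemma represents_same mem out f p d p' : 5 <= d -> represents mem out f p ->
  counters_ok L o f p' -> same_below o d p p' -> represents mem out f p'.
Proof.
move=> d5 [C M F0 po Fo] C' B; split=> //; first exact: mem_ok_same d5 M B.
by rewrite B // leqnn orbT.
Qed.

Lemma wp_pcompile P fr d f p mem out : 0 < L -> represents mem out f p -> 5 <= d ->
  d + pdepth P <= o -> (forall i, 5 <= fr i < d) ->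
  wp (pcompile o fr d P) (ptime L P) f p (fun f' p' =>
    after d out p (ptime L P) f' p'
      (run L P (fun i => (p (fr i)).-1) (mem, out))).
Proof.
have env1 (fr' : nat -> nat) d' (p1 p2 : positions) : (forall i, 5 <= fr' i < d') ->
    (forall k, 5 <= k < d' -> p2 k = p1 k) ->
    (fun i => (p2 (fr' i)).-1) =1 (fun i => (p1 (fr' i)).-1).
  by move=> frd B i; rewrite B //; have := frd i; lia.
move=> L_gt0; elim: P fr d f p mem out => /=.
- move=> P1 IH1 P2 IH2 fr d f p mem out R d5 do_ frd.
  have do1 : d + pdepth P1 <= o by lia.
  apply: wp_Seq (IH1 _ _ _ _ _ _ R d5 do1 frd) _ => f1 p1 [].
  rewrite -/run; case: (run _ P1 _ _) => mem1 out1 /= R1 B1 S1.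
  have do2 : d + pdepth P2 <= o by lia.
  apply: wp_weaken (IH2 _ _ _ _ _ _ R1 d5 do2 frd) (leqnn _) _ => f2 p2 [].
  rewrite -/run (run_ext _ _ _ (env1 _ _ _ _ frd B1)) => R2 B2 S2; split=> //.
    by move=> k kd; rewrite B2 ?B1.
  by apply: leq_trans S2 _; rewrite addnA leq_add2r.
- move=> e P1 IH1 P2 IH2 fr d f p mem out R d5 do_ frd.
  have [C M F0 po Fo] := R.
  have dg := depth_gt0 e.
  have do1 : d + depth e <= o by lia.
  apply: wp_Seq (wp_pos_compile L_gt0 C M d5 do1 frd) _ => f1 p1 [-> [C1 B1 E1]].
  have R1 := represents_same d5 R C1 B1.
  have [fd pd] : _ /\ _ := C1 d ltac:(lia).
  have B1' k : 5 <= k < d -> p1 k = p k by move=> kd; rewrite B1 //; lia.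
  apply: wp_Cond; rewrite fd E1 ruler_sep lt0n.
  have sub P' : (P' = P1) \/ (P' = P2) ->
     wp (pcompile o fr d P') (ptime L P') f p1 (fun f' p' =>
        after d out p1 (ptime L P') f' p'
          (run L P' (fun i => (p1 (fr i)).-1) (mem, out))) ->
     wp (pcompile o fr d P') (ptime L P1 + ptime L P2) f p1 (fun f' p' =>
        after d out p (time L e + (ptime L P1 + ptime L P2).+1) f' p'
          (run L P' (fun i => (p (fr i)).-1) (mem, out))).
    move=> P12 W; apply: wp_weaken W _ _ => [|f2 p2 []].
      by case: P12 => ->; lia.
    rewrite (run_ext _ _ _ (env1 _ _ _ _ frd B1')) => R2 B2 S2; split=> //.
      by move=> k kd; rewrite B2 ?B1'.
    by apply: leq_trans S2 _; case: P12 => ->; lia.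
  case: (eqVneq (eval _ _ _ e) 0) => Z.
    apply: (sub P2); [by right|apply: IH2 => //; lia].
  apply: (sub P1); [by left|apply: IH1 => //; lia].
- move=> e P IH fr d f p mem out R d5 do_ frd.
  have [C M F0 po Fo] := R.
  have dg := depth_gt0 e.
  have do1 : d + depth e <= o by lia.
  apply: wp_Seq (wp_pos_compile L_gt0 C M d5 do1 frd) _ => f1 p1 [-> [C1 B1 E1]].
  have [fd1 pd1] : _ /\ _ := C1 d.+1 ltac:(lia).
  apply: wp_Seq (wp_pos_clear fd1 pd1) _ => f2 p2 [-> E2].
  set s := fun i => (p (fr i)).-1.
  set cnt := eval L mem s e in E1 *.
  have cL : cnt <= L by have [_] : _ /\ _ := C1 d ltac:(lia); rewrite E1; lia.
  set G := fun j st => run L P (scons j s) st.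
  pose I j f' p' := let st := iteri j G (mem, out) in
    [/\ represents st.1 st.2 f' p', (forall k, 5 <= k < d -> p' k = p k),
        size st.2 <= size out + j * ptime L P, p' d = (cnt - j).+1 & p' d.+1 = j.+1].
  have le : (cnt * (ptime L P + 1).+1).+1 <= (L * (ptime L P + 1).+1).+1.
    by rewrite ltnS leq_mul2r cL orbT.
  apply: wp_weaken le (fun _ _ H => H).
  apply: (wp_While (I := I)).
  + split=> //=.
    * apply: (represents_same d5 R).
        by apply: counters_ok_upd C1 _ E2.
      apply: same_below_trans (leqnn _) B1 _.
      by apply: same_below_upd E2; lia.
    * by move=> k kd; rewrite E2 /upd ifF ?B1 //; lia.
    * by rewrite addn0.
    * by rewrite E2 /upd ifF ?subn0 //; lia.
    * by rewrite E2 /upd eqxx.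
  + rewrite /I => j f3 p3 jc [R3 B3 S3 Ed Ed1].
    have [C3 M3 F03 po3 Fo3] := R3.
    have [fd pd] : _ /\ _ := C3 d ltac:(lia).
    split; first by rewrite fd Ed ruler_sep; lia.
    have d5' : 5 <= d.+2 by lia.
    have do2 : d.+2 + pdepth P <= o by lia.
    have frd' x : 5 <= scons d.+1 fr x < d.+2.
      by case: x => [|x] /=; [lia|have := frd x; lia].
    apply: wp_Seq (IH _ _ _ _ _ _ R3 d5' do2 frd') _ => f4 p4 [] /=.
    have Es : (fun i => (p3 (scons d.+1 fr i)).-1) =1 scons j s.
      case=> [|x] /=; first by rewrite Ed1.
      by rewrite /s B3.
    rewrite -surjective_pairing (run_ext _ _ _ Es) -/(G j _) => R4 B4 S4.
    have Ed4 : p4 d = (cnt - j).+1 by rewrite B4 ?Ed //; lia.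
    have Ed14 : p4 d.+1 = j.+1 by rewrite B4 ?Ed1 //; lia.
    set st := G j _ in R4 S4 *.
    have [C4 M4 F04 po4 Fo4] := R4.
    apply: wp_weaken (leqnn _) _; first apply: wp_pos_moves => [k|].
    * by case: eqP => [->|_]; [rewrite Ed4|case: ifP].
    * exact: (erefl : (fun p' => p' = fun k => moved (if k == d then MoveLeft
          else if k == d.+1 then MoveRight else Stay) (p4 k)) _).
    move=> f5 p5 [-> ->]; split=> /=.
    * apply: represents_same (leqnn 5) R4 _ _.
      - move=> k ko; have [fk pk] := C4 k ko; split=> //.
        case: eqP => [->|_]; first by rewrite Ed4 /=; lia.
        by case: eqP => [->|_] //; rewrite Ed14 /=; lia.
      - by move=> k ko; rewrite !ifF //; lia.
    * by move=> k kd; rewrite !ifF ?B4 ?B3 //=; lia.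
    * by apply: leq_trans S4 _; rewrite mulSn; lia.
    * by rewrite eqxx Ed4 /=; lia.
    * by rewrite ifF ?eqxx ?Ed14 //; lia.
  + rewrite /I => f3 p3 [R3 B3 S3 Ed Ed1].
    have [C3 M3 F03 po3 Fo3] := R3.
    have [fd pd] : _ /\ _ := C3 d ltac:(lia).
    split; first by rewrite fd Ed subnn ruler_sep.
    split=> //; apply: leq_trans S3 _; rewrite leq_add2l.
    have : cnt * ptime L P <= L * ptime L P by rewrite leq_mul2r cL orbT.
    have : L * ptime L P <= L * (ptime L P + 1).+1.
      by rewrite leq_mul2l; apply/orP; right; lia.
    lia.
- move=> r i e fr d f p mem out R d5 do_ frd.
  have [C M F0 po Fo] := R.
  have dgi := depth_gt0 i; have dge := depth_gt0 e.
  have rd := tape_of_lt r.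
  have do1 : d + depth i <= o by lia.
  apply: wp_Seq (wp_pos_compile L_gt0 C M d5 do1 frd) _ => f1 p1 [-> [C1 B1 E1]].
  have M1 := mem_ok_same d5 M B1.
  have d5' : 5 <= d.+1 by lia.
  have do2 : d.+1 + depth e <= o by lia.
  have frd' j : 5 <= fr j < d.+1 by have := frd j; lia.
  apply: wp_Seq (wp_pos_compile L_gt0 C1 M1 d5' do2 frd') _ => f2 p2 [-> [C2 B2 E2]].
  have [fd2 pd2] : _ /\ _ := C2 d.+2 ltac:(lia).
  apply: wp_Seq (wp_pos_clear fd2 pd2) _ => f3 p3 [-> E3].
  set s := fun j => (p (fr j)).-1.
  have {}E2 : p2 d.+1 = (eval L mem s e).+1.
    rewrite E2; congr _.+1; apply: eval_ext => //; apply: env1 frd _ => k kd.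
    by rewrite B1 //; lia.
  set v := eval L mem s i in E1 *.
  have vL : v <= L by have [_] : _ /\ _ := C1 d ltac:(lia); rewrite E1; lia.
  have Ed3 : p3 d = v.+1 by rewrite E3 /upd ifF ?B2 ?E1 //; lia.
  have [Mr1 Mr2] := M r.
  have [fd pd] : _ /\ _ := C1 d ltac:(lia).
  have [fd1 pd1] : _ /\ _ := C1 d.+1 ltac:(lia).
  have Er3 : p3 (tape_of r) = 1.
    by rewrite E3 /upd ifF ?B2 ?B1 //; lia.
  apply: wp_Seq (wp_pos_sweep_max vL fd Ed3 _ _) _ => [|j|f4 p4 [-> E4]].
  + by rewrite eqxx.
  + by case: eqP => [->|_]; [lia|case: ifP].
  have Ed4 : p4 d = 1 by rewrite E4 eqxx /= Ed3; lia.
  have Er4 : p4 (tape_of r) = v.+1.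
    by rewrite E4 ifF ?eqxx ?orbT /= ?Er3 //; lia.
  have Ed24 : p4 d.+2 = v.+1.
    by rewrite E4 ifF ?eqxx /= ?E3 /upd ?eqxx ?add1n //; lia.
  have Ed14 : p4 d.+1 = (eval L mem s e).+1.
    by rewrite E4 !ifF /= ?E3 /upd ?ifF ?E2 //; lia.
  set c := flag _.
  pose f5 := upd f (tape_of r) (upd (f (tape_of r)) v.+1 c).
  apply: (@wp_Seq _ _ 2 _ _ _ _ (fun f' p' => f' = f5 /\ p' = p4)).
    apply: wp_Cond; rewrite fd1 Ed14 ruler_sep lt0n.
    have W b : b = (eval L mem s e != 0) ->
      wp (Do (fun k a => (if k == tape_of r then flag b else a, Stay))) 1 f p4
        (fun f' p' => f' = f5 /\ p' = p4).
      move=> eb; apply: (wp_Do (f' := f5) (p' := p4)) => // k /=; split=> // x.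
      rewrite /f5 /upd; case: (eqVneq k (tape_of r)) => [->|kr].
        by rewrite Er4; case: eqP => // _; rewrite /c eb.
      by case: eqP => // ->.
    by case: (eval L mem s e != 0) (W _ erefl).
  move=> _ _ [-> ->].
  have C5 : counters_ok L o f5 p4.
    move=> k ko; have [fk pk] := C2 k ko; split.
      by rewrite /f5 /upd ifF //; lia.
    rewrite E4; case: (eqVneq k d) => [->|n1] /=; first by rewrite Ed3; lia.
    have -> : (k == tape_of r) = false by lia.
    rewrite orbF; case: (eqVneq k d.+2) => [->|n2] /=.
      by rewrite E3 /upd eqxx; lia.
    by rewrite E3 /upd (negbTE n2).
  have fd25 : f5 d.+2 =1 ruler L by have [] := C5 d.+2 ltac:(lia).
  apply: wp_weaken (wp_pos_sweep_max vL fd25 Ed24 _ _) (leqnn _) _ => [|j|f6 p6 [-> E6]].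
  + by rewrite eqxx.
  + by case: ifP => // /orP[/eqP->|/eqP->] _; lia.
  have E6' k : (k != d) && (k != d.+1) && (k != d.+2) -> (k < d.+1) || (o <= k) -> p6 k = p k.
    move=> /andP[/andP[n1 n2] n3] kd.
    rewrite E6 (negbTE n3) /=; case: (eqVneq k (tape_of r)) => [->|n4] /=.
      by rewrite Er4 Mr1; lia.
    rewrite E4 (negbTE n1) (negbTE n3) (negbTE n4) /= E3 /upd (negbTE n3) B2 //.
    by rewrite B1 //; lia.
  split.
  + split=> /=.
    * move=> k ko; have [fk pk] := C5 k ko; split=> //.
      rewrite E6; case: ifP => //= /orP[/eqP->|/eqP kr]; last by lia.
      by rewrite Ed24; lia.
    * move=> r'; have rd' := tape_of_lt r'; have [Mr1' Mr2'] := M r'.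
      split; first by rewrite E6' //; lia.
      move=> x; rewrite /f5 /set_mem /upd.
      have -> : (tape_of r' == tape_of r) = (r' == r) by [].
      by case: eqP => [->|_] //=; rewrite eqSS; case: eqP.
    * by rewrite /f5 /upd ifF ?F0 //; lia.
    * by rewrite E6' //; lia.
    * by move=> x; rewrite /f5 /upd ifF ?Fo //; lia.
  + by move=> k kd; rewrite E6' //; lia.
  + by rewrite leq_addr.
- move=> a fr d f p mem out R d5 do_ frd.
  have [C M F0 po Fo] := R.
  apply: (wp_Do (f' := upd f o (upd (f o) (p o) (Some a))) (p' := upd p o (p o).+1)).
    move=> k /=; rewrite /upd; case: eqP => [->|] //=; split=> // x.
    by case: eqP => // ->.
  split=> /=; last by rewrite size_rcons addn1.
  + split.
    * by move=> k ko; have [fk pk] := C k ko; rewrite /upd; have -> : (k == o) = false by lia.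
    * move=> r; have [Mr1 Mr2] := M r; have rd := tape_of_lt r.
      by rewrite /upd; have -> : (tape_of r == o) = false by lia.
    * by rewrite /upd eqxx po /=.
    * by rewrite /upd eqxx po size_rcons.
    * move=> x; rewrite /upd eqxx po eqSS map_rcons nth_rcons size_map Fo.
      case: ltngtP => // lt; by rewrite nth_default // size_map ltnW.
  + by move=> k kd; rewrite /upd ifF //; lia.
Qed.

End Compilation.

(** * Machines from programs *)

Definition poly_bounded (h : nat -> nat) :=
  exists p : {poly nat}, forall L, h L <= (p.[L])%R.

Lemma poly_bounded_const c : poly_bounded (fun _ => c).
Proof. by exists (c%:P)%R => L; rewrite hornerC. Qed.

Lemma poly_bounded_id : poly_bounded id.
Proof. by exists 'X%R => L; rewrite hornerX. Qed.

Lemma poly_bounded_add g h : poly_bounded g -> poly_bounded h ->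
  poly_bounded (fun L => g L + h L).
Proof. by move=> [p P] [q Q]; exists (p + q)%R => L; rewrite hornerD leq_add. Qed.

Lemma poly_bounded_mul g h : poly_bounded g -> poly_bounded h ->
  poly_bounded (fun L => g L * h L).
Proof. by move=> [p P] [q Q]; exists (p * q)%R => L; rewrite hornerM leq_mul. Qed.

Lemma poly_bounded_succ g : poly_bounded g -> poly_bounded (fun L => (g L).+1).
Proof. by move=> [p P]; exists (p + 1%:P)%R => L; rewrite hornerD hornerC -addn1 leq_add. Qed.

Ltac poly_bound :=
  repeat first [ assumption | apply: poly_bounded_const | apply: poly_bounded_id
    | apply: poly_bounded_succ | apply: poly_bounded_add | apply: poly_bounded_mul ].

Lemma poly_bounded_time e : poly_bounded (fun L => time L e).
Proof. by elim: e => /= *; poly_bound. Qed.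

Lemma poly_bounded_ptime P : poly_bounded (fun L => ptime L P).
Proof. by elim: P => /= *; poly_bound; apply: poly_bounded_time. Qed.

Definition counter o k := 5 <= k < o.
Definition mark o (c : letter) : cmd :=
  Do (fun k a => if counter o k then (Some c, MoveRight) else (a, Stay)).
Fixpoint marks o n : cmd :=
  if n is n'.+1 then Seq (mark o (Bit true)) (marks o n') else skip.

(** All rulers are written at once during a scan of the input, one [Sep] and then eight cells per
    letter; this yields [L = 8 |w| + 1] without arithmetic. Every counter is left at value [L]. *)
Definition setup o : cmd :=
  Seq (mark o Sep) (Seq
    (While 0 isSome (Seq (marks o 8) (move_tape 0 MoveRight))) (Seq
    (move_tape 0 MoveLeft) (Seq
    (While 0 isSome (move_tape 0 MoveLeft))
    (move_tape 0 MoveRight)))).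

Definition finish o : cmd :=
  Seq (move_tape o MoveLeft) (Seq
    (While o isSome (move_tape o MoveLeft))
    (move_tape o MoveRight)).

Definition initial_contents (w : seq letter) : contents :=
  fun k i => if k == 0 then nth None (None :: map Some w) i else None.

Lemma initial_contents_pos (w : seq letter) i :
  initial_contents w 0 i.+1 = nth None (map Some w) i.
Proof. by []. Qed.

Lemma initial_contents_some (w : seq letter) i :
  isSome (initial_contents w 0 i) = (0 < i <= size w).
Proof.
case: i => [|i] //; rewrite initial_contents_pos ltnS.
by elim: w i => [|a w IH] [|i] //=; rewrite IH.
Qed.

Lemma at_initial_tapes w : at_tapes (initial_tapes w) (initial_contents w) (fun _ => 1).
Proof.
move=> k; split=> /= i; rewrite /initial_contents.
  by rewrite add1n; case: eqP => // _; rewrite nth_nil.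
by case: i => // _; rewrite nth_nil; case: eqP.
Qed.

Section Setup.
Variables (o : nat) (w : seq letter).

Definition prepared i M (f : contents) (p : positions) :=
  [/\ p 0 = i,
      forall k, ~~ counter o k -> f k =1 initial_contents w k /\ (k != 0 -> p k = 1)
    & forall k, counter o k -> f k =1 ruler M /\ p k = M.+1].

Lemma wp_mark i M f p : prepared i M f p -> 0 < M ->
  wp (mark o (Bit true)) 1 f p (prepared i M.+1).
Proof.
move=> [p0 E C] M0.
apply: (wp_Do (f' := fun k => if counter o k then ruler M.+1 else f k)
              (p' := fun k => if counter o k then M.+2 else p k)).
  move=> k /=; case: ifP => ck /=.
    have [fk pk] := C k ck; split=> //; last by rewrite pk.
    move=> x; rewrite /upd pk; case: eqP => [->|/eqP nx].
      by rewrite /ruler eqSS ltnS M0 ltnSn -(prednK M0).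
    by rewrite fk /ruler; case: eqP => // _; congr (if _ then _ else _); lia.
  by split=> // x; rewrite /upd; case: eqP => // ->.
split=> //= [k nc|k ck]; last by rewrite ck.
by rewrite (negbTE nc); apply: E.
Qed.

Lemma wp_marks n i M f p : prepared i M f p -> 0 < M ->
  wp (marks o n) n.+1 f p (prepared i (M + n)).
Proof.
elim: n M f p => [|n IH] M f p R M0.
  rewrite addn0; apply: (wp_Do (f' := f) (p' := p)) => // k; split=> // x.
  by rewrite /upd; case: eqP => // ->.
rewrite /= -[n.+2]add1n; apply: wp_Seq (wp_mark R M0) _ => f1 p1 R1.
by rewrite addnS -addSn; apply: IH.
Qed.

Lemma wp_move_input m i M f p : prepared i M f p -> (m = MoveLeft -> 0 < i) ->
  wp (move_tape 0 m) 1 f p (prepared (moved m i) M).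
Proof.
move=> [p0 E C] mp; apply: wp_weaken (leqnn _) _.
  apply: (wp_pos_moves (Q := fun p' => p' = fun k => moved (if k == 0 then m else Stay) (p k))) => //.
  by move=> k; case: eqP => // -> /mp; rewrite p0.
move=> _ _ [-> ->]; split=> /=; first by rewrite p0.
  by move=> k nc; have [fk pk] := E k nc; split=> // k0; rewrite (negbTE k0) pk.
move=> k ck; have [fk pk] := C k ck; split=> //.
by rewrite ifF //; move: ck; rewrite /counter; lia.
Qed.

Definition setup_time (n : nat) : nat :=
  1 + ((n * (9 + 1).+1).+1 + (1 + ((n * 2).+1 + 1))).

Lemma wp_setup : wp (setup o) (setup_time (size w)) (initial_contents w) (fun _ => 1)
  (prepared 1 (8 * size w + 1)).
Proof.
have read0 i M f p : prepared i M f p -> isSome (f 0 (p 0)) = (0 < i <= size w).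
  by move=> [-> E C]; have [E0 _] := E 0 isT; rewrite E0 initial_contents_some.
apply: (@wp_Seq _ _ _ _ _ _ _ (prepared 1 1)).
  apply: (wp_Do (f' := fun k => if counter o k then ruler 1 else initial_contents w k)
                (p' := fun k => if counter o k then 2 else 1)).
    move=> k /=; case: ifP => ck /=; split=> // x.
      rewrite /upd /ruler; case: eqP => // _; rewrite ifF; last by lia.
      by rewrite /initial_contents ifF //; move: ck; rewrite /counter; lia.
    by rewrite /upd; case: eqP => // ->.
  by split=> // [k nc|k ck]; [rewrite (negbTE nc)|rewrite ck].
move=> f p R.
apply: (@wp_Seq _ _ _ _ _ _ _ (prepared (size w).+1 (8 * size w + 1))).
  apply: (wp_While (I := fun i => prepared i.+1 (8 * i + 1))) => //.
    move=> i f1 p1 iN R1; split; first by rewrite (read0 _ _ _ _ R1).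
    apply: wp_Seq (wp_marks 8 R1 _) _ => [|f2 p2 R2]; first by lia.
    apply: wp_weaken (wp_move_input (m := MoveRight) R2 _) (leqnn _) _ => // f3 p3.
    by have -> : 8 * i + 1 + 8 = 8 * i.+1 + 1 by lia.
  by move=> f1 p1 R1; rewrite (read0 _ _ _ _ R1) ltnn.
move=> f1 p1 R1.
apply: wp_Seq (wp_move_input (m := MoveLeft) R1 _) _ => // f2 p2 /= R2.
apply: (@wp_Seq _ _ _ _ _ _ _ (prepared 0 (8 * size w + 1))).
  apply: (wp_While (I := fun i => prepared (size w - i) (8 * size w + 1))).
  + by rewrite subn0.
  + move=> i f3 p3 iN R3; split; first by rewrite (read0 _ _ _ _ R3); lia.
    rewrite subnS; apply: (wp_move_input (m := MoveLeft) R3) => _; lia.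
  + by move=> f3 p3; rewrite subnn => R3; split=> //; rewrite (read0 _ _ _ _ R3).
by move=> f3 p3 R3; apply: (wp_move_input (m := MoveRight) R3).
Qed.

End Setup.

Definition initial_memory (w : seq letter) : memory :=
  fun r i => if r == InputTape then nth None (map Some w) i else None.

Lemma prepared_represents o w f p : 5 <= o -> let L := 8 * size w + 1 in
  prepared o w 1 L f p -> represents L o (initial_memory w) [::] f p.
Proof.
move=> o5 L [p0 E C].
have no : ~~ counter o o by rewrite /counter; lia.
have [fo po] := E o no.
split.
- by move=> k ck; have [fk pk] := C k ck; split=> //; rewrite pk; lia.
- move=> r; have rd := tape_of_lt r.
  have nr : ~~ counter o (tape_of r) by rewrite /counter; lia.
  have [fr pr] := E _ nr; split=> [|i].
    by case: r pr {nr fr rd} => /= pr; rewrite ?p0 ?pr.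
  by rewrite fr /initial_memory; case: r {nr fr pr rd}.
- by rewrite fo /initial_contents ifF //; lia.
- by rewrite po //; lia.
- by move=> i; rewrite fo /initial_contents nth_nil ifF //; lia.
Qed.

Lemma wp_finish L o mem out f p : represents L o mem out f p ->
  wp (finish o) (1 + ((size out * 2).+1 + 1)) f p
    (fun f' p' => p' o = 1 /\ forall i, f' o i.+1 = nth None (map Some out) i).
Proof.
move=> [_ _ F0 po Fo].
have mv m q : (m = MoveLeft -> 0 < q o) ->
    wp_pos (move_tape o m) 1 f q (fun q' => q' o = moved m (q o)).
  by move=> mq; apply: wp_pos_moves => [k|]; [case: eqP => // ->|rewrite eqxx].
have some i : i <= size out -> isSome (f o i) = (0 < i).
  case: i => [|i] i_lt; first by rewrite F0.
  by rewrite Fo (nth_map Sep).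
apply: wp_Seq (mv MoveLeft p _) _ => [|_ p1 [-> /= E1]]; first by rewrite po.
have {}E1 : p1 o = size out by rewrite E1 po.
apply: (@wp_Seq _ _ _ _ _ _ _ (fun f' p' => f' = f /\ p' o = 0)).
  apply: (wp_pos_While (I := fun i p' => p' o = size out - i)).
  + by rewrite E1 subn0.
  + move=> i p2 iN E2; split; first by rewrite E2 some; lia.
    apply: wp_pos_weaken (mv MoveLeft p2 _) (leqnn _) _ => [_|p3 ->]; first by lia.
    by rewrite E2 /=; lia.
  + by move=> p2 E2; rewrite E2 subnn F0.
move=> _ p2 [-> E2].
apply: wp_weaken (mv MoveRight p2 _) (leqnn _) _ => // _ p3 [-> ->].
by rewrite E2.
Qed.

Lemma until_blank_nth (s : seq cell) (out : seq letter) :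
  (forall i, nth None s i = nth None (map Some out) i) -> until_blank s = out.
Proof.
elim: out s => [|a out IH] [|c s] E //=.
- by have := E 0 => /= ->.
- by have := E 0.
- by have := E 0 => /= ->; rewrite (IH s) // => i; have := E i.+1.
Qed.

Lemma tests_below_compile e fr d K : 5 <= d -> d + depth e <= K ->
  (forall i, fr i < d) -> tests_below K (compile fr d e).
Proof.
elim: e fr d => /=.
- by move=> i fr d d5 dK frd; have := frd i; lia.
- by move=> fr d d5 dK frd; lia.
- by move=> fr d d5 dK frd; lia.
- by move=> e IH fr d d5 dK frd; have dg := depth_gt0 e; rewrite IH //=; lia.
- by move=> e IH fr d d5 dK frd; have dg := depth_gt0 e; rewrite IH //=; lia.
- move=> e IH a IHa b IHb fr d d5 dK frd.
  by have dg := depth_gt0 e; rewrite IH ?IHa ?IHb //=; lia.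
- move=> a IHa b IHb fr d d5 dK frd; rewrite IHa ?IHb //=; try lia.
  by case=> [|i] /=; [lia|have := frd i; lia].
- by move=> r e IH fr d d5 dK frd; apply: IH.
- move=> c IHc i IHi b IHb fr d d5 dK frd.
  rewrite IHc ?IHi ?IHb //=; try lia.
  + by case=> [|[|j]] /=; [lia|lia|have := frd j; lia].
  + by move=> j; have := frd j; lia.
- move=> r a e IH fr d d5 dK frd; have rd := tape_of_lt r.
  by rewrite IH //=; lia.
Qed.

Lemma tests_below_pcompile P o fr d K : 5 <= d -> d + pdepth P <= K ->
  (forall i, fr i < d) -> tests_below K (pcompile o fr d P).
Proof.
elim: P fr d => //=.
- by move=> P1 IH1 P2 IH2 fr d d5 dK frd; rewrite IH1 ?IH2 //; lia.
- move=> e P1 IH1 P2 IH2 fr d d5 dK frd; have dg := depth_gt0 e.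
  by rewrite tests_below_compile ?IH1 ?IH2 //=; lia.
- move=> e P IH fr d d5 dK frd; have dg := depth_gt0 e.
  rewrite tests_below_compile ?IH //=; try lia.
  by case=> [|i] /=; [lia|have := frd i; lia].
- move=> r i e fr d d5 dK frd.
  have dgi := depth_gt0 i; have dge := depth_gt0 e.
  rewrite !tests_below_compile //=; try lia.
  by move=> j; have := frd j; lia.
Qed.

Lemma program_machine (P : prog) : exists (M : machine) (pol : {poly nat}),
  forall w : seq letter, exists (t : nat) (s : nat -> nat),
    t <= (pol.[size w])%R /\
    halts_within M w t (run (8 * size w + 1) P s (initial_memory w, [::])).2.
Proof.
(* Tapes 0 to 4 are the memory, tape 5 stands for every free variable, work space starts at 6, and
   [o] is the output tape. *)
pose o := 6 + pdepth P.
pose c := Seq (setup o) (Seq (pcompile o (fun _ => 5) 6 P) (finish o)).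
have [q Q] := poly_bounded_ptime P.
have [q' Q'] : poly_bounded (fun n => setup_time n + (n + (n * 2 + 3))).
  by rewrite /setup_time; poly_bound.
(* [q] bounds the program in terms of [L], hence the composition; it counts once for the run and
   twice for rewinding an output of at most that length. *)
exists (machine_of o c), (q' + (q \Po (8%:P * 'X + 1%:P)) *+ 3)%R => w.
set L := 8 * size w + 1.
have o5 : 5 <= o by rewrite /o; lia.
have W : wp c (setup_time (size w) + (ptime L P + (ptime L P * 2 + 3)))
    (initial_contents w) (fun _ => 1) (fun f' p' => exists s, p' o = 1 /\
      forall i, f' o i.+1 = nth None (map Some
        (run L P s (initial_memory w, [::])).2) i).
  rewrite /c; apply: wp_Seq (@wp_setup o w) _ => f p R.
  have {}R := prepared_represents o5 R.
  have L0 : 0 < L by rewrite /L; lia.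
  apply: wp_Seq (wp_pcompile (P := P) (d := 6) (fr := fun _ => 5) L0 R _ _ _) _ => //.
  move=> f1 p1 [R1 _ S1].
  apply: wp_weaken (wp_finish R1) _ _ => [|f2 p2 H]; first by move: S1 => /=; lia.
  by exists (fun _ => (p 5).-1).
have [n [T' [f' [p' [nt E A [s [po Fo]]]]]]] := W _ (at_initial_tapes w).
exists n, s; split; last first.
  have -> : (run L P s (initial_memory w, [::])).2 = until_blank (right_of (T' o)).
    apply/esym/until_blank_nth => i.
    by have [R _] := A o; rewrite R po add1n Fo.
  apply: compile_run E; rewrite /c /=.
  rewrite tests_below_pcompile //=; try by rewrite /o; lia.
apply: leq_trans nt _.
rewrite hornerD hornerMn horner_comp hornerD hornerM !hornerC hornerX.
have := Q L; have := Q' (size w).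
have -> : (8 * size w + 1)%R = L by [].
set x := (q.[L])%R; set y := (q'.[_])%R.
have -> : (y + x *+ 3)%R = y + 3 * x by rewrite !GRing.mulrS GRing.mulr0n; lia.
lia.
Qed.

(** * Logic and arithmetic of expressions *)

Definition lift n e := Ren (addn n) e.
Definition One := Succ Zero.
Definition Not e := Ite e Zero One.
Definition And a b := Ite a b Zero.
Definition Or a b := Ite a a b.
Definition Flag e := Ite e One Zero.
Definition Add a b := Fold b a (Succ (Var 0)).
Definition Sub a b := Fold b a (Pred (Var 0)).
Definition Lt a b := Sub b a.
Definition Le a b := Not (Lt b a).
Definition Eq a b := And (Le a b) (Le b a).
Definition Mul a b := Fold b Zero (Add (Var 0) (lift 2 a)).
Definition Odd a := Fold a Zero (Not (Var 0)).
(** Counts the odd numbers below [a]. *)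
Definition Half a := Fold a Zero (Ite (Odd (Var 1)) (Succ (Var 0)) (Var 0)).
(* In [Ex], [All], [Count] and [Sum] the bound variable is variable 0 of the
   body; [Ren succn] hides the accumulator from the body. *)
Definition Ex c b := Fold c Zero (Or (Var 0) (Ren succn b)).
Definition All c b := Not (Ex c (Not b)).
Definition Sum c b := Fold c Zero (Add (Var 0) (Ren succn b)).
Definition Count c b := Sum c (Flag b).

Section Operators.
Variables (L : nat) (mem : memory).
Implicit Types (s : nat -> nat) (a b c e : expr).
Notation ev := (eval L mem).
Definition holds s e := eval L mem s e != 0.

Lemma eval_Fold s c i b : ev s (Fold c i b) =
  iteri (ev s c) (fun j acc => ev (scons acc (scons j s)) b) (ev s i).
Proof. by []. Qed.

(** As summands are nonnegative, cutting off at [L] in every round is the same as cutting off once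
    at the end. *)
Lemma iteri_minn n (h : nat -> nat) x : x <= L ->
  iteri n (fun i acc => minn (acc + h i) L) x = minn (x + \sum_(i < n) h i) L.
Proof.
move=> xL; elim: n => [|n IH] /=; first by rewrite big_ord0; lia.
by rewrite IH big_ord_recr /=; lia.
Qed.

Lemma eval_Add s a b : ev s a <= L -> ev s (Add a b) = minn (ev s a + ev s b) L.
Proof.
move=> aL; have := iteri_minn (ev s b) (fun=> 1) aL.
rewrite sum_nat_const card_ord muln1 => <- /=.
by apply: eq_iteri => i x; rewrite addn1.
Qed.

Lemma eval_Sub s a b : ev s (Sub a b) = ev s a - ev s b.
Proof. by rewrite /=; elim: (ev s b) => [|n IH] /=; [rewrite subn0|rewrite IH subnS]. Qed.

Lemma holds_Lt s a b : holds s (Lt a b) = (ev s a < ev s b).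
Proof. by rewrite /holds eval_Sub -lt0n subn_gt0. Qed.

Lemma holds_And s a b : holds s (And a b) = holds s a && holds s b.
Proof. by rewrite /holds /=; case: (eqVneq (ev s a) 0). Qed.

Lemma holds_Or s a b : holds s (Or a b) = holds s a || holds s b.
Proof. by rewrite /holds /=; case: (eqVneq (ev s a) 0) => // /negbTE->. Qed.

Lemma eval_Ite s e a b : ev s (Ite e a b) = if holds s e then ev s a else ev s b.
Proof. by rewrite /holds if_neg. Qed.

Lemma holds_Look s r x e : holds s (Look r x e) = (mem r (ev s e) == Some x).
Proof. by rewrite /holds /= eqb0 negbK. Qed.

Lemma eval_Sum s c b n : ev s c = n ->
  ev s (Sum c b) = minn (\sum_(i < n) ev (scons i s) b) L.
Proof.
move=> <-; rewrite /Sum /=.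
transitivity (iteri (ev s c) (fun i acc => minn (acc + ev (scons i s) b) L) 0).
  elim: (ev s c) => //= k IH; rewrite {1}IH.
  have {}IH : iteri k (fun i acc => minn (acc + ev (scons i s) b) L) 0 <= L.
    by case: k {IH} => //= k; lia.
  set x := iteri _ _ _ in IH *.
  have := @eval_Add (scons x (scons k s)) (Var 0) (Ren succn b) IH.
  by rewrite /=.
by rewrite iteri_minn.
Qed.

Lemma eval_Mul s a b : ev s a * ev s b <= L -> ev s (Mul a b) = ev s a * ev s b.
Proof.
move=> abL; rewrite /Mul /=.
have : ev s b <= ev s b by [].
elim: {1 3 4}(ev s b) => [|k IH] kb /=; first by rewrite muln0.
have le : ev s a * k.+1 <= L by apply: leq_trans abL; rewrite leq_mul2l kb orbT.
rewrite mulnS in le.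
rewrite IH; last exact: ltnW.
have le' : ev s a * k <= L by apply: leq_trans le; apply: leq_addl.
apply: etrans (@eval_Add (scons (ev s a * k) (scons k s)) (Var 0) (lift 2 a) le') _.
change (minn (ev s a * k + ev s a) L = ev s a * k.+1).
by rewrite mulnS addnC; apply/minn_idPl.
Qed.

Lemma holds_Ex s c b n : ev s c = n ->
  holds s (Ex c b) = [exists x : 'I_n, holds (scons x s) b].
Proof.
move=> <-; rewrite /holds /Ex /=; move: (ev s c) => k.
elim: k => [|k IH] /=; first by apply/esym/existsP => -[[]].
set v := iteri _ _ _ in IH *; transitivity ((v != 0) || (ev (scons k s) b != 0)).
  by case: (v).
rewrite {}IH; apply/orP/existsP => [[/existsP[x H]|H]|[x H]].
- by exists (widen_ord (leqnSn k) x).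
- by exists ord_max.
- have [xk|xk] := eqVneq (x : nat) k; first by right; rewrite -xk.
  left; apply/existsP.
  have lt : x < k by have := ltn_ord x; lia.
  by exists (Ordinal lt).
Qed.

Lemma odd_iteri n (f : nat -> nat) : (forall x, (f x != 0) = (x == 0)) ->
  (iteri n (fun _ => f) 0 != 0) = odd n.
Proof. by move=> H; elim: n => //= n <-; rewrite H; case: eqP. Qed.

Hypothesis L_gt0 : 0 < L.

Lemma eval_One s : ev s One = 1. Proof. by rewrite /=; lia. Qed.

Lemma holds_Not s e : holds s (Not e) = ~~ holds s e.
Proof.
change ((if ev s e == 0 then ev s One else 0) != 0 = ~~ (ev s e != 0)).
by rewrite eval_One; case: (ev s e == 0).
Qed.

Lemma eval_Flag s e : ev s (Flag e) = holds s e.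
Proof.
change ((if ev s e == 0 then 0 else ev s One) = (ev s e != 0)).
by rewrite eval_One; case: (ev s e == 0).
Qed.

Lemma holds_Le s a b : holds s (Le a b) = (ev s a <= ev s b).
Proof. by rewrite holds_Not holds_Lt -leqNgt. Qed.

Lemma holds_Eq s a b : holds s (Eq a b) = (ev s a == ev s b).
Proof. by rewrite holds_And !holds_Le eqn_leq. Qed.

Lemma holds_All s c b n : ev s c = n ->
  holds s (All c b) = [forall x : 'I_n, holds (scons x s) b].
Proof.
move=> cn; rewrite holds_Not (holds_Ex _ cn) negb_exists.
by apply: eq_forallb => x; rewrite holds_Not negbK.
Qed.

Lemma eval_Count s c b n : ev s c = n -> n <= L ->
  ev s (Count c b) = \sum_(i < n) holds (scons i s) b.
Proof.
move=> cn nL; rewrite (eval_Sum _ cn) (eq_bigr _ (fun i _ => eval_Flag _ _)).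
apply/minn_idPl; apply: leq_trans nL; rewrite -[X in _ <= X]card_ord -sum1_card.
by apply: leq_sum => i _; case: holds.
Qed.

Lemma holds_Odd s a : holds s (Odd a) = odd (ev s a).
Proof.
rewrite /holds /= -(@odd_iteri _ (fun acc => if acc == 0 then minn 1 L else 0)).
  by [].
by move=> x; case: (x == 0) => //; lia.
Qed.

Lemma eval_Half s a : ev s a <= L -> ev s (Half a) = (ev s a)./2.
Proof.
rewrite eval_Fold; elim: (ev s a) => // n IH nL.
have -> (f : nat -> nat -> nat) x : iteri n.+1 f x = f n (iteri n f x) by [].
rewrite IH; last exact: ltnW.
rewrite eval_Ite holds_Odd /= uphalf_half; case: (odd n) => //.
by rewrite -divn2; lia.
Qed.

End Operators.

(** * Binary arithmetic on the items of the input word *)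

Definition enc_items (its : seq (seq bool)) : seq letter :=
  flatten [seq rcons (map Bit b) Sep | b <- its].

Definition Seps p := Count p (Look InputTape Sep (Var 0)).
(** The positions before item [j] are exactly those preceded by fewer than [j] separators, so
    counting them locates the item. Beyond the last item the result is at or past the end of the
    word. *)
Definition Start j := Count Top (Lt (Seps (Var 0)) (lift 1 j)).
(** 0 is the empty word, whose item consists of the separator alone. *)
Definition NonZero j := Not (Look InputTape Sep (Start j)).
(** The comparison pads numbers with zero bits: past the last bit the answer is false. [Pred]
    excludes the separator. *)
Definition BitAt j i :=
  And (Lt (Add (Start j) i) (Pred (Start (Succ j)))) (Look InputTape (Bit true) (Add (Start j) i)).
(** Column [k] of the schoolbook product before carrying, i.e. a coefficient of the product of two
    polynomials. *)
Definition Col a b k :=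
  Count (Succ k) (And (BitAt (lift 1 a) (Var 0)) (BitAt (lift 1 b) (Sub (lift 1 k) (Var 0)))).
(** A quarter of [L], which is [2 * size w]: a round adds two columns of at most [size w] ones each,
    and this bound on the column sums also bounds the carry in absolute value. *)
Definition Offset := Half (Half Top).

(* Compares (a1 + a2) b with c d, for the numbers in the items with these
   indices, by adding up the columns of both products from the least
   significant one on; the accumulator is the carry, which can be negative,
   plus the offset. *)
Definition GeProd a1 a2 b c d :=
  Le Offset (Fold Top Offset (Half (Sub
    (Add (Add (Var 0) (Add (Col (lift 2 a1) (lift 2 b) (Var 1)) (Col (lift 2 a2) (lift 2 b) (Var 1))))
       Offset)
    (Col (lift 2 c) (lift 2 d) (Var 1))))).

Definition bits_val (b : seq bool) : nat := \sum_(i < size b) nth false b i * 2 ^ i.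

Lemma size_enc_items its : size (enc_items its) = \sum_(b <- its) (size b).+1.
Proof.
rewrite size_flatten /shape -map_comp sumnE big_map.
by apply: eq_bigr => b _ /=; rewrite size_rcons size_map.
Qed.

Lemma count_seps_lt its j p : j <= size its ->
  (count_mem Sep (take p (enc_items its)) < j) = (p < size (enc_items (take j its))).
Proof.
elim: its j p => [|b its IH] [|j] p //= jl.
rewrite /enc_items /= !size_cat size_rcons size_map cat_rcons.
have nb n : count_mem Sep (take n (map Bit b)) = 0.
  by apply/count_memPn; rewrite -map_take; apply/mapP => -[].
rewrite take_cat size_map; case: (ltnP p (size b)) => pb; first by rewrite nb; lia.
rewrite count_cat -[map Bit b]take_size nb add0n.
case: (p - size b) (subnKC pb) => [|p'] /= <-; first lia.
by rewrite add1n addnS addSn !ltnS ltn_add2l; apply: IH.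
Qed.

Lemma nth_enc_items its j i : j < size its -> i <= size (nth [::] its j) ->
  nth None (map Some (enc_items its)) (size (enc_items (take j its)) + i) =
  Some (if i < size (nth [::] its j) then Bit (nth false (nth [::] its j) i) else Sep).
Proof.
move=> jl il.
have E : enc_items its = enc_items (take j its) ++ map Bit (nth [::] its j) ++
    Sep :: enc_items (drop j.+1 its).
  rewrite -{1}(cat_take_drop j its) (drop_nth [::] jl) /enc_items map_cat flatten_cat /=.
  by rewrite cat_rcons.
have lt : size (enc_items (take j its)) + i < size (enc_items its).
  by rewrite E !size_cat size_map /=; lia.
rewrite (nth_map Sep) // E nth_cat ltnNge leq_addr /= addKn; congr Some.
rewrite nth_cat size_map; case: ltnP => lt'; first by rewrite (nth_map false).
by have -> : i - size (nth [::] its j) = 0 by lia.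
Qed.

Lemma sum_lt L t : \sum_(i < L) (i < t) = minn t L.
Proof. by elim: L => [|L IH]; rewrite ?big_ord0 ?minn0 // big_ord_recr /= IH; lia. Qed.

Definition conv (x y : seq bool) k :=
  \sum_(i < k.+1) nth false x i * nth false y (k - i).

Lemma conv_le x y k : conv x y k <= size x.
Proof.
rewrite /conv; apply: (@leq_trans (\sum_(i < k.+1) (i < size x))).
  apply: leq_sum => i _; case: (ltnP i (size x)) => ix; last by rewrite nth_default.
  by case: (nth false x i); case: (nth false y _).
by rewrite sum_lt geq_minl.
Qed.

(** Read the bits as coefficients of two polynomials and evaluate their product at 2; [K] exceeds
    its degree. *)
Lemma bits_conv x y K : size x + size y <= K ->
  \sum_(k < K) conv x y k * 2 ^ k = bits_val x * bits_val y.
Proof.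
move=> K_ge.
pose P (z : seq bool) : {poly nat} := (\poly_(i < size z) (nth false z i : nat))%R.
have PE z i : ((P z)`_i)%R = nth false z i.
  by rewrite coef_poly; case: ltnP => // zi; rewrite nth_default.
have sP z : size (P z) <= size z by apply: size_poly.
have valE z : ((P z).[2])%R = bits_val z.
  rewrite (horner_coef_wide _ (sP z)) /bits_val; apply: eq_bigr => i _.
  by rewrite PE.
rewrite -!valE; transitivity ((P x * P y).[2])%R; last by rewrite hornerM.
have sM : size (P x * P y)%R <= K.
  apply: leq_trans (size_polyMleq _ _) _; apply: leq_trans (leq_pred _) _.
  by apply: leq_trans K_ge; apply: leq_add.
rewrite (horner_coef_wide _ sM); apply: eq_bigr => k _.
by rewrite coefM /conv; congr (_ * _); apply: eq_bigr => i _; rewrite !PE.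
Qed.

(* [acc] is the floor of [M + (\sum_(k < K) (p k - q k) * 2 ^ k) / 2 ^ K]. *)
Lemma carry_iteri (p q : nat -> nat) M K : (forall k, k < K -> q k <= M) ->
  let acc := iteri K (fun k acc => (acc + p k + M - q k)./2) M in
  (M <= acc) = (\sum_(k < K) q k * 2 ^ k <= \sum_(k < K) p k * 2 ^ k).
Proof.
move=> qM acc.
(* [rho] collects the bits dropped by the halvings, which makes the floor an exact equation. *)
suff [rho [r_lt E]] : exists rho, rho < 2 ^ K /\
    acc * 2 ^ K + rho + \sum_(k < K) q k * 2 ^ k = M * 2 ^ K + \sum_(k < K) p k * 2 ^ k.
  apply/idP/idP => H; first by have := leq_mul H (leqnn (2 ^ K)); lia.
  rewrite -ltnS -(@ltn_pmul2r (2 ^ K)) ?expn_gt0 // mulSn; lia.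
rewrite /acc; elim: K qM {acc} => [|K IH] qM /=.
  by exists 0; rewrite !big_ord0 !addn0.
have [k kK|rho [r_lt E]] := IH; first by apply: qM; exact: ltnW.
set a := iteri K _ _ in E *.
have := odd_double_half (a + p K + M - q K).
set h := _./2; set b := odd _ => D.
(* This keeps the truncated subtraction exact. The [M] added in each round makes up for the halving
   of the offset. *)
have qK := qM K (ltnSn K).
exists (rho + b * 2 ^ K); split.
  rewrite expnS; move: r_lt; move: (2 ^ K) => t; case: (b) => /=; rewrite ?mul1n ?mul0n; lia.
rewrite !big_ord_recr /= expnS; move: D; rewrite -mul2n => D.
have D' : (b + 2 * h + q K) * 2 ^ K = (a + p K + M) * 2 ^ K by congr (_ * _); lia.
clear -D' E; clearbody a h b; move: D' E; rewrite !mulnDl.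
by move: (2 ^ K) (\sum_(k < K) q k * 2 ^ k) (\sum_(k < K) p k * 2 ^ k) (p K) (q K) (b : nat); nia.
Qed.

Section Parsing.
Variables (its : seq (seq bool)) (mem : memory).
Let w := enc_items its.
Let L := 8 * size w + 1.
Hypothesis mem_input : forall i, mem InputTape i = nth None (map Some w) i.
Notation ev := (eval L mem).
Notation holds := (holds L mem).
Implicit Types (s : nat -> nat) (a b c d : expr).

Let L_gt0 : 0 < L. Proof. by rewrite /L; lia. Qed.

Lemma items_le : size its <= size w.
Proof.
rewrite size_enc_items -sum1_size; elim: (its) => [|b t IH]; rewrite ?big_nil // !big_cons.
by apply: leq_add.
Qed.

Lemma item_size_le j : j < size its -> (size (nth [::] its j)).+1 <= size w.
Proof.
move=> jl; rewrite size_enc_items (big_nth [::]) big_mkord (bigD1 (Ordinal jl)) //=.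
exact: leq_addr.
Qed.

Lemma eval_Seps s p : ev s p <= L -> ev s (Seps p) = count_mem Sep (take (ev s p) w).
Proof.
move=> pL; rewrite (eval_Count L_gt0 _ erefl pL).
under eq_bigr => x _ do rewrite holds_Look mem_input /=.
elim: (ev s p) => [|n IH]; first by rewrite big_ord0 take0.
rewrite big_ord_recr /= IH; case: (ltnP n (size w)) => nw.
  by rewrite (take_nth Sep) // -cats1 count_cat /= addn0 (nth_map Sep).
rewrite nth_default ?size_map //= addn0.
by rewrite !take_oversize //; exact: leqW.
Qed.

Lemma eval_Start s j : ev s (Start j) =
  \sum_(p < L) (count_mem Sep (take p w) < ev s j).
Proof.
rewrite (@eval_Count L mem L_gt0 s Top _ L erefl (leqnn L)); apply: eq_bigr => p _.
by rewrite holds_Lt eval_Seps //=; apply: ltnW.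
Qed.

Lemma eval_Start_lt s j J : ev s j = J -> J <= size its ->
  ev s (Start j) = size (enc_items (take J its)).
Proof.
move=> <- jl; rewrite eval_Start.
under eq_bigr => p _ do rewrite count_seps_lt //.
rewrite sum_lt; apply/minn_idPl.
apply: (@leq_trans (size w)); last by rewrite /L; lia.
rewrite !size_enc_items -{2}(cat_take_drop (ev s j) its) big_cat.
exact: leq_addr.
Qed.

Lemma eval_Start_ge s j : size its <= ev s j -> size w <= ev s (Start j) <= L.
Proof.
move=> jl; rewrite eval_Start; apply/andP; split; last first.
  rewrite -[X in _ <= X]card_ord -sum1_card; apply: leq_sum => p _; exact: leq_b1.
apply: (@leq_trans (\sum_(p < L) (p < size w))); first by rewrite sum_lt /L; lia.
apply: leq_sum => p _; case: ltnP => // pw.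
rewrite (leq_trans _ jl) //.
by rewrite count_seps_lt ?take_size.
Qed.

Lemma holds_NonZero s j J : ev s j = J -> J < size its ->
  holds s (NonZero j) = (0 < size (nth [::] its J)).
Proof.
move=> jJ jl; rewrite holds_Not // holds_Look mem_input (eval_Start_lt jJ (ltnW jl)).
have := nth_enc_items jl (leq0n _); rewrite addn0 => ->.
by case: (nth [::] its J).
Qed.

Lemma holds_BitAt s j i J : ev s j = J -> J <= L ->
  holds s (BitAt j i) = nth false (nth [::] its J) (ev s i).
Proof.
move=> jJ JL; rewrite holds_And holds_Lt holds_Look mem_input.
have SL : ev s (Start j) <= L.
  rewrite eval_Start -[X in _ <= X]card_ord -sum1_card; apply: leq_sum => p _; exact: leq_b1.
rewrite eval_Add //; case: (ltnP J (size its)) => jl; last first.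
  have /andP[S1 _] : size w <= ev s (Start j) <= L by apply: eval_Start_ge; rewrite jJ.
  rewrite [nth None _ _]nth_default ?andbF ?(nth_default _ jl) ?nth_nil // size_map.
  by rewrite leq_min (leq_trans S1 (leq_addr _ _)) /L; lia.
have S1 := eval_Start_lt jJ (ltnW jl).
have wl := items_le.
have jJ1 : ev s (Succ j) = J.+1 by rewrite /= jJ; apply/minn_idPl; rewrite /L; lia.
have isz := item_size_le jl.
change (ev s (Pred (Start (Succ j)))) with (ev s (Start (Succ j))).-1.
rewrite (eval_Start_lt jJ1 jl).
have -> : (size (enc_items (take J.+1 its))).-1 = size (enc_items (take J its)) + size (nth [::] its J).
  by rewrite (take_nth [::]) // !size_enc_items -cats1 big_cat /= big_seq1 addnS.
have le : size (enc_items (take J its)) + size (nth [::] its J) < size w.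
  have := size_enc_items its.
  rewrite -[in RHS](cat_take_drop J its) (drop_nth [::] jl) big_cat big_cons /= -size_enc_items.
  by rewrite -/w; lia.
rewrite S1; case: (ltnP (ev s i) (size (nth [::] its J))) => il.
  have -> : minn (size (enc_items (take J its)) + ev s i) L = size (enc_items (take J its)) + ev s i.
    apply/minn_idPl; apply: (@leq_trans (size w)); last by rewrite /L; lia.
    by rewrite (leq_trans _ (ltnW le)) // leq_add2l ltnW.
  by rewrite ltn_add2l il (nth_enc_items jl (ltnW il)) il /=; case: (nth false _ _).
rewrite [RHS]nth_default // ltnNge.
have -> : size (enc_items (take J its)) + size (nth [::] its J) <=
    minn (size (enc_items (take J its)) + ev s i) L.
  rewrite leq_min leq_add2l il /=; apply: (@leq_trans (size w)); first exact: ltnW.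
  by rewrite /L; lia.
by [].
Qed.


Lemma holds_BitAt_shift s j a k J : ev s j = J -> J <= L ->
  holds s (BitAt j (Sub a k)) = nth false (nth [::] its J) (ev s a - ev s k).
Proof. by move=> jJ JL; rewrite (holds_BitAt _ jJ JL) eval_Sub. Qed.

Lemma item_size J : size (nth [::] its J) <= size w.
Proof.
case: (ltnP J (size its)) => jl; last by rewrite nth_default.
exact: ltnW (item_size_le jl).
Qed.

Lemma eval_Col s a b k A B : ev s a = A -> ev s b = B -> A <= L -> B <= L -> ev s k < L ->
  ev s (Col a b k) = conv (nth [::] its A) (nth [::] its B) (ev s k).
Proof.
move=> aA bB AL BL kL.
have kL' : ev s (Succ k) = (ev s k).+1 by apply/minn_idPl.
rewrite (eval_Count L_gt0 _ kL' kL); apply: eq_bigr => i _.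
have aA' : ev (scons i s) (lift 1 a) = A by [].
have bB' : ev (scons i s) (lift 1 b) = B by [].
rewrite holds_And (holds_BitAt _ aA' AL) (holds_BitAt_shift _ _ bB' BL).
by case: (nth false _ _) => //; rewrite mul1n.
Qed.

Lemma eval_Offset s : ev s Offset = 2 * size w.
Proof.
have top : ev s Top = L by [].
by rewrite !eval_Half ?top // /L; lia.
Qed.

Lemma holds_GeProd s a1 a2 b c d A1 A2 B C D :
  ev s a1 = A1 -> ev s a2 = A2 -> ev s b = B -> ev s c = C -> ev s d = D ->
  A1 <= L -> A2 <= L -> B <= L -> C <= L -> D <= L ->
  let val J := bits_val (nth [::] its J) in
  holds s (GeProd a1 a2 b c d) = (val C * val D <= (val A1 + val A2) * val B).
Proof.
move=> a1E a2E bE cE dE A1L A2L BL CL DL val.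
rewrite holds_Le // eval_Offset.
pose it J := nth [::] its J.
pose p k := conv (it A1) (it B) k + conv (it A2) (it B) k.
pose q k := conv (it C) (it D) k.
set M := 2 * size w.
have qM k : q k <= M.
  by apply: leq_trans (conv_le _ _ _) _; have := item_size C; rewrite /M /it; lia.
have pM k : p k <= M.
  have := conv_le (it A1) (it B) k; have := conv_le (it A2) (it B) k.
  by have := item_size A1; have := item_size A2; rewrite /M /p /it; lia.
rewrite [X in M <= X](_ : _ = iteri L (fun k acc => (acc + p k + M - q k)./2) M).
  rewrite carry_iteri //.
  have szL x y : size (it x) + size (it y) <= L.
    by have := item_size x; have := item_size y; rewrite /it /L; lia.
  rewrite bits_conv // -[X in _ = (_ <= X)]/((val A1 + val A2) * val B) mulnDl.
  rewrite -!(bits_conv (K := L)) // -big_split /=.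
  by congr (_ <= _); apply: eq_bigr => k _; rewrite mulnDl.
(* Hence a round handles at most [2 * M + M + M], which is below [L], and no addition saturates. *)
have aM K : iteri K (fun k acc => (acc + p k + M - q k)./2) M <= 2 * M.
  elim: K => [|K IH] /=; first by lia.
  by have := pM K; rewrite -divn2; lia.
rewrite eval_Fold eval_Offset -/M.
set body := Half _.
have iteriS n (f : nat -> nat -> nat) x : iteri n.+1 f x = f n (iteri n f x) by [].
suff H K : K <= L -> iteri K (fun j acc => ev (scons acc (scons j s)) body) M =
    iteri K (fun k acc => (acc + p k + M - q k)./2) M by exact: H.
elim: K => // K IH KL; rewrite !iteriS (IH (ltnW KL)).
have := aM K; set s0 := iteri K _ _ => s0M.
pose s' := scons s0 (scons K s).
have col1 : ev s' (Col (lift 2 a1) (lift 2 b) (Var 1)) = conv (it A1) (it B) K.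
  by rewrite (@eval_Col _ _ _ _ A1 B).
have col2 : ev s' (Col (lift 2 a2) (lift 2 b) (Var 1)) = conv (it A2) (it B) K.
  by rewrite (@eval_Col _ _ _ _ A2 B).
have col3 : ev s' (Col (lift 2 c) (lift 2 d) (Var 1)) = q K.
  by rewrite (@eval_Col _ _ _ _ C D).
have pK := pM K; have ML : M * 4 <= L by rewrite /M /L; lia.
have e1 : ev s' (Add (Col (lift 2 a1) (lift 2 b) (Var 1)) (Col (lift 2 a2) (lift 2 b) (Var 1))) = p K.
  have pL : p K <= L by lia.
  rewrite eval_Add col1 ?col2; last by apply: leq_trans pL; apply: leq_addr.
  exact/minn_idPl.
have e2 : ev s' (Add (Var 0) (Add (Col (lift 2 a1) (lift 2 b) (Var 1))
    (Col (lift 2 a2) (lift 2 b) (Var 1)))) = s0 + p K.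
  have s0L : s0 <= L by lia.
  by rewrite eval_Add // e1; apply/minn_idPl; change (s0 + p K <= L); lia.
have e3 : ev s' (Add (Add (Var 0) (Add (Col (lift 2 a1) (lift 2 b) (Var 1))
    (Col (lift 2 a2) (lift 2 b) (Var 1)))) Offset) = s0 + p K + M.
  by rewrite eval_Add e2 ?eval_Offset; [apply/minn_idPl|]; rewrite -?/M; lia.
have e4 : ev s' (Sub (Add (Add (Var 0) (Add (Col (lift 2 a1) (lift 2 b) (Var 1))
    (Col (lift 2 a2) (lift 2 b) (Var 1)))) Offset) (Col (lift 2 c) (lift 2 d) (Var 1))) =
    s0 + p K + M - q K by rewrite eval_Sub e3 col3.
have e5 : s0 + p K + M - q K <= L by lia.
rewrite -e4 in e5.
exact: etrans (eval_Half L_gt0 e5) (congr1 half e4).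
Qed.

End Parsing.

Import Order.TTheory GRing.Theory Num.Theory.

(** * Parsing instances *)

Lemma bits_val_nil : bits_val [::] = 0. Proof. exact: big_ord0. Qed.

Lemma bits_val_cons b s : bits_val (b :: s) = b + 2 * bits_val s.
Proof.
rewrite /bits_val big_ord_recl /= muln1; congr (_ + _).
by rewrite big_distrr; apply: eq_bigr => i _ /=; rewrite /bump add1n expnS mulnCA.
Qed.

Lemma bits_val_positive p : bits_val (positive_bits p) = nat_of_pos p.
Proof.
by elim: p => [p IH|p IH|] /=; rewrite bits_val_cons ?IH ?bits_val_nil ?mul2n ?NatTrec.doubleE.
Qed.

Lemma bits_val_nat n : bits_val (nat_bits n) = n.
Proof.
rewrite -[RHS]bin_of_natK /nat_bits; case: bin_of_nat => [|p] /=.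
  exact: bits_val_nil.
exact: bits_val_positive.
Qed.

Lemma size_nat_bits_gt0 n : (0 < size (nat_bits n)) = (0 < n).
Proof.
rewrite -[in RHS](bits_val_nat n) /nat_bits; case: bin_of_nat => [|p].
  by rewrite bits_val_nil.
have pos : 0 < nat_of_pos p by elim: p => //= p; rewrite NatTrec.doubleE double_gt0.
by rewrite bits_val_positive pos; case: p {pos}.
Qed.

Lemma enc_items_cat s t : enc_items (s ++ t) = enc_items s ++ enc_items t.
Proof. by rewrite /enc_items map_cat flatten_cat. Qed.

Lemma enc_items_flatten ss : enc_items (flatten ss) = flatten [seq enc_items s | s <- ss].
Proof. by elim: ss => //= s ss <-; rewrite enc_items_cat. Qed.

Lemma size_flatten_uniform (T : Type) n (ss : seq (seq T)) :
  all (fun s => size s == n) ss -> size (flatten ss) = size ss * n.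
Proof. by elim: ss => //= s ss IH /andP[/eqP sn /IH E]; rewrite size_cat sn E. Qed.

Lemma nth_flatten_uniform (T : Type) (d : T) n ss i j :
  all (fun s => size s == n) ss -> i < size ss -> j < n ->
  nth d (flatten ss) (i * n + j) = nth d (nth [::] ss i) j.
Proof.
elim: ss i => // s ss IH [|i] /= /andP[/eqP sn U] i_lt j_lt; rewrite nth_cat sn.
  by rewrite j_lt.
by rewrite mulSn -addnA ltnNge leq_addr /= addKn IH.
Qed.

Lemma nth_enum_pairs (T : Type) (d : T) m n (F : 'I_m -> 'I_n -> T) (t : 'I_m) (x : 'I_n) :
  nth d [seq F t x | t <- enum 'I_m, x <- enum 'I_n] (t * n + x) = F t x.
Proof.
rewrite (@nth_flatten_uniform T d n) ?size_map ?size_enum_ord //.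
  rewrite (nth_map t) ?size_enum_ord // (nth_map x) ?size_enum_ord //.
  by rewrite !nth_ord_enum.
  by rewrite all_map; apply/allP => y _ /=; rewrite size_map size_enum_ord.
by rewrite -enumT size_enum_ord.
Qed.

Lemma size_enum_pairs (T : Type) m n (F : 'I_m -> 'I_n -> T) :
  size [seq F t x | t <- enum 'I_m, x <- enum 'I_n] = m * n.
Proof. by rewrite size_allpairs !size_enum_ord. Qed.

Lemma enc_items_pairs m n (F : 'I_m -> 'I_n -> nat) :
  flatten [seq enc_nat (F t x) | t <- enum 'I_m, x <- enum 'I_n] =
  enc_items [seq nat_bits (F t x) | t <- enum 'I_m, x <- enum 'I_n].
Proof. by rewrite /enc_items map_allpairs. Qed.

Definition num (q : rat) : nat := `|numq q|%N.
Definition den (q : rat) : nat := `|denq q|%N.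
Definition rat_items (q : rat) := [:: nat_bits (num q); nat_bits (den q)].

Lemma enc_ratE q : enc_rat q = enc_items (rat_items q).
Proof. by rewrite /enc_items /= cats0. Qed.

Section Instance.
Variable I : instance.
Local Notation m := (nTAs I).
Local Notation n := (ncourses I).

Definition items : seq (seq bool) :=
  [:: nseq n true; nseq m true] ++
  [seq nat_bits (TA_util t x) | t <- enum 'I_m, x <- enum 'I_n] ++
  flatten [seq rat_items (grade t x) | t <- enum 'I_m, x <- enum 'I_n] ++
  [seq nat_bits (capacity x) | x <- enum 'I_n] ++
  [seq nat_bits (course_util x t) | x <- enum 'I_n, t <- enum 'I_m] ++
  rat_items (threshold I).

Lemma enc_instanceE : enc_instance I = enc_items items.
Proof.
have cards : enc_items [:: nseq n true; nseq m true] = enc_card n ++ enc_card m.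
  by rewrite /enc_items /= cats0 !map_nseq.
have grades : flatten [seq enc_rat (grade t x) | t <- enum 'I_m, x <- enum 'I_n] =
    enc_items (flatten [seq rat_items (grade t x) | t <- enum 'I_m, x <- enum 'I_n]).
  rewrite enc_items_flatten map_allpairs; congr flatten.
  by apply: eq_allpairs => t x; rewrite enc_ratE.
have caps : flatten [seq enc_nat (capacity x) | x <- enum 'I_n] =
    enc_items [seq nat_bits (capacity x) | x <- enum 'I_n].
  by rewrite /enc_items -map_comp.
rewrite /items /enc_instance !enc_items_cat -!enc_items_pairs cards grades caps.
by rewrite -enc_ratE -!catA.
Qed.

(** The blocks of [items] are laid out row by row; each index adds the lengths of the preceding
    blocks, where a grade counts as two items. *)
Definition util_index t x := 2 + (t * n + x).
Definition grade_index t x := 2 + m * n + (t * n + x) * 2.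
Definition capacity_index x := 2 + m * n + m * n * 2 + x.
Definition value_index x t := 2 + m * n + m * n * 2 + n + (x * m + t).
Definition threshold_index := 2 + m * n + m * n * 2 + n + n * m.

Lemma size_rat_pairs (g : 'I_m -> 'I_n -> rat) :
  size (flatten [seq rat_items (g t x) | t <- enum 'I_m, x <- enum 'I_n]) = m * n * 2.
Proof.
rewrite (@size_flatten_uniform _ 2) ?size_enum_pairs //.
by apply/allP => s /allpairsP[u [_ _ ->]].
Qed.

Lemma size_items : size items = threshold_index + 2.
Proof.
rewrite /items !size_cat !size_enum_pairs size_rat_pairs size_map size_enum_ord /=.
by rewrite /threshold_index !addnA.
Qed.

Lemma nth_cat_add (T : Type) (d : T) s1 s2 k i : size s1 = k ->
  nth d (s1 ++ s2) (k + i) = nth d s2 i.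
Proof. by move=> <-; rewrite nth_cat ltnNge leq_addr addKn. Qed.

Lemma items_util (t : 'I_m) (x : 'I_n) : nth [::] items (util_index t x) = nat_bits (TA_util t x).
Proof.
rewrite nth_cat_add // nth_cat size_enum_pairs nth_enum_pairs ifT //.
by have := ltn_ord t; have := ltn_ord x; nia.
Qed.

Lemma items_grade (t : 'I_m) (x : 'I_n) b : b < 2 ->
  nth [::] items (grade_index t x + b) = nth [::] (rat_items (grade t x)) b.
Proof.
move=> b2; have tm := ltn_ord t; have xn := ltn_ord x.
have tx : t * n + x < m * n by nia.
rewrite /grade_index -!addnA nth_cat_add //.
rewrite nth_cat_add ?size_enum_pairs // nth_cat size_rat_pairs ifT; last by nia.
rewrite (@nth_flatten_uniform _ _ 2) ?size_enum_pairs ?nth_enum_pairs //.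
by apply/allP => s /allpairsP[u [_ _ ->]].
Qed.

Lemma items_capacity (x : 'I_n) : nth [::] items (capacity_index x) = nat_bits (capacity x).
Proof.
rewrite /capacity_index -!addnA nth_cat_add // nth_cat_add ?size_enum_pairs //.
rewrite nth_cat_add ?size_rat_pairs // nth_cat size_map size_enum_ord ltn_ord.
by rewrite (nth_map x) ?size_enum_ord // nth_ord_enum.
Qed.

Lemma size_capacities : size [seq nat_bits (capacity x) | x <- enum 'I_n] = n.
Proof. by rewrite size_map size_enum_ord. Qed.

Lemma items_value (x : 'I_n) (t : 'I_m) : nth [::] items (value_index x t) = nat_bits (course_util x t).
Proof.
rewrite /value_index -!addnA nth_cat_add // nth_cat_add ?size_enum_pairs //.
rewrite nth_cat_add ?size_rat_pairs // nth_cat_add ?size_capacities //.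
rewrite nth_cat size_enum_pairs nth_enum_pairs ifT //.
by have := ltn_ord t; have := ltn_ord x; nia.
Qed.

Lemma items_threshold b :
  nth [::] items (threshold_index + b) = nth [::] (rat_items (threshold I)) b.
Proof.
rewrite /threshold_index -!addnA nth_cat_add // nth_cat_add ?size_enum_pairs //.
rewrite nth_cat_add ?size_rat_pairs // nth_cat_add ?size_capacities //.
by rewrite nth_cat_add ?size_enum_pairs.
Qed.

End Instance.


(** * The matching algorithm *)

Lemma rat_numden (q : rat) : (0 <= q)%R -> q = ((num q)%:R / (den q)%:R)%R.
Proof.
move=> q0; rewrite -[LHS]divq_num_den /num /den; congr (_ / _)%R.
  by rewrite pmulrn gez0_abs ?numq_ge0.
by rewrite pmulrn absz_denq.
Qed.

Lemma den_gt0 q : 0 < den q.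
Proof. by rewrite /den absz_gt0 denq_neq0. Qed.

Lemma rat_div_le (a b c d : nat) : 0 < b -> 0 < d ->
  ((a%:R / b%:R <= c%:R / d%:R :> rat)%R) = (a * d <= c * b).
Proof.
move=> b0 d0; rewrite ler_pdivrMr ?ltr0n // mulrAC ler_pdivlMr ?ltr0n //.
by rewrite -!natrM ler_nat.
Qed.

Section Instance.
Variable I : instance.
Local Notation TA := 'I_(nTAs I).
Local Notation course := 'I_(ncourses I).

Definition incident (t : TA) (x : course) : bool := TA_util t x != 0.
(** This and the next two tests have their denominators cleared, which brings them into the form
    decided by [GeProd]. *)
Definition avg_one (s : TA) (y : course) : bool :=
  num (threshold I) * capacity y <= course_util y s * den (threshold I).
Definition avg_two (s s' : TA) (y : course) : bool :=
  num (threshold I) * capacity y <= (course_util y s + course_util y s') * den (threshold I).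
Definition grade_le (s s' : TA) (x : course) : bool :=
  num (grade s' x) * den (grade s x) <= num (grade s x) * den (grade s' x).
Definition TA_le (s : TA) (x y : course) : bool := TA_util s x <= TA_util s y.

Definition mefe_ok := final_ok incident (@capacity I) avg_one avg_two grade_le TA_le.

Lemma grade_leE s s' x : grade_le s s' x = (grade s' x <= grade s x)%R.
Proof.
rewrite [in RHS](rat_numden (grade_ge0 s x)) [in RHS](rat_numden (grade_ge0 s' x)).
by rewrite rat_div_le ?den_gt0.
Qed.

Lemma avgE (c v : nat) : 0 < c ->
  (threshold I <= c%:R^-1 * v%:R)%R = (num (threshold I) * c <= v * den (threshold I)).
Proof.
move=> c0; rewrite {1}(rat_numden (threshold_ge0 I)) [(c%:R^-1 * _)%R]mulrC.
by rewrite rat_div_le ?den_gt0.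
Qed.

Lemma incidentE t x : incident t x = (0 < course_util x t).
Proof. by rewrite lt0n course_util_eq0. Qed.

Hypothesis degree_le2 : forall x : course, degree x <= 2.

Lemma incident_two (x : course) (r s t : TA) :
  incident r x -> incident s x -> incident t x -> r != s -> t != s -> t = r.
Proof.
move=> rx sx tx rs ts; apply/eqP/negPn/negP => tr.
have /subset_leq_card : [set r; s; t] \subset [set t' : TA | 0 < course_util x t'].
  by apply/subsetP => a; rewrite !inE -incidentE => /orP[/orP[]|] /eqP->.
have -> : #|[set r; s; t]| = 3.
  by rewrite setUC cardsU1 !inE cards2 rs negb_or tr ts.
by move=> /leq_trans/(_ (degree_le2 x)).
Qed.

Definition graph (mu : matching I) : {set TA * course} := [set p | mu p.1 == Some p.2].

Definition matching_of (R : {set TA * course}) : matching I :=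
  [ffun t => [pick x | (t, x) \in R]].

Lemma MEFE_graph (mu : matching I) : MEFE mu -> within incident (graph mu) /\ mefe_ok (graph mu).
Proof.
move=> [[card_mu util_mu] avg_mu no_envy_mu].
have W : within incident (graph mu).
  by move=> s y; rewrite inE /= => /eqP/util_mu/eqP.
split=> //; apply/andP; split; last first.
  apply/forallP => y; apply/existsP.
  have : 0 < #|assigned mu y| by rewrite card_mu capacity_gt0.
  rewrite card_gt0 => /set0Pn[s]; rewrite inE => sy; exists s; apply: W.
  by rewrite inE.
apply/forallP => s; apply/and3P; split.
- apply/forallP => y; apply/forallP => y'; rewrite !inE /=; apply/implyP.
  by move=> /andP[/eqP-> /eqP[->]].
- apply/forallP => x; apply/forallP => s'; apply/implyP; rewrite inE /=.
  case/and3P=> sx /eqP s'x; rewrite grade_leE => gr.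
  apply/existsP; case: (ltnP (util s (mu s)) (TA_util s x)) => lt.
    by case: no_envy_mu; exists s, s', x.
  move: lt; rewrite /util; case E: (mu s) => [y|] le.
    by exists y; rewrite inE /= E eqxx.
  (* An unassigned [s] with utility 0 cannot be content while [x] has positive utility for it. *)
  by move: sx; rewrite /incident -lt0n; move: le; rewrite leqn0 => /eqP->.
- apply/forallP => y; apply/implyP => _.
  (* Feasibility makes assigned TAs neighbours of [y], so the degree bounds the capacity, leaving
     just the cases of [course_ok]. *)
  have : #|assigned mu y| <= 2.
    apply: leq_trans (degree_le2 y); apply: subset_leq_card.
    by apply/subsetP => t; rewrite !inE -incidentE => /eqP/util_mu/eqP.
  have := avg_mu y; rewrite /avg_util -natr_sum avgE ?capacity_gt0 // => avg le2.
  have := capacity_gt0 y; have cy := card_mu y.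
  have inS t : ((t, y) \in graph mu) = (t \in assigned mu y) by rewrite !inE.
  case c: (capacity y) cy => [|[|[|k]]] // cy _; last by rewrite cy in le2.
    apply/orP; left; rewrite c eqxx /=.
    have /cards1P[s' As] : #|assigned mu y| == 1 by rewrite cy.
    apply/existsP; exists s'; rewrite inS As inE eqxx /= /avg_one.
    rewrite As big_set1 in avg; rewrite avg andbT.
    by apply/forallP => t; rewrite inS As inE implybb.
  apply/orP; right; rewrite c eqxx /=.
  have /cards2P[a [b [ab As]]] : #|assigned mu y| == 2 by rewrite cy.
  apply/existsP; exists a; apply/existsP; exists b.
  rewrite ab !inS As !inE !eqxx orbT /= /avg_two.
  by rewrite As big_setU1 ?inE // big_set1 in avg.
Qed.

Lemma matching_of_graph R : (forall s, single R s) ->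
  forall t x, (matching_of R t == Some x) = ((t, x) \in R).
Proof.
move=> sg t x; rewrite ffunE; case: pickP => [y ty|no]; last by rewrite no.
apply/eqP/idP => [[<-]//|tx]; congr Some.
have /forallP/(_ x)/forallP/(_ y)/implyP := sg t.
by rewrite tx ty => /(_ isT)/eqP.
Qed.

Lemma graph_MEFE R : within incident R -> mefe_ok R -> MEFE (matching_of R).
Proof.
move=> W /andP[/forallP okR /forallP all_inc].
have sg s : single R s by have /and3P[] := okR s.
have mE := matching_of_graph sg.
have aE y : assigned (matching_of R) y = [set s | (s, y) \in R].
  by apply/setP => s; rewrite !inE mE.
have card_avg y : #|assigned (matching_of R) y| = capacity y /\
    (threshold I <= avg_util (matching_of R) y)%R.
  have /existsP[s0 s0y] := all_inc y.
  have /and3P[_ _ /forallP/(_ y)/implyP/(_ s0y)] := okR s0.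
  rewrite /avg_util -natr_sum avgE ?capacity_gt0 //.
  case/orP=> /andP[/eqP c].
    case/existsP=> a /and3P[ay /forallP U avg].
    have A : assigned (matching_of R) y = [set a].
      apply/setP => s; rewrite aE !inE; apply/idP/eqP => [sy|->//].
      exact/eqP/(implyP (U s)).
    by rewrite A cards1 big_set1 c; split=> //; move: avg; rewrite /avg_one c.
  case/existsP=> a /existsP[b /and4P[ab ay by_ avg]].
  (* A third TA on [y] would exceed the degree bound. *)
  have A : assigned (matching_of R) y = [set a; b].
    apply/setP => s; rewrite aE !inE; apply/idP/orP => [sy|[] /eqP->//].
    have [->|sa] := eqVneq s a; [by left|right].
    by rewrite (incident_two (W _ _ by_) (W _ _ ay) (W _ _ sy) _ sa) // eq_sym.
  rewrite A cards2 ab big_setU1 ?inE // big_set1 c; split=> //.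
  by move: avg; rewrite /avg_two c.
split.
- split=> [y|t x /eqP]; first by case: (card_avg y).
  by rewrite mE => /W/eqP.
- by move=> y; case: (card_avg y).
- case=> i [j [x [/eqP jx gr lt]]]; rewrite mE in jx.
  have ix : incident i x by rewrite /incident -lt0n; apply: leq_trans lt.
  have /and3P[_ /forallP/(_ x)/forallP/(_ j)/implyP H _] := okR i.
  have /existsP[y /andP[iy le]] : [exists y, ((i, y) \in R) && TA_le i x y].
    by apply: H; rewrite ix jx grade_leE.
  by move: iy lt; rewrite -mE => /eqP->; rewrite ltnNge /= -/(TA_le i x y) le.
Qed.

End Instance.

(** * The conditions of the algorithm as expressions *)

Definition Two := Succ One.
(** The cardinalities are unary items, so their values are lengths. *)
Definition CourseNum := Pred (Start One).
Definition TANum := Sub (Pred (Start Two)) (Start One).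
Definition Edge t x := Add (Mul t CourseNum) x.
Definition Pairs := Mul TANum CourseNum.
Definition GradeBase := Add Two Pairs.
Definition CapacityBase := Add GradeBase (Mul Pairs Two).
Definition ValueBase := Add CapacityBase CourseNum.
Definition UtilItem t x := Add Two (Edge t x).
(** A rational occupies two items, numerator first, so [Succ] of its index points to the
    denominator. *)
Definition GradeItem t x := Add GradeBase (Mul (Edge t x) Two).
Definition CapacityItem x := Add CapacityBase x.
Definition ValueItem x t := Add ValueBase (Add (Mul x TANum) t).
Definition ThresholdItem := Add ValueBase (Mul CourseNum TANum).

Definition Row r t x := Look r (Bit true) (Edge t x).
Definition Inc t x := NonZero (UtilItem t x).
Definition Len j := Sub (Pred (Start (Succ j))) (Start j).
(** A capacity may exceed [L], so it is recognized by its expansion. Without leading zeros, 1 is the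
    only number of length one, and the lowest bit separates 2 from 3. *)
Definition Cap1 x := Eq (Len (CapacityItem x)) One.
Definition Cap2 x :=
  And (Eq (Len (CapacityItem x)) Two) (Not (BitAt (CapacityItem x) Zero)).
(* [Top] is the index of no item, so it stands for the number 0. *)
Definition Avg1 t x :=
  GeProd (ValueItem x t) Top (Succ ThresholdItem) ThresholdItem (CapacityItem x).
Definition Avg2 t t' x :=
  GeProd (ValueItem x t) (ValueItem x t') (Succ ThresholdItem) ThresholdItem (CapacityItem x).
Definition Beats t t' x :=
  GeProd (GradeItem t x) Top (Succ (GradeItem t' x)) (GradeItem t' x) (Succ (GradeItem t x)).
(** [GeProd] compares products, so both utilities are multiplied by the same positive number, the
    denominator of the threshold. *)
Definition UtilLe t x y :=
  GeProd (UtilItem t y) Top (Succ ThresholdItem) (UtilItem t x) (Succ ThresholdItem).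

Definition CourseOk r y :=
  Or (And (Cap1 y) (Ex TANum (And (Row r (Var 0) (lift 1 y))
       (And (All TANum (Or (Not (Row r (Var 0) (lift 2 y))) (Eq (Var 0) (Var 1))))
            (Avg1 (Var 0) (lift 1 y))))))
     (And (Cap2 y) (Ex TANum (Ex TANum (And (Not (Eq (Var 1) (Var 0)))
       (And (Row r (Var 1) (lift 2 y)) (And (Row r (Var 0) (lift 2 y))
            (Avg2 (Var 1) (Var 0) (lift 2 y)))))))).

Definition Single r t :=
  All CourseNum (All CourseNum (Or (Not (And (Row r (lift 2 t) (Var 1)) (Row r (lift 2 t) (Var 0))))
    (Eq (Var 1) (Var 0)))).

Definition NoEnvy r t :=
  All CourseNum (All TANum (Or (Not (And (Inc (lift 2 t) (Var 1)) (And (Row r (Var 0) (Var 1))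
      (Beats (lift 2 t) (Var 0) (Var 1)))))
    (Ex CourseNum (And (Row r (lift 3 t) (Var 0)) (UtilLe (lift 3 t) (Var 2) (Var 0)))))).

Definition Ok r t :=
  And (Single r t) (And (NoEnvy r t)
    (All CourseNum (Or (Not (Inc (lift 1 t) (Var 0))) (CourseOk r (Var 0))))).

Definition Touched r t := Or (Eq t r) (Ex CourseNum (Row EdgeTape (lift 1 t) (Var 0))).

Definition Good r :=
  All TANum (Or (Not (Touched (lift 1 r) (Var 0))) (And (Ok EdgeTape (Var 0))
    (All CourseNum (Or (Not (Inc (Var 1) (Var 0)))
      (All TANum (Or (Not (Inc (Var 0) (Var 1))) (Touched (lift 3 r) (Var 0)))))))).

Definition Forced r o t x :=
  And (Inc t x) (Or (Row EdgeTape t x) (Or (And (Eq t r) (Eq x o))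
    (Ex TANum (And (Not (Eq (Var 0) (lift 1 t))) (And (Inc (Var 0) (lift 1 x))
      (Or (Ex CourseNum (And (Row EdgeTape (Var 1) (Var 0)) (Not (Eq (Var 0) (lift 2 x)))))
        (Or (And (Eq (Var 0) (lift 1 r)) (Not (Eq (lift 1 x) (lift 1 o))))
            (And (Row EdgeTape (Var 0) (lift 1 x)) (Cap2 (lift 1 x)))))))))).

Definition FinalOk :=
  And (All TANum (Ok ResultTape (Var 0)))
      (All CourseNum (Ex TANum (Inc (Var 0) (Var 1)))).

Lemma nat_bits_eq1 k : 0 < k -> (size (nat_bits k) == 1) = (k == 1).
Proof.
move=> k0; rewrite -[in RHS](bits_val_nat k); have := size_nat_bits_gt0 k.
rewrite k0 /nat_bits; case: bin_of_nat => [|p] //= _.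
have pos q : 0 < nat_of_pos q by elim: q => //= q; rewrite NatTrec.doubleE double_gt0.
have sz q : 0 < size (positive_bits q) by case: q.
by case: p => [q|q|] //=; rewrite bits_val_cons ?bits_val_positive ?bits_val_nil //;
  have := pos q; have := sz q; lia.
Qed.

Lemma nat_bits_eq2 k : 0 < k ->
  (size (nat_bits k) == 2) && ~~ nth false (nat_bits k) 0 = (k == 2).
Proof.
move=> k0; rewrite -[in RHS](bits_val_nat k); have := size_nat_bits_gt0 k.
rewrite k0 /nat_bits; case: bin_of_nat => [|p] //= _.
have pos q : 0 < nat_of_pos q by elim: q => //= q; rewrite NatTrec.doubleE double_gt0.
have sz q : 0 < size (positive_bits q) by case: q.
case: p => [q|q|] //=; rewrite bits_val_cons ?andbF ?andbT.
  by rewrite bits_val_positive; have := pos q; lia.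
  by case: q => [q|q|] //=; rewrite bits_val_cons ?bits_val_positive ?bits_val_nil //;
  have := pos q; have := sz q; lia.
by rewrite bits_val_nil.
Qed.

Section Specification.
Variables (I : instance) (mem : memory).
Let w := enc_instance I.
Let L := 8 * size w + 1.
Hypothesis mem_input : forall i, mem InputTape i = nth None (map Some w) i.
Local Notation m := (nTAs I).
Local Notation n := (ncourses I).
Notation ev := (eval L mem).
Notation holds := (holds L mem).
Implicit Types (s : nat -> nat).

Let L_gt0 : 0 < L. Proof. by rewrite /L; lia. Qed.

Let wE : w = enc_items (items I). Proof. exact: enc_instanceE. Qed.

Let mem_items i : mem InputTape i = nth None (map Some (enc_items (items I))) i.
Proof. by rewrite mem_input wE. Qed.

Let LE : 8 * size (enc_items (items I)) + 1 = L. Proof. by rewrite /L wE. Qed.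

Lemma index_le : threshold_index I + 2 <= size w.
Proof. by rewrite -size_items wE items_le. Qed.

(** Every item contains a separator, so item indices are bounded by the length of the word; the
    unary items bound [m] even if there are no courses. *)
Lemma bounds : [/\ n < L, m < L, m * n < L, 2 + m * n + m * n * 2 + n + n * m + 2 < L
  & 2 + n + m <= size w].
Proof.
have := index_le; rewrite /threshold_index => le.
have : n + m + 2 <= size w.
  rewrite wE /items enc_items_cat size_cat {1}/enc_items /= cats0.
  rewrite size_cat !size_rcons !size_map !size_nseq.
  by lia.
have : n * m = m * n by rewrite mulnC.
by rewrite /L; split; lia.
Qed.

Lemma eval_Two s : ev s Two = 2.
Proof.
have [_ _ _ le _] := bounds; apply: etrans (_ : minn (ev s One).+1 L = 2); first by [].
by rewrite eval_One //; apply/minn_idPl; lia.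
Qed.

Lemma eval_CourseNum s : ev s CourseNum = n.
Proof.
change ((ev s (Start One)).-1 = n).
have := @eval_Start_lt (items I) mem mem_items s One 1.
rewrite LE eval_One // => -> //.
by rewrite /items /= /enc_items /= cats0 size_rcons size_map size_nseq.
Qed.

Lemma eval_TANum s : ev s TANum = m.
Proof.
rewrite eval_Sub; change ((ev s (Start Two)).-1 - ev s (Start One) = m).
have := @eval_Start_lt (items I) mem mem_items s One 1.
rewrite LE eval_One // => -> //.
have := @eval_Start_lt (items I) mem mem_items s Two 2.
rewrite LE eval_Two // => -> //.
rewrite /items /= take0 /enc_items /= !cats0 size_cat !size_rcons !size_map !size_nseq; lia.
Qed.

Section Indices.
Variables (s : nat -> nat) (a b c : expr) (t t' : 'I_m) (x y : 'I_n).

Lemma edge_lt (t0 : 'I_m) (x0 : 'I_n) : t0 * n + x0 < m * n.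
Proof. by have := ltn_ord t0; have := ltn_ord x0; nia. Qed.

Lemma edge_lt_transposed (t0 : 'I_m) (x0 : 'I_n) : x0 * m + t0 < n * m.
Proof. by have := ltn_ord t0; have := ltn_ord x0; nia. Qed.

Lemma eval_Edge : ev s a = t -> ev s b = x -> ev s (Edge a b) = t * n + x.
Proof.
move=> sa sb; have := edge_lt t x; have [_ _ le _ _] := bounds => lt.
have tn : ev s (Mul a CourseNum) = t * n.
  by rewrite eval_Mul sa eval_CourseNum //; lia.
by rewrite eval_Add tn ?sb; [apply/minn_idPl|]; lia.
Qed.

Lemma eval_Pairs : ev s Pairs = m * n.
Proof.
by have [_ _ le _ _] := bounds; rewrite eval_Mul eval_TANum eval_CourseNum //; apply: ltnW.
Qed.

Lemma eval_GradeBase : ev s GradeBase = 2 + m * n.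
Proof.
have [_ _ _ le _] := bounds.
by rewrite eval_Add eval_Two ?eval_Pairs; [apply/minn_idPl|]; lia.
Qed.

Lemma eval_CapacityBase : ev s CapacityBase = 2 + m * n + m * n * 2.
Proof.
have [_ _ _ le _] := bounds.
have e : ev s (Mul Pairs Two) = m * n * 2 by rewrite eval_Mul eval_Pairs eval_Two //; lia.
by rewrite eval_Add eval_GradeBase ?e; [apply/minn_idPl|]; lia.
Qed.

Lemma eval_ValueBase : ev s ValueBase = 2 + m * n + m * n * 2 + n.
Proof.
have [_ _ _ le _] := bounds.
by rewrite eval_Add eval_CapacityBase ?eval_CourseNum; [apply/minn_idPl|]; lia.
Qed.

Lemma eval_ThresholdItem : ev s ThresholdItem = threshold_index I.
Proof.
have [_ _ _ le _] := bounds.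
have e : ev s (Mul CourseNum TANum) = n * m.
  by rewrite eval_Mul eval_TANum eval_CourseNum //; lia.
by rewrite eval_Add eval_ValueBase ?e; [apply/minn_idPl|]; rewrite /threshold_index; lia.
Qed.

Lemma eval_UtilItem : ev s a = t -> ev s b = x -> ev s (UtilItem a b) = util_index I t x.
Proof.
move=> sa sb; have := edge_lt t x; have [_ _ _ le _] := bounds => lt.
by rewrite eval_Add eval_Two ?(eval_Edge sa sb); [apply/minn_idPl|]; rewrite ?/util_index; lia.
Qed.

Lemma eval_GradeItem : ev s a = t -> ev s b = x -> ev s (GradeItem a b) = grade_index I t x.
Proof.
move=> sa sb; have := edge_lt t x; have [_ _ _ le _] := bounds => lt.
have e : ev s (Mul (Edge a b) Two) = (t * n + x) * 2.
  by rewrite eval_Mul (eval_Edge sa sb) eval_Two //; lia.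
by rewrite eval_Add eval_GradeBase ?e; [apply/minn_idPl|]; rewrite ?/grade_index; lia.
Qed.

Lemma eval_CapacityItem : ev s b = x -> ev s (CapacityItem b) = capacity_index I x.
Proof.
move=> sb; have := ltn_ord x; have [_ _ _ le _] := bounds => lt.
by rewrite eval_Add eval_CapacityBase ?sb; [apply/minn_idPl|]; rewrite ?/capacity_index; lia.
Qed.

Lemma eval_ValueItem : ev s a = t -> ev s b = x -> ev s (ValueItem b a) = value_index I x t.
Proof.
move=> sa sb; have := edge_lt_transposed t x; have [_ _ _ le _] := bounds => lt.
have e : ev s (Mul b TANum) = x * m by rewrite eval_Mul sb eval_TANum //; lia.
have e' : ev s (Add (Mul b TANum) a) = x * m + t.
  by rewrite eval_Add e ?sa; [apply/minn_idPl|]; lia.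
by rewrite eval_Add eval_ValueBase ?e'; [apply/minn_idPl|]; rewrite ?/value_index; lia.
Qed.

Lemma eval_succ e k : ev s e = k -> k < L -> ev s (Succ e) = k + 1.
Proof. by move=> <- kL; rewrite addn1; apply/minn_idPl. Qed.

End Indices.

Section Predicates.
Variables (s : nat -> nat) (a b c : expr) (t t' : 'I_m) (x y : 'I_n).

Lemma items_top : nth [::] (items I) L = [::].
Proof.
rewrite nth_default // size_items; apply: leq_trans index_le _; rewrite /L; lia.
Qed.

Lemma index_bounds (t0 : 'I_m) (x0 : 'I_n) :
  [/\ util_index I t0 x0 < size (items I), grade_index I t0 x0 + 1 < L,
      capacity_index I x0 < size (items I), value_index I x0 t0 < L
    & threshold_index I + 1 < L].
Proof.
have := index_le; have := edge_lt t0 x0; have := edge_lt_transposed t0 x0; have := ltn_ord x0.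
rewrite size_items /L /threshold_index /util_index /grade_index /capacity_index /value_index.
by split; lia.
Qed.

Lemma threshold_lt : threshold_index I + 1 < L.
Proof. by have := index_le; rewrite /L; lia. Qed.

Lemma holds_geprod s0 a1 a2 b1 c1 d1 A1 A2 B C D :
  ev s0 a1 = A1 -> ev s0 a2 = A2 -> ev s0 b1 = B -> ev s0 c1 = C -> ev s0 d1 = D ->
  A1 <= L -> A2 <= L -> B <= L -> C <= L -> D <= L ->
  let val J := bits_val (nth [::] (items I) J) in
  holds s0 (GeProd a1 a2 b1 c1 d1) = (val C * val D <= (val A1 + val A2) * val B).
Proof.
have := @holds_GeProd (items I) mem mem_items s0 a1 a2 b1 c1 d1 A1 A2 B C D.
by rewrite LE.
Qed.

Lemma holds_nonzero s0 j J : ev s0 j = J -> J < size (items I) ->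
  holds s0 (NonZero j) = (0 < size (nth [::] (items I) J)).
Proof. by have := @holds_NonZero (items I) mem mem_items s0 j J; rewrite LE. Qed.

Lemma holds_bit s0 j i J : ev s0 j = J -> J <= L ->
  holds s0 (BitAt j i) = nth false (nth [::] (items I) J) (ev s0 i).
Proof. by have := @holds_BitAt (items I) mem mem_items s0 j i J; rewrite LE. Qed.

Lemma holds_Row r : ev s a = t -> ev s b = x ->
  holds s (Row r a b) = (mem r (t * n + x) == Some (Bit true)).
Proof. by move=> sa sb; rewrite holds_Look (eval_Edge sa sb). Qed.

Lemma holds_Inc : ev s a = t -> ev s b = x -> holds s (Inc a b) = incident t x.
Proof.
move=> sa sb; have [lt _ _ _ _] := index_bounds t x.
by rewrite (holds_nonzero (eval_UtilItem sa sb) lt) items_util size_nat_bits_gt0 lt0n.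
Qed.

Lemma eval_Len j J : ev s j = J -> J < size (items I) ->
  ev s (Len j) = size (nth [::] (items I) J).
Proof.
move=> jJ lt; rewrite eval_Sub.
have JL : J < L by have := index_le; rewrite /L; move: lt; rewrite size_items; lia.
change ((ev s (Start (Succ j))).-1 - ev s (Start j) = size (nth [::] (items I) J)).
have := @eval_Start_lt (items I) mem mem_items s j J.
rewrite LE => ->  //; last exact: ltnW.
have := @eval_Start_lt (items I) mem mem_items s (Succ j) J.+1.
rewrite LE => -> //; last by rewrite (eval_succ jJ JL) addn1.
rewrite (take_nth [::]) // -cats1 enc_items_cat size_cat {2}/enc_items /= cats0.
by rewrite size_rcons size_map addnS /= addKn.
Qed.

Lemma holds_Cap1 : ev s b = x -> holds s (Cap1 b) = (capacity x == 1).
Proof.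
move=> sb; have le := index_le.
have lt : capacity_index I x < size (items I).
  by have := ltn_ord x; rewrite size_items /capacity_index /threshold_index; lia.
rewrite holds_Eq // (eval_Len (eval_CapacityItem sb) lt) eval_One // items_capacity.
exact: nat_bits_eq1 (capacity_gt0 x).
Qed.

Lemma holds_Cap2 : ev s b = x -> holds s (Cap2 b) = (capacity x == 2).
Proof.
move=> sb; have le := index_le.
have lt : capacity_index I x < size (items I).
  by have := ltn_ord x; rewrite size_items /capacity_index /threshold_index; lia.
have lt' : capacity_index I x <= L by move: lt; rewrite size_items /L; lia.
rewrite holds_And holds_Eq // (eval_Len (eval_CapacityItem sb) lt) eval_Two holds_Not //.
rewrite (holds_bit Zero (eval_CapacityItem sb) lt') items_capacity.
exact: nat_bits_eq2 (capacity_gt0 x).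
Qed.

Lemma eval_ThresholdDen : ev s (Succ ThresholdItem) = threshold_index I + 1.
Proof. by rewrite (eval_succ (eval_ThresholdItem s)) //; have := threshold_lt; lia. Qed.

Lemma items_num : nth [::] (items I) (threshold_index I) = nat_bits (num (threshold I)).
Proof. by rewrite -[threshold_index I]addn0 items_threshold. Qed.

Lemma holds_Avg1 : ev s a = t -> ev s b = x -> holds s (Avg1 a b) = avg_one t x.
Proof.
move=> sa sb; have [lt1 lt2 lt3 lt4 lt5] := index_bounds t x.
have lt6 : size (items I) <= L by have := index_le; rewrite size_items /L; lia.
rewrite (holds_geprod (eval_ValueItem sa sb) (erefl : ev s Top = L) eval_ThresholdDen
  (eval_ThresholdItem s) (eval_CapacityItem sb)); try lia.
by rewrite items_value items_top items_threshold items_num items_capacity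
  !bits_val_nat bits_val_nil addn0.
Qed.

Lemma holds_Avg2 : ev s a = t -> ev s c = t' -> ev s b = x ->
  holds s (Avg2 a c b) = avg_two t t' x.
Proof.
move=> sa sc sb; have [lt1 lt2 lt3 lt4 lt5] := index_bounds t x.
have [_ _ _ lt4' _] := index_bounds t' x.
have lt6 : size (items I) <= L by have := index_le; rewrite size_items /L; lia.
rewrite (holds_geprod (eval_ValueItem sa sb) (eval_ValueItem sc sb) eval_ThresholdDen
  (eval_ThresholdItem s) (eval_CapacityItem sb)); try lia.
by rewrite !items_value items_threshold items_num items_capacity !bits_val_nat.
Qed.

Lemma holds_Beats : ev s a = t -> ev s c = t' -> ev s b = x ->
  holds s (Beats a c b) = grade_le t t' x.
Proof.
move=> sa sc sb; have [lt1 lt2 lt3 lt4 lt5] := index_bounds t x.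
have [_ lt2' _ _ _] := index_bounds t' x.
have e1 := eval_GradeItem sa sb; have e2 := eval_GradeItem sc sb.
rewrite (holds_geprod e1 (erefl : ev s Top = L) (eval_succ e2 _) e2 (eval_succ e1 _)); try lia.
have i0 (t0 : 'I_m) : nth [::] (items I) (grade_index I t0 x) = nat_bits (num (grade t0 x)).
  by rewrite -[grade_index I t0 x]addn0 items_grade.
by rewrite !items_grade // !i0 items_top !bits_val_nat bits_val_nil addn0.
Qed.

Lemma holds_UtilLe : ev s a = t -> ev s b = x -> ev s c = y ->
  holds s (UtilLe a b c) = TA_le t x y.
Proof.
move=> sa sb sc; have [lt1 lt2 lt3 lt4 lt5] := index_bounds t x.
have [lt1' _ _ _ _] := index_bounds t y.
have lt6 : size (items I) <= L by have := index_le; rewrite size_items /L; lia.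
rewrite (holds_geprod (eval_UtilItem sa sc) (erefl : ev s Top = L) eval_ThresholdDen
  (eval_UtilItem sa sb) eval_ThresholdDen); try lia.
rewrite !items_util items_threshold items_top !bits_val_nat bits_val_nil addn0.
by rewrite leq_pmul2r ?den_gt0.
Qed.

End Predicates.

Definition edges_on (mem : memory) r : {set 'I_m * 'I_n} :=
  [set p : 'I_m * 'I_n | mem r (nat_of_ord p.1 * n + nat_of_ord p.2) == Some (Bit true)].

Lemma holds_Row_edges s r a b (t : 'I_m) (x : 'I_n) : ev s a = t -> ev s b = x ->
  holds s (Row r a b) = ((t, x) \in edges_on mem r).
Proof. by move=> sa sb; rewrite (holds_Row r sa sb) inE. Qed.

Lemma holds_eq_ord k s a b (i j : 'I_k) : ev s a = i -> ev s b = j ->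
  holds s (Eq a b) = (i == j).
Proof. by move=> sa sb; rewrite holds_Eq // sa sb. Qed.

(** One rule per connective: the expressions mirror the boolean predicates, so each specification
    below follows the common shape. *)
Lemma holds_And_eq s a b P Q : holds s a = P -> holds s b = Q -> holds s (And a b) = P && Q.
Proof. by move=> <- <-; rewrite holds_And. Qed.

Lemma holds_Or_eq s a b P Q : holds s a = P -> holds s b = Q -> holds s (Or a b) = P || Q.
Proof. by move=> <- <-; rewrite holds_Or. Qed.

Lemma holds_Not_eq s a P : holds s a = P -> holds s (Not a) = ~~ P.
Proof. by move=> <-; rewrite holds_Not. Qed.

Lemma holds_Imp_eq s a b P Q : holds s a = P -> holds s b = Q -> holds s (Or (Not a) b) = (P ==> Q).
Proof. by move=> aP bQ; rewrite implybE; apply: holds_Or_eq bQ; apply: holds_Not_eq. Qed.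

Lemma holds_ExCourse_eq s a (P : pred 'I_n) : (forall x : 'I_n, holds (scons x s) a = P x) ->
  holds s (Ex CourseNum a) = [exists x, P x].
Proof. by move=> E; rewrite (holds_Ex _ (eval_CourseNum s)); apply: eq_existsb. Qed.

Lemma holds_ExTA_eq s a (P : pred 'I_m) : (forall t : 'I_m, holds (scons t s) a = P t) ->
  holds s (Ex TANum a) = [exists t, P t].
Proof. by move=> E; rewrite (holds_Ex _ (eval_TANum s)); apply: eq_existsb. Qed.

Lemma holds_AllCourse_eq s a (P : pred 'I_n) : (forall x : 'I_n, holds (scons x s) a = P x) ->
  holds s (All CourseNum a) = [forall x, P x].
Proof. by move=> E; rewrite (holds_All L_gt0 _ (eval_CourseNum s)); apply: eq_forallb. Qed.

Lemma holds_AllTA_eq s a (P : pred 'I_m) : (forall t : 'I_m, holds (scons t s) a = P t) ->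
  holds s (All TANum a) = [forall t, P t].
Proof. by move=> E; rewrite (holds_All L_gt0 _ (eval_TANum s)); apply: eq_forallb. Qed.

Lemma holds_CourseOk s r b (y : 'I_n) : ev s b = y ->
  holds s (CourseOk r b) = course_ok (@capacity I) (@avg_one I) (@avg_two I) (edges_on mem r) y.
Proof.
move=> sb; apply: holds_Or_eq; apply: holds_And_eq.
- exact: holds_Cap1.
- apply: holds_ExTA_eq => t; apply: holds_And_eq; first exact: holds_Row_edges.
  apply: holds_And_eq; last exact: holds_Avg1.
  apply: holds_AllTA_eq => t'; apply: holds_Imp_eq; first exact: holds_Row_edges.
  exact: holds_eq_ord.
- exact: holds_Cap2.
- apply: holds_ExTA_eq => t; apply: holds_ExTA_eq => t'; apply: holds_And_eq.
    by apply: holds_Not_eq; apply: holds_eq_ord.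
  apply: holds_And_eq; first exact: holds_Row_edges.
  apply: holds_And_eq; first exact: holds_Row_edges.
  exact: holds_Avg2.
Qed.

Local Notation ok_set := (ok (@incident I) (@capacity I) (@avg_one I) (@avg_two I)
  (@grade_le I) (@TA_le I)).

Lemma holds_Ok s r a (t : 'I_m) : ev s a = t ->
  holds s (Ok r a) = ok_set (edges_on mem r) t.
Proof.
move=> sa; apply: holds_And_eq; last apply: holds_And_eq.
- apply: holds_AllCourse_eq => y; apply: holds_AllCourse_eq => y'.
  apply: holds_Imp_eq; last exact: holds_eq_ord.
  by apply: holds_And_eq; apply: holds_Row_edges.
- apply: holds_AllCourse_eq => x; apply: holds_AllTA_eq => t'; apply: holds_Imp_eq.
    apply: holds_And_eq; first exact: holds_Inc.
    apply: holds_And_eq; first exact: holds_Row_edges.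
    exact: holds_Beats.
  apply: holds_ExCourse_eq => y; apply: holds_And_eq; first exact: holds_Row_edges.
  exact: holds_UtilLe.
- apply: holds_AllCourse_eq => y; apply: holds_Imp_eq; first exact: holds_Inc.
  exact: holds_CourseOk.
Qed.

Lemma holds_Touched s a b (r t : 'I_m) : ev s a = r -> ev s b = t ->
  holds s (Touched a b) = touched (edges_on mem EdgeTape) r t.
Proof.
move=> sa sb; apply: holds_Or_eq; first exact: holds_eq_ord.
by apply: holds_ExCourse_eq => x; apply: holds_Row_edges.
Qed.

Lemma holds_Good s a (r : 'I_m) : ev s a = r ->
  holds s (Good a) = good (@incident I) (@capacity I) (@avg_one I) (@avg_two I)
    (@grade_le I) (@TA_le I) (edges_on mem EdgeTape) r.
Proof.
move=> sa; apply: holds_AllTA_eq => t; apply: holds_Imp_eq; first exact: holds_Touched.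
apply: holds_And_eq; first exact: holds_Ok.
apply: holds_AllCourse_eq => y; apply: holds_Imp_eq; first exact: holds_Inc.
apply: holds_AllTA_eq => t'; apply: holds_Imp_eq; first exact: holds_Inc.
exact: holds_Touched.
Qed.

Lemma holds_FinalOk s : holds s FinalOk = mefe_ok (edges_on mem ResultTape).
Proof.
apply: holds_And_eq; first by apply: holds_AllTA_eq => t; apply: holds_Ok.
by apply: holds_AllCourse_eq => y; apply: holds_ExTA_eq => t; apply: holds_Inc.
Qed.

(** Leaving the TA unassigned is the additional last value of a loop over [n + 1] options. *)
Definition option_code (o : option 'I_n) : nat := if o is Some x then x else n.

Lemma holds_eq_option s a b (x : 'I_n) o : ev s a = x -> ev s b = option_code o ->
  holds s (Eq a b) = (Some x == o).
Proof.
move=> sa sb; rewrite holds_Eq // sa sb; case: o {sb} => [y|] //=.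
by apply/negbTE; rewrite neq_ltn ltn_ord.
Qed.

Lemma holds_Forced s a b c d (r t : 'I_m) (o : option 'I_n) (x : 'I_n) :
  ev s a = r -> ev s b = option_code o -> ev s c = t -> ev s d = x ->
  holds s (Forced a b c d) =
    forced (@incident I) (@capacity I) (edges_on mem EdgeTape) r o t x.
Proof.
move=> sa sb sc sd; apply: holds_And_eq; first exact: holds_Inc.
apply: holds_Or_eq; first exact: holds_Row_edges.
apply: holds_Or_eq; first by apply: holds_And_eq; [apply: holds_eq_ord|apply: holds_eq_option].
apply: holds_ExTA_eq => t'; apply: holds_And_eq; first by apply: holds_Not_eq; apply: holds_eq_ord.
apply: holds_And_eq; first exact: holds_Inc.
apply: holds_Or_eq.
  apply: holds_ExCourse_eq => z; apply: holds_And_eq; first exact: holds_Row_edges.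
  by apply: holds_Not_eq; apply: holds_eq_ord.
apply: holds_Or_eq; apply: holds_And_eq.
- exact: holds_eq_ord.
- by apply: holds_Not_eq; apply: holds_eq_option.
- exact: holds_Row_edges.
- exact: holds_Cap2.
Qed.

End Specification.

(** * The program and its array updates *)

Fixpoint reads_not (r : region) (e : expr) : bool :=
  match e with
  | Var _ | Zero | Top => true
  | Succ e | Pred e | Ren _ e => reads_not r e
  | Ite a b c | Fold a b c => [&& reads_not r a, reads_not r b & reads_not r c]
  | Bind a b => reads_not r a && reads_not r b
  | Look r' _ e => (r' != r) && reads_not r e
  end.

Lemma eval_reads_not L mem mem' r e s : reads_not r e ->
  (forall r', r' != r -> mem r' =1 mem' r') -> eval L mem s e = eval L mem' s e.
Proof.
move=> + E; elim: e s => //=.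
- by move=> e IH s /IH->.
- by move=> e IH s /IH->.
- by move=> a IHa b IHb c IHc s /and3P[/IHa-> /IHb-> /IHc->].
- by move=> a IHa b IHb s /andP[/IHa-> /IHb->].
- by move=> f e IH s /IH.
- move=> a IHa b IHb c IHc s /and3P[/IHa-> /IHb-> nc].
  by apply: eq_iteri => j y; apply: IHc.
- by move=> r' x e IH s /andP[/E-> /IH->].
Qed.

Definition PSkip := PFor Zero (PEmit Sep).
Definition PSet r e := PFor Top (PWrite r (Var 0) e).

(** Under the quantifiers, variables 0 and 1 are course and TA, 2 is the entry being written, 3 the
    propagation round, 4 the option and 5 the root. *)
Definition ForcedEntry := Ex TANum (Ex CourseNum
  (And (Eq (Var 2) (Edge (Var 1) (Var 0))) (Forced (Var 5) (Var 4) (Var 1) (Var 0)))).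
(** [propagate] updates all entries simultaneously and each may depend on any old entry, so the new
    array is built on a separate tape before it is copied. *)
Definition Propagate :=
  PSeq (PSet NewTape ForcedEntry) (PSet EdgeTape (Look NewTape (Bit true) (Var 0))).

(* Variable 1 is the TA and variable 0 the option of the candidate. *)
Definition Acceptable := And (Not (Look CoveredTape (Bit true) (Var 1))) (Good (Var 1)).
Definition ResultEntry := Or (Look ResultTape (Bit true) (Var 0)) (Look EdgeTape (Bit true) (Var 0)).
Definition CoveredEntry := Or (Look CoveredTape (Bit true) (Var 0)) (Touched (Var 2) (Var 0)).
Definition Accept := PSeq (PSet ResultTape ResultEntry) (PSet CoveredTape CoveredEntry).
Definition TryCandidate :=
  PSeq (PSet EdgeTape Zero) (PSeq (PFor Top Propagate) (PIf Acceptable Accept PSkip)).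

Definition Search := PFor TANum (PFor (Succ CourseNum) TryCandidate).

Definition Code :=
  Fold CourseNum Zero (Ite (Row ResultTape (Var 2) (Var 1)) (Succ (Var 1)) (Var 0)).
(** The code halved once per bit position: its parity is the bit to emit, and 0 means that the
    expansion has ended, so that no leading zeros appear. *)
Definition Shifted := Fold (Var 0) (Ren succn Code) (Half (Var 0)).
Definition EmitTA :=
  PSeq (PFor Top (PIf Shifted (PIf (Odd Shifted) (PEmit (Bit true)) (PEmit (Bit false))) PSkip))
       (PEmit Sep).
Definition Answer :=
  PIf FinalOk (PSeq (PEmit (Bit true)) (PFor TANum EmitTA)) (PEmit (Bit false)).
Definition Program := PSeq Search Answer.

Lemma iteri_invariant (T : Type) (P : nat -> T -> Prop) (f : nat -> T -> T) n x :
  P 0 x -> (forall i y, i < n -> P i y -> P i.+1 (f i y)) -> P n (iteri n f x).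
Proof.
move=> P0 step; suff H k : k <= n -> P k (iteri k f x) by exact: H.
by elim: k => //= k IH kn; apply: step => //; apply: IH; apply: ltnW.
Qed.

Lemma iteriS (T : Type) n (f : nat -> T -> T) x : iteri n.+1 f x = f n (iteri n f x).
Proof. by []. Qed.

Lemma foldl_map (S T T' : Type) (f : S -> T -> S) (h : T' -> T) x s :
  foldl f x (map h s) = foldl (fun y a => f y (h a)) x s.
Proof. by elim: s x => /=. Qed.

Lemma iteri_foldl (T : Type) (f : nat -> T -> T) n x :
  iteri n f x = foldl (fun y (i : 'I_n) => f i y) x (enum 'I_n).
Proof.
rewrite -(foldl_map (fun y i => f i y) val) val_enum_ord; elim: n => // n IH.
by rewrite -[X in iota _ X]addn1 iotaD foldl_cat -IH.
Qed.

(** The array is overwritten in place. The hypothesis asks that entry [i] be insensitive to changes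
    of [r] elsewhere: [e] may consult [r] at [i], which is still the old value when it is read. *)
Lemma run_PSet L r e s mem out :
  (forall mem' i, i < L -> (forall r', r' != r -> mem' r' =1 mem r') -> mem' r i = mem r i ->
     holds L mem' (scons i s) e = holds L mem (scons i s) e) ->
  let st := run L (PSet r e) s (mem, out) in
  [/\ forall r', r' != r -> st.1 r' =1 mem r',
      forall i, i < L -> st.1 r i = flag (holds L mem (scons i s) e) & st.2 = out].
Proof.
move=> stable st.
pose P k (st : memory * seq letter) :=
  [/\ forall r', r' != r -> st.1 r' =1 mem r',
      forall i, i < k -> st.1 r i = flag (holds L mem (scons i s) e),
      forall i, k <= i -> st.1 r i = mem r i & st.2 = out].
have [] : P L st; last by split.
rewrite /st /=; apply: iteri_invariant; first by split.
move=> k [mem1 out1] kL [/= H1 H2 H3 H4]; split=> //= [r' nr i|i|i ki].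
- by rewrite /set_mem (negbTE nr) H1.
- rewrite ltnS leq_eqVlt /set_mem eqxx /= => /orP[/eqP->|ik].
    rewrite eqxx -/(holds L mem1 (scons k s) e) stable //.
    exact: H3.
  by rewrite (ltn_eqF ik) H2.
- by rewrite /set_mem eqxx /= (gtn_eqF ki) H3 // ltnW.
Qed.

(** * Correctness of the program *)

Section Correctness.
Variable I : instance.
Let w := enc_instance I.
Let L := 8 * size w + 1.
Local Notation m := (nTAs I).
Local Notation n := (ncourses I).
Local Notation reads_input mem := (forall i, mem InputTape i = nth None (map Some w) i).
Local Notation edges_on mem r := (@edges_on I mem r).

Let bounds : [/\ n < L, m < L & m * n < L].
Proof. by have [] := bounds I. Qed.

Let edge_L (t : 'I_m) (x : 'I_n) : t * n + x < L.
Proof. by have [_ _ mn] := bounds; apply: ltn_trans (edge_lt t x) mn. Qed.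

Definition covered (mem : memory) : {set 'I_m} :=
  [set t | mem CoveredTape (nat_of_ord t) == Some (Bit true)].

Lemma eq_flag b : (flag b == Some (Bit true)) = b.
Proof. by case: b. Qed.

Definition preserves (mem mem' : memory) (rs : seq region) :=
  forall r, r \in rs -> mem' r =1 mem r.

Lemma edges_on_preserved mem mem' r : mem' r =1 mem r -> edges_on mem' r = edges_on mem r.
Proof. by move=> E; apply/setP => p; rewrite !inE E. Qed.

Lemma run_Propagate s mem out (r : 'I_m) (o : option 'I_n) :
  reads_input mem -> s 1 = option_code o -> s 2 = r ->
  let st := run L Propagate s (mem, out) in
  [/\ preserves mem st.1 [:: InputTape; ResultTape; CoveredTape],
      edges_on st.1 EdgeTape = propagate (@incident I) (@capacity I) r o (edges_on mem EdgeTape)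
    & st.2 = out].
Proof.
move=> inp s1 s2 st.
have [|] := @run_PSet L NewTape ForcedEntry s mem out.
  move=> mem' i iL E _; rewrite /holds (@eval_reads_not L mem' mem NewTape) //.
have -> : st = run L (PSet EdgeTape (Look NewTape (Bit true) (Var 0))) s
    (run L (PSet NewTape ForcedEntry) s (mem, out)) by [].
move: (run L (PSet NewTape ForcedEntry) s (mem, out)) => [mem1 out1] P1 E1 out1E.
simpl in P1, E1, out1E.
have [|] := @run_PSet L EdgeTape (Look NewTape (Bit true) (Var 0)) s mem1 out1.
  by move=> mem' i iL E _; rewrite !holds_Look E.
move: (run L (PSet EdgeTape _) s (mem1, out1)) => [mem2 out2] /= P2 E2 out2E.
split; last by rewrite out2E.
  by move=> r'; rewrite !inE => /or3P[] /eqP-> i; rewrite P2 // P1.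
apply/setP => -[t x]; rewrite !inE /= E2 // eq_flag holds_Look /= E1 // eq_flag.
rewrite (holds_Ex _ (eval_TANum inp _)); apply/existsP/idP => [[t' /=]|F].
  rewrite (holds_Ex _ (eval_CourseNum inp _)) => /existsP[x'].
  rewrite holds_And holds_Eq ?(@eval_Edge I mem inp _ _ _ t' x') //; last by rewrite /L; lia.
  case/andP=> /= /eqP eq_tx.
  have [-> ->] : t = t' /\ x = x'.
    have xn := ltn_ord x; have xn' := ltn_ord x'.
    (* Division by [n] decodes the row-major index. *)
    have tt' : nat_of_ord t = t'.
      have := congr1 (divn^~ n) eq_tx.
      have n0 : 0 < n := leq_ltn_trans (leq0n _) xn.
      by rewrite /= !divnMDl // !divn_small // !addn0.
    split; apply: ord_inj => //.
    by move: eq_tx; rewrite tt' => /addnI.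
  by rewrite (holds_Forced inp (r := r) (o := o) (t := t') (x := x')).
exists t; rewrite (holds_Ex _ (eval_CourseNum inp _)); apply/existsP; exists x.
rewrite holds_And holds_Eq ?(@eval_Edge I mem inp _ _ _ t x) //; last by rewrite /L; lia.
by rewrite eqxx (holds_Forced inp (r := r) (o := o) (t := t) (x := x)).
Qed.


Local Notation process := (process (@incident I) (@capacity I) (@avg_one I) (@avg_two I)
  (@grade_le I) (@TA_le I)).

(** Simulation relation between the memory and the abstract state of [process]; the edge tape is
    absent because each candidate begins by clearing it. *)
Definition tracks (st : memory * seq letter) (RC : {set 'I_m * 'I_n} * {set 'I_m}) :=
  [/\ reads_input st.1, edges_on st.1 ResultTape = RC.1, covered st.1 = RC.2 & st.2 = [::]].

Lemma run_closure s mem out (r : 'I_m) (o : option 'I_n) :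
  reads_input mem -> s 0 = option_code o -> s 1 = r -> edges_on mem EdgeTape = set0 ->
  let st := run L (PFor Top Propagate) s (mem, out) in
  [/\ preserves mem st.1 [:: InputTape; ResultTape; CoveredTape],
      edges_on st.1 EdgeTape = closure (@incident I) (@capacity I) L r o
    & st.2 = out].
Proof.
move=> inp s0 s1 E0 st.
pose P k (st : memory * seq letter) :=
  [/\ preserves mem st.1 [:: InputTape; ResultTape; CoveredTape],
      edges_on st.1 EdgeTape = closure (@incident I) (@capacity I) k r o
    & st.2 = out].
have -> : st = iteri L (fun j st => run L Propagate (scons j s) st) (mem, out) by [].
apply: (@iteri_invariant _ P); first by split.
move=> k [mem1 out1] _ [H1 H2 out1E]; simpl in H1, H2, out1E; rewrite {}out1E.
have inp1 : reads_input mem1 by move=> i; rewrite H1 ?inE.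
have [] := @run_Propagate (scons k s) mem1 out r o inp1 s0 s1.
move: (run L Propagate (scons k s) (mem1, out)) => [mem2 out2] /= P1 E1 out1E; split=> //=.
  by move=> r' r'in i; rewrite P1 ?H1.
by rewrite E1 H2.
Qed.

Lemma run_TryCandidate s st (RC : {set 'I_m * 'I_n} * {set 'I_m}) (r : 'I_m) (o : option 'I_n) :
  s 0 = option_code o -> s 1 = r -> tracks st RC ->
  tracks (run L TryCandidate s st) (process L RC (r, o)).
Proof.
move=> s0 s1; case: st RC => mem out [R C] [inp RE CE outE].
simpl in inp, RE, CE, outE; rewrite {}outE.
have -> : run L TryCandidate s (mem, [::]) =
    run L (PIf Acceptable Accept PSkip) s (run L (PFor Top Propagate) s
      (run L (PSet EdgeTape Zero) s (mem, [::]))) by [].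
have [//|] := @run_PSet L EdgeTape Zero s mem [::].
move: (run L (PSet EdgeTape Zero) s (mem, [::])) => [mem1 out1] P1 E1 out1E.
simpl in P1, E1, out1E; rewrite {}out1E.
have inp1 : reads_input mem1 by move=> i; rewrite P1.
have set1 : edges_on mem1 EdgeTape = set0 by apply/setP => p; rewrite !inE E1.
have [] := run_closure [::] inp1 s0 s1 set1.
move: (run L (PFor Top Propagate) s (mem1, [::])) => [mem2 out2] P2 E2 out2E.
simpl in P2, E2, out2E; rewrite {}out2E.
have inp2 : reads_input mem2 by move=> i; rewrite P2 ?inE.
have {}RE : edges_on mem2 ResultTape = R.
  by rewrite -RE; apply: edges_on_preserved => i; rewrite P2 ?P1 ?inE.
have {}CE : covered mem2 = C.
  by rewrite -CE; apply/setP => t; rewrite !inE P2 ?P1 ?inE.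
rewrite /process [(r, o).1]/= [(r, o).2]/= [(R, C).1]/= [(R, C).2]/= -E2 -CE.
have cE : (eval L mem2 s Acceptable != 0) = (r \notin covered mem2) && good (@incident I) (@capacity I)
    (@avg_one I) (@avg_two I) (@grade_le I) (@TA_le I) (edges_on mem2 EdgeTape) r.
  apply: holds_And_eq; last exact: holds_Good.
  by apply: holds_Not_eq; rewrite holds_Look /= s1 inE.
have -> : run L (PIf Acceptable Accept PSkip) s (mem2, [::]) =
  if eval L mem2 s Acceptable != 0 then run L Accept s (mem2, [::]) else (mem2, [::]) by [].
rewrite {}cE; case: ifP => _; last by split; rewrite //= CE.
have -> : run L Accept s (mem2, [::]) = run L (PSet CoveredTape CoveredEntry) s
  (run L (PSet ResultTape ResultEntry) s (mem2, [::])) by [].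
have [|] := @run_PSet L ResultTape ResultEntry s mem2 [::].
  by move=> mem' i iL E Ei; rewrite !holds_Or !holds_Look /= Ei E.
move: (run L (PSet ResultTape ResultEntry) s (mem2, [::])) => [mem3 out3] P3 E3 out3E.
simpl in P3, E3, out3E; rewrite {}out3E.
have [|] := @run_PSet L CoveredTape CoveredEntry s mem3 [::].
  (* The covered tape is read only at the entry being written; [Touched] reads the edge tape. *)
  move=> mem' i iL E Ei; rewrite [LHS]holds_Or [RHS]holds_Or !holds_Look.
  congr (_ || _); first by rewrite /= Ei.
  by rewrite /holds (@eval_reads_not L mem' mem3 CoveredTape).
move: (run L (PSet CoveredTape CoveredEntry) s (mem3, [::])) => [mem4 out4] P4 E4 out4E.
simpl in P4, E4, out4E.
have inp3 : reads_input mem3 by move=> i; rewrite P3.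
split=> //=.
- by move=> i; rewrite P4.
- rewrite -RE; apply/setP => -[t x]; rewrite !inE /= P4 // E3 // eq_flag.
  by rewrite holds_Or !holds_Look.
- apply/setP => t; have tL : t < L by have [_ mL _] := bounds; apply: ltn_trans (ltn_ord t) mL.
  rewrite !inE E4 // eq_flag holds_Or holds_Look /= P3 //; congr (_ || _).
  rewrite (holds_Touched inp3 (r := r) (t := t)) //.
  by rewrite (@edges_on_preserved mem2 mem3) // => i; rewrite P3.
Qed.

(** [None] comes last because its code [n] belongs to the last round of the inner loop. *)
Definition candidates : seq ('I_m * option 'I_n) :=
  [seq (r, o) | r <- enum 'I_m, o <- rcons (map Some (enum 'I_n)) None].

Lemma mem_candidates c : c \in candidates.
Proof.
case: c => r o; apply/allpairsP; exists (r, o); split=> //=; first by rewrite mem_enum.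
rewrite mem_rcons inE; case: o => [x|] //=; rewrite mem_map ?mem_enum // => y z [].
exact.
Qed.

Lemma foldl_tracks (A : eqType) (f : memory * seq letter -> A -> memory * seq letter)
    (g : {set 'I_m * 'I_n} * {set 'I_m} -> A -> {set 'I_m * 'I_n} * {set 'I_m}) xs st RC :
  (forall x st RC, tracks st RC -> tracks (f st x) (g RC x)) ->
  tracks st RC -> tracks (foldl f st xs) (foldl g RC xs).
Proof. by move=> fg; elim: xs st RC => //= x xs IH st RC /(fg x)/IH. Qed.

Lemma run_Search s : tracks (run L Search s (initial_memory w, [::]))
  (foldl (process L) (set0, set0) candidates).
Proof.
have init : tracks (initial_memory w, [::]) (set0, set0).
  by split=> //=; apply/setP => p; rewrite !inE.
have -> : foldl (process L) (set0, set0) candidates =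
    foldl (fun RC r => foldl (fun RC o => process L RC (r, o)) RC
      (rcons (map Some (enum 'I_n)) None)) (set0, set0) (enum 'I_m).
  rewrite /candidates; elim: (enum 'I_m) (set0, set0) => //= r rs IH RC.
  by rewrite foldl_cat IH foldl_map.
have -> : run L Search s (initial_memory w, [::]) = iteri (eval L (initial_memory w) s TANum)
    (fun r st => run L (PFor (Succ CourseNum) TryCandidate) (scons r s) st)
    (initial_memory w, [::]) by [].
have [inp _ _ _] := init.
rewrite (eval_TANum inp) iteri_foldl; apply: foldl_tracks init => r st RC.
move=> tr; have [inp' _ _ _] := tr.
have -> : run L (PFor (Succ CourseNum) TryCandidate) (scons r s) st =
  iteri (eval L st.1 (scons r s) (Succ CourseNum))
    (fun o st => run L TryCandidate (scons o (scons r s)) st) st by [].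
have [nL _ _] := bounds.
rewrite (@eval_succ I st.1 (scons r s) _ n) ?(eval_CourseNum inp') // addn1.
rewrite iteriS iteri_foldl foldl_rcons foldl_map.
apply: (run_TryCandidate (o := None)) => //.
by apply: foldl_tracks tr => x st' RC' tr'; apply: (run_TryCandidate (o := Some x)).
Qed.


Lemma eval_Code (s : nat -> nat) mem (t : 'I_m) : reads_input mem -> s 0 = t ->
  (forall t', single (edges_on mem ResultTape) t') ->
  eval L mem s Code =
    if matching_of (edges_on mem ResultTape) t is Some x then (nat_of_ord x).+1 else 0.
Proof.
move=> inp s0 sg; rewrite eval_Fold (eval_CourseNum inp).
pose P k acc := acc = if matching_of (edges_on mem ResultTape) t is Some x then
                        if x < k then (nat_of_ord x).+1 else 0 else 0.
have -> : (if matching_of (edges_on mem ResultTape) t is Some x then (nat_of_ord x).+1 else 0) =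
    if matching_of (edges_on mem ResultTape) t is Some x then
      if x < n then (nat_of_ord x).+1 else 0 else 0.
  by case: (matching_of _ _) => // x; rewrite ltn_ord.
apply: (@iteri_invariant _ P); first by rewrite /P; case: (matching_of _ _).
move=> k acc kn; rewrite /P => ->; set acc0 := if _ is Some x then _ else _.
rewrite eval_Ite -[eval L mem _ (Succ _)]/(minn k.+1 L) -[eval L mem _ (Var 0)]/acc0.
rewrite (holds_Row_edges inp ResultTape (t := t) (x := Ordinal kn)) //.
rewrite -matching_of_graph // /acc0.
case: (matching_of _ t) => [x|] //.
have -> : (Some x == Some (Ordinal kn)) = (x == k :> nat) by [].
have -> : minn k.+1 L = k.+1.
  by apply/minn_idPl; have [nL _ _] := bounds; apply: leq_trans kn (ltnW nL).
by rewrite ltnS; case: (ltngtP x k) => // ->.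
Qed.

Lemma nat_bits_rec v : nat_bits v = if v == 0 then [::] else odd v :: nat_bits v./2.
Proof.
case: (posnP v) => [->//|v0].
have [p ->] : exists p, v = nat_of_pos p.
  by rewrite -(bin_of_natK v) in v0 *; case: (bin_of_nat v) v0 => // p _; exists p.
have bitsE q : nat_bits (nat_of_pos q) = positive_bits q.
  by rewrite /nat_bits -[nat_of_pos q]/(nat_of_bin (BinNums.Npos q)) nat_of_binK.
rewrite bitsE.
case: p => [q|q|] //=; rewrite NatTrec.doubleE /= ?odd_double ?uphalf_double ?doubleK bitsE //.
Qed.

Lemma size_nat_bits v i : (i < size (nat_bits v)) = (iter i half v != 0).
Proof.
elim: i v => [|i IH] v.
  by rewrite size_nat_bits_gt0 lt0n.
rewrite iterSr -IH nat_bits_rec; case: eqP => [->|_] //=.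
Qed.

Lemma nth_nat_bits v i : nth false (nat_bits v) i = odd (iter i half v).
Proof.
elim: i v => [|i IH] v; rewrite nat_bits_rec; case: eqP => [->|_] //=.
  by have -> : iter i half 0 = 0 by elim: i {IH} => //= i ->.
by rewrite IH -iterSr.
Qed.

Lemma iter_half_le i v : iter i half v <= v - i.
Proof. by elim: i => [|i IH] /=; rewrite ?subn0 // -divn2; lia. Qed.

Lemma run_EmitTA (s : nat -> nat) mem out (t : 'I_m) : reads_input mem -> s 0 = t ->
  (forall t', single (edges_on mem ResultTape) t') ->
  run L EmitTA s (mem, out) = (mem, out ++ enc_nat
    (if matching_of (edges_on mem ResultTape) t is Some x then (nat_of_ord x).+1 else 0)).
Proof.
move=> inp s0 sg; rewrite -(eval_Code inp s0 sg); set v := eval L mem s Code.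
have vL : v <= L.
  rewrite /v (eval_Code inp s0 sg); case: (matching_of _ _) => // x.
  by have [nL _ _] := bounds; apply: leq_trans (ltn_ord x) (ltnW nL).
have shift i : eval L mem (scons i s) Shifted = iter i half v.
  rewrite eval_Fold -[eval L mem _ (Var 0)]/i -[eval L mem _ (Ren _ _)]/v.
  elim: i => // i IH; rewrite iteriS iterS.
  have e : eval L mem (scons (iter i half v) (scons i (scons i.+1 s))) (Half (Var 0)) =
      (iter i half v)./2.
    apply: eval_Half; first by rewrite /L addn1.
    by apply: leq_trans (iter_half_le i v) _; apply: leq_trans (leq_subr _ _) vL.
  by rewrite -e /= -IH.
(* So [L] rounds suffice to emit all bits. *)
have size_v : size (nat_bits v) <= L.
  rewrite leqNgt size_nat_bits negbK -leqn0; apply: leq_trans (iter_half_le L v) _.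
  by rewrite leqn0 subn_eq0.
pose bits := PIf Shifted (PIf (Odd Shifted) (PEmit (Bit true)) (PEmit (Bit false))) PSkip.
pose P k (st : memory * seq letter) := st = (mem, out ++ map Bit (take k (nat_bits v))).
have loop : P L (run L (PFor Top bits) s (mem, out)).
  have -> : run L (PFor Top bits) s (mem, out) =
    iteri L (fun j st => run L bits (scons j s) st) (mem, out) by [].
  apply: (@iteri_invariant _ P); first by rewrite /P take0 cats0.
  move=> k _ kL ->; rewrite /P; set out1 := out ++ _.
  have -> : run L bits (scons k s) (mem, out1) =
      if eval L mem (scons k s) Shifted != 0 then
        if holds L mem (scons k s) (Odd Shifted) then (mem, rcons out1 (Bit true))
        else (mem, rcons out1 (Bit false))
      else (mem, out1) by [].
  rewrite holds_Odd; last by rewrite /L addn1.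
  rewrite shift -size_nat_bits -nth_nat_bits /out1; case: ltnP => kv.
    by rewrite (take_nth false kv) map_rcons -rcons_cat; case: (nth _ _ _).
  by rewrite !take_oversize // ltnW.
have -> : run L EmitTA s (mem, out) =
    run L (PEmit Sep) s (run L (PFor Top bits) s (mem, out)) by [].
by rewrite loop take_oversize // [run _ _ _ _]/= rcons_cat.
Qed.

Hypothesis degree_le2 : forall x : 'I_n, degree x <= 2.

Lemma run_Answer s mem R C : tracks (mem, [::]) (R, C) -> within (@incident I) R ->
  (run L Answer s (mem, [::])).2 =
    enc_answer (if mefe_ok R then Some (matching_of R) else None).
Proof.
move=> [inp RE _ _]; simpl in inp, RE => W.
have -> : run L Answer s (mem, [::]) = if holds L mem s FinalOk
    then run L (PFor TANum EmitTA) s (mem, [:: Bit true]) else (mem, [:: Bit false]) by [].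
rewrite (holds_FinalOk inp) RE; case: ifP => // okR.
have sg t : single (edges_on mem ResultTape) t.
  by rewrite RE; case/andP: okR => /forallP/(_ t)/and3P[].
have -> : run L (PFor TANum EmitTA) s (mem, [:: Bit true]) =
  iteri (eval L mem s TANum) (fun j st => run L EmitTA (scons j s) st) (mem, [:: Bit true]) by [].
rewrite (eval_TANum inp) iteri_foldl.
rewrite -[enc_answer _]/([:: Bit true] ++ enc_matching (matching_of R)) /enc_matching.
elim: (enum 'I_m) [:: Bit true] => [|t ts IH] out; first by rewrite cats0.
rewrite [foldl _ _ _]/(foldl _ (run L EmitTA (scons t s) (mem, out)) ts).
by rewrite (run_EmitTA _ inp (t := t)) // RE IH -catA.
Qed.

(** A positive answer is justified by the final test together with the [within] part of the
    invariant, a negative one by completeness of the candidates. *)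
Lemma run_Program s : exists2 r : option (matching I),
  (run L Program s (initial_memory w, [::])).2 = enc_answer r & correct_answer r.
Proof.
have K_large : #|{: 'I_m * 'I_n}| <= L.
  by rewrite card_prod !card_ord; have [_ _ mn] := bounds; apply: ltnW.
have := run_Search s; set RC := foldl _ _ _; move=> tr.
have inv : invariant (@incident I) (@capacity I) (@avg_one I) (@avg_two I)
    (@grade_le I) (@TA_le I) RC.
  rewrite /RC; have : invariant (@incident I) (@capacity I) (@avg_one I) (@avg_two I)
      (@grade_le I) (@TA_le I) (set0, set0).
    by split=> [t|t|t|t]; rewrite ?inE //= => y; rewrite inE.
  elim: candidates (set0, set0) => //= c cs IH RC0 inv0.
  exact/IH/process_invariant.
case: inv => _ W _ _.
exists (if mefe_ok RC.1 then Some (matching_of RC.1) else None).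
  have -> : run L Program s (initial_memory w, [::]) =
    run L Answer s (run L Search s (initial_memory w, [::])) by [].
  case: (run L Search s _) tr => mem out tr; have [_ _ _ outE] := tr.
  simpl in outE; rewrite {}outE in tr *.
  exact: (@run_Answer s mem RC.1 RC.2 tr W).
(* If a MEFE matching existed, its graph would play the role of [S] and force the final test to
   succeed. *)
case: ifP => [|/negP no]; first exact: graph_MEFE.
move=> [mu /(MEFE_graph degree_le2)[Wmu okmu]]; apply: no.
apply: (process_all K_large Wmu okmu) mem_candidates.
exact: (incident_two degree_le2).
Qed.

End Correctness.

Theorem corollary1 :
  exists (M : machine) (p : {poly nat}),
    forall I : instance,
      (forall x : 'I_(ncourses I), degree x <= 2) ->
      exists (t : nat) (r : option (matching I)),
        [/\ t <= (p.[size (enc_instance I)])%R,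
            halts_within M (enc_instance I) t (enc_answer r)
          & correct_answer r].
Proof.
have [M [p H]] := program_machine Program; exists M, p => I deg.
(* [s] is whatever environment the machine starts with; [run_Program] covers all of them. *)
have [t [s [t_le run_t]]] := H (enc_instance I).
have [r out_r r_ok] := run_Program deg s.
by exists t, r; split=> //; rewrite -out_r.
Qed.
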